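(* Assume $\dim E<\infty$ and $\dim F=1$. If $N$ is a non-splitting invariant subspace of $S_E\oplus S_F^*$, then there is $\Phi\in\Gamma_{E\oplus F}^\infty$ such that $V_\Phi$ is a partial isometry and $N=R(V_\Phi)$.
   Context: $E$ and $F$ are complex separable Hilbert spaces. $L_E^2$ is the space of square integrable $E$-valued functions on the unit circle $\mathbb T$ and $H_E^2\subset L_E^2$ the $E$-valued Hardy space. $L^\infty_{B(E,F)}$ is the space of bounded measurable functions on $\mathbb T$ with values in $B(E,F)$ (bounded operators from $E$ to $F$), and $H^\infty_{B(E,F)}$ the bounded analytic ones; $B(E)=B(E,E)$. $P$ is the orthogonal projection of a vector-valued $L^2$ space onto the corresponding $H^2$. $S_E=T_z$ is the shift (multiplication by $z$) on $H_E^2$. Invariant subspaces are closed. For $\Phi\in L^\infty_{B(E,F)}$ the Toeplitz operator $T_\Phi:H_E^2\to H_F^2$ is $T_\Phi h=P[\Phi h]$, and the Hankel operator $H_\Phi:H_E^2\to H_F^2$ is $H_\Phi h=PJ[\Phi h]$, where $Jf(z)=\overline z f(\overline z)$ for $f\in L_F^2$. (Likewise for other pairs of spaces.) $\Gamma^\infty_{E\oplus F}$ is the set of all symbols $$\Phi(z)=\begin{bmatrix} A(z)&B(z)\\ C(z)&D(z)\end{bmatrix}:E\oplus F\to E\oplus F$$ with $A\in H^\infty_{B(E)}$, $B\in H^\infty_{B(F,E)}$, $C\in L^\infty_{B(E,F)}$, $D\in L^\infty_{B(F)}$. For such $\Phi$, $$V_\Phi=\begin{bmatrix} T_A&T_B\\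 H_C&H_D\end{bmatrix}:H_E^2\oplus H_F^2\to H_E^2\oplus H_F^2 ,$$ and $R(V_\Phi)$ is its range. An operator $G$ is a partial isometry if it maps $\ker(G)^\perp$ isometrically onto its range. An invariant subspace $N$ of $S_E\oplus S_F^*$ is called splitting if there exist direct (orthogonal) sum decompositions $E=E_1\oplus E_2$, $F=F_1\oplus F_2$, where both $S_{E_1}\oplus S_{F_1}^*$ and $S_{E_2}\oplus S_{F_2}^*$ are not zero (i.e. $E_i\oplus F_i\neq\{0\}$ for $i=1,2$), and a unitary operator $V\in B(E\oplus F)$ (acting pointwise as a constant operator function, with $E\oplus F$ identified with $E_1\oplus F_1\oplus E_2\oplus F_2$) such that $$S_E\oplus S_F^*=V(S_{E_1}\oplus S_{F_1}^*\oplus S_{E_2}\oplus S_{F_2}^* )V^*,\qquad N=V(N_1\oplus N_2),$$ where $N_i$ is an invariant subspace of $S_{E_i}\oplus S_{F_i}^*$ for $i=1,2$. Non-splitting means not splitting.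
   Formalization: E is assumed nonzero; for E = {0} the claim fails with N = H^2_F, which is non-splitting, while a partially isometric Hankel operator H_D onto H^2_F would make H_D^* an isometry with H_D^* S^n = S^{*n} H_D^* tending to 0 strongly. *)

(* Defs.v *)
From HB Require Import structures.
From mathcomp Require Import all_boot all_order all_algebra.
From mathcomp Require Import sesquilinear complex.
From mathcomp Require Import all_classical all_reals all_analysis.

Set Implicit Arguments.
Unset Strict Implicit.
Unset Printing Implicit Defensive.

Import Order.TTheory GRing.Theory Num.Def Num.Theory.
Import numFieldNormedType.Exports.

Local Open Scope classical_set_scope.
Local Open Scope ring_scope.
Local Open Scope complex_scope.

(* Finite-dimensional complex Hilbert spaces are vector spaces                *)
(* E : vectType R[i] with a positive definite hermitian form                  *)
(* dE : {dot E for conjC}, linear in its first argument. Elements of L^2 and  *)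
(* L^oo are handled through representatives: functions on the circle,         *)
(* considered up to a.e. equality. The circle is parametrized by t |-> e^(it).*)

Definition circle (R : realType) := {z : R[i] | `|z| == 1}.

Section Circle.
Variable R : realType.

Lemma expi_subproof (t : R) : `|cos t +i* sin t| == 1 :> R[i].
Proof. by rewrite eq_complex /= cos2Dsin2 sqrtr1 !eqxx. Qed.

Definition expi (t : R) : circle R := exist _ (cos t +i* sin t) (expi_subproof t).

Lemma circle_conj_subproof (z : circle R) : `|(val z)^*| == 1.
Proof. by rewrite normcJ (valP z). Qed.

Definition circle_conj (z : circle R) : circle R :=
  exist _ (val z)^* (circle_conj_subproof z).

Definition circle_ae (P : circle R -> Prop) :=
  {ae lebesgue_measure, forall t : measurableTypeR R, P (expi t)}.

Definition ae_equal (X : Type) (f g : circle R -> X) :=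
  circle_ae (fun z => f z = g z).

Definition circle_measurable (f : circle R -> R[i]) :=
  measurable_fun setT (fun t : measurableTypeR R => complex.Re (f (expi t))) /\
  measurable_fun setT (fun t : measurableTypeR R => complex.Im (f (expi t))).

(* Integral against the normalized Lebesgue measure of the circle. *)
Definition circle_int (f : circle R -> R[i]) : R[i] :=
  let I (g : R -> R) :=
    (pi *+ 2)^-1 * Rintegral (@lebesgue_measure R) `[- pi, pi] g in
  I (fun t => complex.Re (f (expi t))) +i* I (fun t => complex.Im (f (expi t))).

(* k-th Fourier coefficient. *)
Definition fourier (f : circle R -> R[i]) (k : int) : R[i] :=
  circle_int (fun z => f z * val z ^ (- k)).

End Circle.

Section VectorSpaces.
Variable R : realType.
Variables (E : vectType R[i]) (dE : {dot E for conjC}).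

Definition vnorm (x : E) : R := Num.sqrt (complex.Re (dE x x)).

(* Weak measurability is measurability, E being separable. *)
Definition L2 (f : circle R -> E) :=
  (forall e, circle_measurable (fun z => dE (f z) e)) /\
  (\int[lebesgue_measure]_(t in `[(- pi)%R, pi])
     ((vnorm (f (expi t)) ^+ 2)%:E) < +oo)%E.

Definition L2_dot (f g : circle R -> E) : R[i] :=
  circle_int (fun z => dE (f z) (g z)).

(* f has analytic extension to the disc: its negative Fourier coefficients vanish. *)
Definition H2 (f : circle R -> E) :=
  L2 f /\ forall (k : int) (e : E), k < 0 -> fourier (fun z => dE (f z) e) k = 0.

(* The orthogonal projection of L^2 onto H^2 (a representative of it). *)
Definition proj_H2 (f : circle R -> E) : circle R -> E :=
  xget (fun=> 0) [set g | H2 g /\ forall h, H2 h -> L2_dot (f - g) h = 0].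

Definition shift (f : circle R -> E) : circle R -> E := fun z => val z *: f z.

(* The Hilbert space adjoint of [shift] on H^2 (a representative of it). *)
Definition shift_adj (f : circle R -> E) : circle R -> E :=
  xget (fun=> 0)
    [set g | H2 g /\ forall h, H2 h -> L2_dot (shift h) f = L2_dot h g].

(* Jf (z) = z^* f (z^* ) *)
Definition opJ (f : circle R -> E) : circle R -> E :=
  fun z => (val z)^* *: f (circle_conj z).

End VectorSpaces.

Section OperatorFunctions.
Variable R : realType.
Variables (E F : vectType R[i]) (dE : {dot E for conjC}) (dF : {dot F for conjC}).

Definition Linfty (A : circle R -> 'Hom(E, F)) :=
  (forall x y, circle_measurable (fun z => dF (A z x) y)) /\
  exists M : R, circle_ae (fun z => forall x, vnorm dF (A z x) <= M * vnorm dE x).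

Definition Hinfty (A : circle R -> 'Hom(E, F)) :=
  Linfty A /\ forall (k : int) x y, k < 0 ->
    fourier (fun z => dF (A z x) y) k = 0.

Definition toeplitz (A : circle R -> 'Hom(E, F)) (h : circle R -> E) :=
  proj_H2 dF (fun z => A z (h z)).

Definition hankel (A : circle R -> 'Hom(E, F)) (h : circle R -> E) :=
  proj_H2 dF (opJ (fun z => A z (h z))).

End OperatorFunctions.

Section DirectSum.
Variable R : realType.
Variables (E F : vectType R[i]) (dE : {dot E for conjC}) (dF : {dot F for conjC}).

Definition sumfun : Type := ((circle R -> E) * (circle R -> F))%type.

Implicit Types u v w : sumfun.

Definition sum_ae_equal u v := ae_equal u.1 v.1 /\ ae_equal u.2 v.2.

(* H^2_E (+) H^2_F *)
Definition H2sum : set sumfun := [set u | H2 dE u.1 /\ H2 dF u.2].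

Definition sum_dot u v : R[i] := L2_dot dE u.1 v.1 + L2_dot dF u.2 v.2.

Definition sum_norm u : R := Num.sqrt (complex.Re (sum_dot u u)).

(* S_E (+) S_F^* *)
Definition shift_sum u : sumfun := (shift u.1, shift_adj dF u.2).

(* Closedness, applied to constant sequences, makes N stable under a.e. equality. *)
Definition invariant_subspace (N : set sumfun) :=
  [/\ N `<=` H2sum,
      N ((fun=> 0), (fun=> 0)) /\
      (forall (a : R[i]) u v, N u -> N v ->
         N ((fun z => a *: u.1 z + v.1 z), (fun z => a *: u.2 z + v.2 z))),
      (forall (s : nat -> sumfun) u, (forall n, N (s n)) -> H2sum u ->
         (fun n => sum_norm ((s n).1 - u.1, (s n).2 - u.2)) @ \oo --> (0 : R) ->
         N u) &
      (forall u, N u -> N (shift_sum u))].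

Section Operators.
Variable G : sumfun -> sumfun.

Definition op_range : set sumfun :=
  [set u | H2sum u /\ exists2 h, H2sum h & sum_ae_equal u (G h)].

Definition op_ker : set sumfun :=
  [set h | H2sum h /\ sum_ae_equal (G h) ((fun=> 0), (fun=> 0))].

Definition op_ker_perp : set sumfun :=
  [set h | H2sum h /\ forall k, op_ker k -> sum_dot h k = 0].

Definition partial_isometry :=
  (forall h, op_ker_perp h -> sum_norm (G h) = sum_norm h) /\
  (forall u, op_range u -> exists2 h, op_ker_perp h & sum_ae_equal u (G h)).

End Operators.

Record symbol := Symbol {
  symA : circle R -> 'Hom(E, E);
  symB : circle R -> 'Hom(F, E);
  symC : circle R -> 'Hom(E, F);
  symD : circle R -> 'Hom(F, F) }.

Definition Gamma_infty (Phi : symbol) :=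
  [/\ Hinfty dE dE (symA Phi), Hinfty dF dE (symB Phi),
      Linfty dE dF (symC Phi) & Linfty dF dF (symD Phi)].

Definition V_op (Phi : symbol) (h : sumfun) : sumfun :=
  (toeplitz dE (symA Phi) h.1 + toeplitz dE (symB Phi) h.2,
   hankel dF (symC Phi) h.1 + hankel dF (symD Phi) h.2).

Definition unitary_op (V : 'End((E * F)%type)) :=
  (forall x y : E * F,
     dE (V x).1 (V y).1 + dF (V x).2 (V y).2 = dE x.1 y.1 + dF x.2 y.2) /\
  limg V = fullv.

(* V acting pointwise, as a constant operator function. *)
Definition const_op (V : 'End((E * F)%type)) u : sumfun :=
  ((fun z => (V (u.1 z, u.2 z)).1), (fun z => (V (u.1 z, u.2 z)).2)).

End DirectSum.

Section Subspaces.
Variable R : realType.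
Variables (E : vectType R[i]) (dE : {dot E for conjC}) (U : {vspace E}).

(* A subspace of E with the induced inner product. *)
Definition sub_dot (x y : subvs_of U) : R[i] := dE (vsval x) (vsval y).

Lemma sub_dot_bilinear :
  bilinear_for ( *%R ) (conjC \; *%R) sub_dot.
Proof.
by split=> [y a x x'|x a y y']; rewrite /sub_dot linearP // linearPl.
Qed.

HB.instance Definition _ :=
  bilinear_isBilinear.Build _ _ _ _ _ _ sub_dot sub_dot_bilinear.

Lemma sub_dot_hermitian x y :
  sub_dot x y = (-1) ^+ false * conjC (sub_dot y x).
Proof. exact: hermitian_subproof. Qed.

HB.instance Definition _ :=
  isHermitianSesquilinear.Build _ _ false conjC sub_dot sub_dot_hermitian.

Lemma sub_dot_gt0 x : x != 0 -> 0 < sub_dot x x.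
Proof.
move=> x0; apply: neq0_dnorm_gt0; apply: contra x0 => /eqP x0.
by apply/eqP/val_inj; rewrite /= x0.
Qed.

HB.instance Definition _ := isDotProduct.Build _ _ sub_dot sub_dot_gt0.

End Subspaces.

Section Splitting.
Variable R : realType.
Variables (E F : vectType R[i]) (dE : {dot E for conjC}) (dF : {dot F for conjC}).

Definition orth_decomp (X : vectType R[i]) (dX : {dot X for conjC})
    (X1 X2 : {vspace X}) :=
  (X1 + X2 = fullv)%VS /\ {in X1 & X2, forall x y, dX x y = 0}.

(* The identification of E1 (+) F1 (+) E2 (+) F2 with E (+) F, on functions. *)
Definition direct_merge (E1 E2 : {vspace E}) (F1 F2 : {vspace F})
    (u : sumfun (subvs_of E1) (subvs_of F1))
    (v : sumfun (subvs_of E2) (subvs_of F2)) : sumfun E F :=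
  ((fun z => vsval (u.1 z) + vsval (v.1 z)),
   (fun z => vsval (u.2 z) + vsval (v.2 z))).

(* The operator identity S_E (+) S_F^* = V W V^*, where W is the direct sum of *)
(* the four shifts, is written (S_E (+) S_F^* ) V = V W, V being unitary.      *)
Definition splitting (N : set (sumfun E F)) :=
  exists (E1 E2 : {vspace E}) (F1 F2 : {vspace F}) (V : 'End((E * F)%type)),
  let dE1 := @sub_dot R E dE E1 : {dot _ for conjC} in
  let dE2 := @sub_dot R E dE E2 : {dot _ for conjC} in
  let dF1 := @sub_dot R F dF F1 : {dot _ for conjC} in
  let dF2 := @sub_dot R F dF F2 : {dot _ for conjC} in
  [/\ orth_decomp dE E1 E2 /\ orth_decomp dF F1 F2,
      (0 < \dim E1 + \dim F1)%N /\ (0 < \dim E2 + \dim F2)%N,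
      unitary_op dE dF V,
      (forall u v, H2sum dE1 dF1 u -> H2sum dE2 dF2 v ->
         sum_ae_equal (shift_sum dF (const_op V (direct_merge u v)))
           (const_op V (direct_merge (shift_sum dF1 u) (shift_sum dF2 v)))) &
      exists N1 N2,
      [/\ invariant_subspace dE1 dF1 N1, invariant_subspace dE2 dF2 N2 &
          N = [set u | H2sum dE dF u /\ exists u1 u2,
                 [/\ N1 u1, N2 u2 & sum_ae_equal u (const_op V (direct_merge u1 u2))]]]].

End Splitting.

(* Main.v *)
(* The operator J identifies H^2_F with the orthogonal complement of H^2_F in L^2_F, and
   S_F^* with the compression of multiplication by z. Hence N lifts to a closed z-invariant
   subspace M of H^2_E (+) L^2_F containing 0 (+) H^2_F. Let M_inf be the intersection of
   the z^n M, a z-reducing subspace of 0 (+) L^2_F. As F is a line, the constant unit vector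
   f of F has an M_inf-component of the form eta f with eta in {0, 1} a.e.; an argument of
   Helson shows that f - eta f is either 0 or nonzero a.e. In the first case M contains
   0 (+) L^2_F, so that N = N_1 (+) H^2_F splits. In the second case M_inf = 0. An
   orthonormal family w_1, ..., w_m of M - zM is then pointwise orthonormal a.e., because
   the negative and positive Fourier coefficients of <w_i, w_j> vanish; hence
   m <= dim E + dim F, a maximal family generates M, and Phi(z) x = sum_i <x, b_i> w_i(z),
   for orthonormal b_i in E (+) F, maps H^2 onto M (Beurling-Lax-Halmos). The operator V_Phi
   is Phi followed by the projection onto the complement of 0 (+) H^2_F, which is contained
   in M; therefore V_Phi is a partial isometry with range N. *)

From HB Require Import structures.
From mathcomp Require Import all_boot all_order all_algebra.
From mathcomp Require Import sesquilinear complex zify ring lra.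
From mathcomp Require Import all_classical all_reals all_analysis.
From mathcomp Require Import measurable_realfun.
Require Import Defs.

Set Implicit Arguments.
Unset Strict Implicit.
Unset Printing Implicit Defensive.

Import Order.TTheory GRing.Theory Num.Def Num.Theory.
Import numFieldNormedType.Exports.

Local Open Scope classical_set_scope.
Local Open Scope ring_scope.
Local Open Scope complex_scope.

(** Apart from N itself, closed subspaces are written as annihilators [annih S]: closedness,
    stability under a.e. equality and the orthogonal projection then hold for all of them at once,
    and membership is a family of scalar equations. This covers H^2, M, zM, M_inf and closed spans
    (as double annihilators). In exchange, invariance is read on the adjoint side: M is z-invariant
    because the complement of N in H^2 is stable under the adjoint of S_E (+) S_F^* . Pointwise
    statements come from uniqueness of Fourier coefficients in L^1, the space where the pointwise
    inner product of two L^2 functions lives: orthogonality of one function to all z^k-multiples of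
    another becomes orthogonality of values a.e. The line F matters because the projection of f on
    M_inf is governed by a scalar function eta, and the pointwise relation eta (1 - conj eta) = 0
    leaves only the values 0 and 1. The condition M_inf = 0 is what makes a wandering family
    complete: a vector of M that is pointwise orthogonal to a maximal family can be divided by z for
    ever. When m < dim E + dim F, the operator Phi is itself only a partial isometry, which gives
    V_Phi a second source of kernel vectors. *)

(** * Measurability and integration on the circle *)

Section CircleIntegral.
Variable R : realType.
Local Notation C := R[i].
Local Notation mu := (@lebesgue_measure R).
Local Notation II := (`[- pi, pi]%classic : set (measurableTypeR R)).

Lemma conjcE (x : C) : x^* = Num.conj x.
Proof. by []. Qed.

Lemma mII : measurable II.
Proof. exact: measurable_itv. Qed.

Lemma circle_ae_and (P Q : circle R -> Prop) :
  circle_ae P -> circle_ae Q -> circle_ae (fun z => P z /\ Q z).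
Proof. move=> p q; rewrite /circle_ae. apply: filterI p q. Qed.

Lemma circle_ae_imp (P Q : circle R -> Prop) :
  (forall z, P z -> Q z) -> circle_ae P -> circle_ae Q.
Proof. move=> h; rewrite /circle_ae; apply: filterS => t; exact: h. Qed.

Lemma circle_ae_all (P : circle R -> Prop) : (forall z, P z) -> circle_ae P.
Proof. by move=> h; apply: aeW => t. Qed.

Lemma cmeas_cst (c : C) : circle_measurable (fun _ : circle R => c).
Proof. by split; apply: measurable_cst. Qed.

Lemma cReD (x y : C) : complex.Re (x + y) = complex.Re x + complex.Re y.
Proof. by case: x; case: y. Qed.
Lemma cImD (x y : C) : complex.Im (x + y) = complex.Im x + complex.Im y.
Proof. by case: x; case: y. Qed.
Lemma cReM (x y : C) : complex.Re (x * y) =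
  complex.Re x * complex.Re y - complex.Im x * complex.Im y.
Proof. by case: x; case: y. Qed.
Lemma cImM (x y : C) : complex.Im (x * y) =
  complex.Re x * complex.Im y + complex.Im x * complex.Re y.
Proof. by case: x => a b; case: y => c d /=; rewrite (mulrC b). Qed.
Lemma cReJ (x : C) : complex.Re (Num.conj x) = complex.Re x.
Proof. by case: x. Qed.
Lemma cImJ (x : C) : complex.Im (Num.conj x) = - complex.Im x.
Proof. by case: x. Qed.

Lemma cmeas_add (f g : circle R -> C) : circle_measurable f ->
  circle_measurable g -> circle_measurable (fun z => f z + g z).
Proof.
move=> [f1 f2] [g1 g2]; split.
  under eq_fun do rewrite cReD; exact: measurable_funD.
under eq_fun do rewrite cImD; exact: measurable_funD.
Qed.

Lemma cmeas_mul (f g : circle R -> C) : circle_measurable f ->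
  circle_measurable g -> circle_measurable (fun z => f z * g z).
Proof.
move=> [f1 f2] [g1 g2]; split.
  by under eq_fun do rewrite cReM; apply: measurable_funB; apply: measurable_funM.
by under eq_fun do rewrite cImM; apply: measurable_funD; apply: measurable_funM.
Qed.

Lemma cmeas_conj (f : circle R -> C) : circle_measurable f ->
  circle_measurable (fun z => Num.conj (f z)).
Proof.
move=> [f1 f2]; split; first by under eq_fun do rewrite cReJ.
by under eq_fun do rewrite cImJ; exact: measurable_funN.
Qed.

Lemma cmeas_sum (I : Type) (s : seq I) (F : I -> circle R -> C) :
  (forall i, circle_measurable (F i)) ->
  circle_measurable (fun z => \sum_(i <- s) F i z).
Proof.
move=> mF; elim: s => [|i s IH].
  under eq_fun do rewrite big_nil; exact: cmeas_cst.
under eq_fun do rewrite big_cons; exact: cmeas_add.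
Qed.

Lemma cmeas_val : circle_measurable (fun z : circle R => val z).
Proof.
split => /=; apply: continuous_measurable_fun.
  exact: continuous_cos.
exact: continuous_sin.
Qed.

Lemma circle_unit (z : circle R) : val z * Num.conj (val z) = 1.
Proof. by rewrite -normCK (eqP (valP z)) expr1n. Qed.

Lemma circle_neq0 (z : circle R) : val z != 0.
Proof.
by apply/eqP => z0; move: (circle_unit z); rewrite z0 mul0r => /esym/eqP;
  rewrite oner_eq0.
Qed.

Lemma circle_inv (z : circle R) : (val z)^-1 = Num.conj (val z).
Proof.
by apply: (mulfI (circle_neq0 z)); rewrite circle_unit divff ?circle_neq0.
Qed.

Lemma cmeas_exp (k : int) : circle_measurable (fun z : circle R => val z ^ k).
Proof.
have H (f : circle R -> C) n : circle_measurable f ->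
    circle_measurable (fun z => f z ^+ n).
  move=> mf; elim: n => [|n IH]; first exact: cmeas_cst.
  by under eq_fun do rewrite exprS; exact: cmeas_mul.
case: k => n; first by apply: H; exact: cmeas_val.
under eq_fun do rewrite NegzE -exprnN -exprVn circle_inv.
by apply: H; apply: cmeas_conj; exact: cmeas_val.
Qed.

Lemma circle_conj_expi (t : R) : circle_conj (expi t) = expi (- t).
Proof. by apply: val_inj; rewrite /= cosN sinN. Qed.

Lemma cmeas_flip (f : circle R -> C) : circle_measurable f ->
  circle_measurable (fun z => f (circle_conj z)).
Proof.
move=> [f1 f2]; split; under eq_fun do rewrite circle_conj_expi.
  by apply: measurableT_comp f1 _; exact: oppr_measurable.
by apply: measurableT_comp f2 _; exact: oppr_measurable.
Qed.

Lemma measurable_sqrt (f : measurableTypeR R -> R) :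
  measurable_fun setT f -> measurable_fun setT (fun x => Num.sqrt (f x)).
Proof.
move=> mf; apply: (measurableT_comp _ mf).
by apply: continuous_measurable_fun; exact: sqrt_continuous.
Qed.

(** The norm of [C] takes its values in [C]; measure theory needs the modulus as a real number. *)
Definition cabs (x : C) : R := complex.Re `|x|.

Lemma cabsE (x : C) : `|x| = (cabs x)%:C.
Proof. by rewrite /cabs normc_def. Qed.

Lemma cabs_sqrt (x : C) :
  cabs x = Num.sqrt (complex.Re x ^+ 2 + complex.Im x ^+ 2).
Proof. by rewrite /cabs normc_def. Qed.

Lemma cabs_ge0 (x : C) : 0 <= cabs x.
Proof. by rewrite cabs_sqrt sqrtr_ge0. Qed.

Lemma cabs_add (x y : C) : cabs (x + y) <= cabs x + cabs y.
Proof. by move: (ler_normD x y); rewrite !cabsE -rmorphD lecR. Qed.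

Lemma cabs_mul (x y : C) : cabs (x * y) = cabs x * cabs y.
Proof. by apply: complexI; rewrite rmorphM -!cabsE normrM. Qed.

Lemma cabs_conj (x : C) : cabs (Num.conj x) = cabs x.
Proof. by rewrite /cabs norm_conjC. Qed.

Lemma cabs_pos (x : C) : 0 <= x -> cabs x = complex.Re x.
Proof. by move=> x0; rewrite /cabs ger0_norm. Qed.

Lemma Re_le_cabs (x : C) : `|complex.Re x| <= cabs x.
Proof. by move: (normc_ge_Re x); rewrite cabsE lecR. Qed.

Lemma Im_le_cabs (x : C) : `|complex.Im x| <= cabs x.
Proof.
rewrite cabs_sqrt -sqrtr_sqr ler_wsqrtr// lerDr sqr_ge0 //.
Qed.

Lemma cmeas_abs (f : circle R -> C) : circle_measurable f ->
  measurable_fun setT (fun t : measurableTypeR R => cabs (f (expi t))).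
Proof.
move=> [f1 f2]; under eq_fun do rewrite cabs_sqrt.
by apply: measurable_sqrt; apply: measurable_funD; apply: measurable_funX.
Qed.

Definition cL1 (f : circle R -> C) := circle_measurable f /\
  (\int[mu]_(t in II) (cabs (f (expi t)))%:E < +oo)%E.

Lemma EFin_mfun (f : measurableTypeR R -> R) : measurable_fun setT f ->
  measurable_fun II (fun t => (f t)%:E).
Proof. by move=> mf; apply/measurable_EFinP; exact: measurable_funTS. Qed.

Lemma cL1_dom (f g : circle R -> C) : circle_measurable f -> cL1 g ->
  circle_ae (fun z => cabs (f z) <= cabs (g z)) -> cL1 f.
Proof.
move=> mf [mg ig] fg; split => //; apply: le_lt_trans ig.
apply: ae_ge0_le_integral.
- exact: mII.
- by move=> t _; rewrite lee_fin cabs_ge0.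
- by apply: EFin_mfun; exact: cmeas_abs.
- by move=> t _; rewrite lee_fin cabs_ge0.
- by apply: EFin_mfun; exact: cmeas_abs.
- by move: fg; rewrite /circle_ae; apply: filterS => t /= h _; rewrite lee_fin.
Qed.

Lemma muII : (mu II < +oo)%E.
Proof. by rewrite /= lebesgue_measure_itv /=; case: ifP => // _; rewrite ltry. Qed.

Lemma cL1_cst (c : C) : cL1 (fun=> c).
Proof.
split; first exact: cmeas_cst.
rewrite integral_cst; last exact: mII.
by apply: lte_mul_pinfty; rewrite ?lee_fin ?cabs_ge0//; exact: muII.
Qed.

Lemma cL1_add (f g : circle R -> C) : cL1 f -> cL1 g -> cL1 (fun z => f z + g z).
Proof.
move=> [mf fi] [mg gi]; split; first exact: cmeas_add.
apply: (@le_lt_trans _ _ (\int[mu]_(t in II) ((cabs (f (expi t)))%:E + (cabs (g (expi t)))%:E)))%E.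
  apply: ge0_le_integral.
  - exact: mII.
  - by move=> t _; rewrite lee_fin cabs_ge0.
  - by apply: EFin_mfun; exact: (cmeas_abs (cmeas_add mf mg)).
  - by apply: emeasurable_funD; apply: EFin_mfun; exact: cmeas_abs.
  - by move=> t _; rewrite -EFinD lee_fin cabs_add.
rewrite ge0_integralD.
- exact: lte_add_pinfty.
- exact: mII.
- by move=> t _; rewrite lee_fin cabs_ge0.
- by apply: EFin_mfun; exact: cmeas_abs.
- by move=> t _; rewrite lee_fin cabs_ge0.
- by apply: EFin_mfun; exact: cmeas_abs.
Qed.

Lemma cL1_scale (c : C) (f : circle R -> C) : cL1 f -> cL1 (fun z => c * f z).
Proof.
move=> [mf fi]; split; first by apply: cmeas_mul => //; exact: cmeas_cst.
under eq_integral do rewrite cabs_mul EFinM.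
rewrite ge0_integralZl.
- by apply: lte_mul_pinfty; rewrite ?lee_fin ?cabs_ge0.
- exact: mII.
- by apply: EFin_mfun; exact: cmeas_abs.
- by move=> t _; rewrite lee_fin cabs_ge0.
- by rewrite lee_fin cabs_ge0.
Qed.

Lemma cL1_bounded (f g : circle R -> C) (M : R) : circle_measurable f -> cL1 g ->
  circle_ae (fun z => cabs (f z) <= M) -> cL1 (fun z => f z * g z).
Proof.
move=> mf g1 fM; apply: (@cL1_dom _ (fun z => M%:C * g z)).
- by apply: cmeas_mul => //; case: g1.
- exact: cL1_scale.
- apply: circle_ae_imp fM => z fz; rewrite !cabs_mul ler_wpM2r ?cabs_ge0//.
  by apply: le_trans fz _; rewrite /cabs normc_def /= expr0n addr0 sqrtr_sqr ler_norm.
Qed.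

Lemma cabs_exp (z : circle R) (k : int) : cabs (val z ^ k) = 1.
Proof.
by apply: complexI; rewrite -cabsE; have /eqP := valP z;
  case: k => n; rewrite ?NegzE -?exprnN ?normrV ?unitfE ?expf_neq0 ?circle_neq0// normrX => ->;
  rewrite expr1n ?invr1.
Qed.

Lemma cL1_exp (k : int) (f : circle R -> C) : cL1 f -> cL1 (fun z => val z ^ k * f z).
Proof.
move=> fi; apply: (@cL1_bounded _ _ 1) => //; first exact: cmeas_exp.
by apply: circle_ae_all => z; rewrite cabs_exp.
Qed.

Lemma cL1_ReI (f : circle R -> C) : cL1 f ->
  mu.-integrable II (EFin \o (fun t => complex.Re (f (expi t)))).
Proof.
move=> [mf fi]; apply: (@le_integrable _ _ _ mu II mII _ (fun t => (cabs (f (expi t)))%:E)).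
- by apply: EFin_mfun; case: mf.
- by move=> t _ /=; rewrite lee_fin [leRHS]ger0_norm ?cabs_ge0// Re_le_cabs.
- apply/integrableP; split; first by apply: EFin_mfun; exact: cmeas_abs.
  by under eq_integral do rewrite gee0_abs ?lee_fin ?cabs_ge0//.
Qed.

Lemma cL1_ImI (f : circle R -> C) : cL1 f ->
  mu.-integrable II (EFin \o (fun t => complex.Im (f (expi t)))).
Proof.
move=> [mf fi]; apply: (@le_integrable _ _ _ mu II mII _ (fun t => (cabs (f (expi t)))%:E)).
- by apply: EFin_mfun; case: mf.
- by move=> t _ /=; rewrite lee_fin [leRHS]ger0_norm ?cabs_ge0// Im_le_cabs.
- apply/integrableP; split; first by apply: EFin_mfun; exact: cmeas_abs.
  by under eq_integral do rewrite gee0_abs ?lee_fin ?cabs_ge0//.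
Qed.

Lemma cint_add (f g : circle R -> C) : cL1 f -> cL1 g ->
  circle_int (fun z => f z + g z) = circle_int f + circle_int g.
Proof.
move=> fi gi; rewrite /circle_int /=.
under [X in _ * X +i* _]eq_Rintegral do rewrite cReD.
under [X in _ +i* (_ * X)]eq_Rintegral do rewrite cImD.
rewrite (RintegralD mII (cL1_ReI fi) (cL1_ReI gi)) (RintegralD mII (cL1_ImI fi) (cL1_ImI gi)).
by rewrite !mulrDr.
Qed.

Lemma cint_scale (c : C) (f : circle R -> C) : cL1 f ->
  circle_int (fun z => c * f z) = c * circle_int f.
Proof.
move=> fi; rewrite /circle_int /=.
under [X in _ * X +i* _]eq_Rintegral do rewrite cReM.
under [X in _ +i* (_ * X)]eq_Rintegral do rewrite cImM.
have rI k := @RintegralZl _ _ _ mu II _ k mII (cL1_ReI fi).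
have iI k := @RintegralZl _ _ _ mu II _ k mII (cL1_ImI fi).
have rII k : mu.-integrable II (EFin \o (fun t => k * complex.Re (f (expi t)))).
  by have := integrableZl mII k (cL1_ReI fi); apply: eq_integrable => //; exact: mII.
have iII k : mu.-integrable II (EFin \o (fun t => k * complex.Im (f (expi t)))).
  by have := integrableZl mII k (cL1_ImI fi); apply: eq_integrable => //; exact: mII.
rewrite (RintegralB mII (rII _) (iII _)) (RintegralD mII (iII _) (rII _)).
rewrite !rI !iI; case: c => a b /=; congr (_ +i* _).
  by rewrite mulrBr !(mulrCA _ a) !(mulrCA _ b).
by rewrite mulrDr !(mulrCA _ a) !(mulrCA _ b).
Qed.

Lemma Rint_opp (f : R -> R) : mu.-integrable II (EFin \o f) ->
  Rintegral mu II (fun t => - f t) = - Rintegral mu II f.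
Proof.
move=> fi; rewrite -[RHS]mulN1r -(RintegralZl (-1) mII fi).
by apply: eq_Rintegral => t _; rewrite mulN1r.
Qed.

Lemma cint_conj (f : circle R -> C) : cL1 f ->
  circle_int (fun z => Num.conj (f z)) = Num.conj (circle_int f).
Proof.
move=> fi; rewrite /circle_int /=.
under [X in _ * X +i* _]eq_Rintegral do rewrite cReJ.
under [X in _ +i* (_ * X)]eq_Rintegral do rewrite cImJ.
by rewrite (Rint_opp (cL1_ImI fi)) mulrN.
Qed.

Lemma Rint_ae (f g : R -> R) : measurable_fun II f -> measurable_fun II g ->
  {ae mu, forall t : measurableTypeR R, f t = g t} -> Rintegral mu II f = Rintegral mu II g.
Proof.
move=> mf mg fg; rewrite /Rintegral; congr fine; apply: ae_eq_integral => //.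
- exact/measurable_EFinP.
- exact/measurable_EFinP.
- by move: fg; apply: filterS => t /= ->.
Qed.

Lemma cint_ae (f g : circle R -> C) : circle_measurable f -> circle_measurable g ->
  ae_equal f g -> circle_int f = circle_int g.
Proof.
move=> [f1 f2] [g1 g2] fg; rewrite /circle_int.
congr (_ * _ +i* (_ * _)); apply: Rint_ae; try exact: measurable_funTS;
  by move: fg; rewrite /ae_equal /circle_ae; apply: filterS => t /= ->.
Qed.

Lemma cL1_ae (f g : circle R -> C) : cL1 f -> circle_measurable g ->
  ae_equal f g -> cL1 g.
Proof. by move=> fi mg fg; apply: cL1_dom fi _ => //; apply: (@circle_ae_imp (fun z => f z = g z)) fg => z /= ->. Qed.

Lemma pi_inv_gt0 : 0 < (pi *+ 2 : R)^-1.
Proof. by rewrite invr_gt0 pmulrn_lgt0 ?pi_gt0. Qed.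

Lemma cint_ge0 (f : circle R -> C) : cL1 f -> (forall z, 0 <= f z) ->
  0 <= circle_int f.
Proof.
move=> fi f0; rewrite /circle_int lecE /=; apply/andP; split.
  rewrite (_ : Rintegral _ _ _ = 0) ?mulr0//.
  rewrite /Rintegral integral0_eq// => t _; have := f0 (expi t).
  by rewrite lecE /= => /andP[/eqP -> _].
rewrite mulr_ge0 ?(ltW pi_inv_gt0)// Rintegral_ge0// => t _.
by have := f0 (expi t); rewrite lecE => /andP[].
Qed.

Lemma cint_cst (c : C) : circle_int (fun=> c) = c.
Proof.
have mupi : fine (mu II) = (pi *+ 2 : R).
  rewrite /= lebesgue_measure_itv /= lte_fin gtrN ?pi_gt0//.
  by rewrite opprK mulr2n.
rewrite /circle_int !Rintegral_cst; try exact: mII.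
rewrite mupi; case: c => a b /=.
have p0 : (pi *+ 2 : R) != 0 by rewrite gt_eqF // pmulrn_lgt0 ?pi_gt0.
by rewrite !(mulrC _ (pi *+ 2)) !mulKf.
Qed.

(** Lebesgue measure is determined by its values on half-open intervals, so an image measure has to
    be compared with it only there. *)
Lemma pushforward_lebesgue (phi : measurableTypeR R -> measurableTypeR R)
  (mphi : measurable_fun setT phi) :
  (forall a b : R, mu (phi @^-1` `]a, b]%classic) = mu `]a, b]%classic) ->
  forall A, measurable A -> mu (phi @^-1` A) = mu A.
Proof.
move=> h A mA; pose phim : {mfun measurableTypeR R >-> measurableTypeR R} := mfun_Sub (mem_set mphi).
have := @lebesgue_measure_unique R (pushforward mu phim).
move=> /(_ mphi) /(_ _ A mA) ->//.
by move=> X [[a b] _ <-]; exact/esym/h.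
Qed.

End CircleIntegral.

(** * Periodicity, reflection, and vanishing of nonnegative functions with integral 0 *)

Section CircleInvariance.
Variable R : realType.
Local Notation C := R[i].
Local Notation mu := (@lebesgue_measure R).
Local Notation II := (`[- pi, pi]%classic : set (measurableTypeR R)).
Local Notation mII := (@mII R).

Lemma mu_translate (c : R) (A : set (measurableTypeR R)) : measurable A ->
  mu ((fun t : measurableTypeR R => t + c : measurableTypeR R) @^-1` A) = mu A.
Proof.
apply: pushforward_lebesgue.
  by apply: measurable_funD => //; exact: measurable_cst.
move=> a b; rewrite (_ : _ @^-1` _ = `]a - c, b - c]%classic).
  rewrite !lebesgue_measure_itv /= !lte_fin ltrD2r; case: ifP => // _.
  by rewrite -!EFinD; congr (_%:E); lra.
by apply/seteqP; split => x /=; rewrite !in_itv /= ltrBlDr lerBrDr.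
Qed.

Lemma mu_flip (A : set (measurableTypeR R)) : measurable A ->
  mu ((fun t : measurableTypeR R => - t : measurableTypeR R) @^-1` A) = mu A.
Proof.
apply: pushforward_lebesgue; first exact: oppr_measurable.
move=> a b; rewrite (_ : _ @^-1` _ = `[- b, - a[%classic).
  rewrite !lebesgue_measure_itv /= !lte_fin ltrN2; case: ifP => // _.
  by rewrite -!EFinD; congr (_%:E); lra.
by apply/seteqP; split => x /=; rewrite !in_itv /= lerNl ltrNr andbC.
Qed.

Lemma expi_period (t : R) (n : nat) : expi (t + (pi *+ 2) *+ n) = expi t.
Proof.
apply: val_inj => /=.
by rewrite (periodicn (@cosD2pi R)) (periodicn (@sinD2pi R)).
Qed.

Lemma preimage_translate_null (c : R) (N : set (measurableTypeR R)) :
  measurable N -> mu N = 0%E ->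
  mu.-negligible ((fun t : measurableTypeR R => t + c : measurableTypeR R) @^-1` N).
Proof.
move=> mN N0; exists ((fun t : measurableTypeR R => t + c : measurableTypeR R) @^-1` N).
split => //.
  rewrite -[X in measurable X]setTI.
  have : measurable_fun setT (fun t : measurableTypeR R => t + c : measurableTypeR R).
    by apply: measurable_funD => //; exact: measurable_cst.
  by apply.
by rewrite mu_translate.
Qed.

Lemma shift_into_II (t : R) : exists n : nat,
  II (t + (pi *+ 2) *+ n) \/ II (t - (pi *+ 2) *+ n).
Proof.
have p0 := @pi_gt0 R; pose x := (t + pi) / (pi *+ 2).
have p20 : 0 < (pi *+ 2 : R) by rewrite pmulrn_lgt0.
have /andP[h1 h2] := floor_itv x.
have e : x * (pi *+ 2) = t + pi by rewrite /x divfK // gt_eqF.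
have h1' : (Num.floor x)%:~R * (pi *+ 2) <= t + pi by rewrite -e ler_pM2r.
have h2' : t + pi < (Num.floor x)%:~R * (pi *+ 2) + pi *+ 2.
  by rewrite -e -[X in _ + X]mul1r -mulrDl ltr_pM2r //; move: h2; rewrite intrD.
case: (Num.floor x) h1' h2' => n h1' h2'.
  exists n; right => /=; rewrite in_itv /=.
  move: h1' h2'; rewrite -pmulrn mulr_natl => h1' h2'.
  by apply/andP; split; lra.
exists n.+1; left => /=; rewrite in_itv /=.
move: h1' h2'; rewrite NegzE mulrNz mulNr -pmulrn mulr_natl => h1' h2'.
by apply/andP; split; lra.
Qed.

(** The exceptional set on the line is covered by the translates of a null set by multiples of 2 pi,
    and there are countably many of them. The factor 1 or -1 in [F] gives the two directions of
    translation. *)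
Lemma circle_ae_II (P : circle R -> Prop) :
  {ae mu, forall t : measurableTypeR R, II t -> P (expi t)} -> circle_ae P.
Proof.
move=> [N [mN N0 sN]]; rewrite /circle_ae /almost_everywhere /=.
pose F c n := (fun t : measurableTypeR R => t + (pi *+ 2) *+ n * c : measurableTypeR R) @^-1` N.
have nF c : mu.-negligible (\bigcup_n F c n).
  by apply: negligible_bigcup => n; exact: preimage_translate_null.
apply: (@negligibleS _ _ _ mu _ _ _ (negligibleU (nF 1) (nF (-1)))) => t /= nP.
have [n [h|h]] := shift_into_II t; [left|right]; exists n => //; apply: sN => /=.
  by rewrite mulr1 expi_period => /(_ h).
rewrite mulrN1 => /(_ h); rewrite -(expi_period _ n) subrK.
exact: nP.
Qed.

Lemma Rint_flip (f : measurableTypeR R -> R) : measurable_fun setT f ->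
  mu.-integrable II (EFin \o f) ->
  Rintegral mu II (fun t => f (- t)) = Rintegral mu II f.
Proof.
move=> mf fi.
pose phi := (fun t : measurableTypeR R => - t : measurableTypeR R).
have mphi : measurable_fun setT phi by exact: oppr_measurable.
have eI : phi @^-1` II = II.
  by apply/seteqP; split => x /=; rewrite !in_itv /phi /= => /andP[? ?]; apply/andP; split; lra.
rewrite /Rintegral; congr fine.
have em (g : measurableTypeR R -> \bar R) : (\int[pushforward mu phi]_(y in II) g y =
    \int[mu]_(y in II) g y)%E.
  apply: eq_measure_integral => /= A mA _; rewrite /pushforward.
  exact: mu_flip.
rewrite -[RHS]em integral_pushforward //; first by rewrite eI.
- exact/measurable_EFinP.
- rewrite eI; apply/integrableP; split.
    apply/measurable_EFinP; apply: measurable_funTS.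
    exact: measurableT_comp.
  have := fi => /integrableP[_]; rewrite -em ge0_integral_pushforward ?eI//.
  by apply: measurableT_comp => //; exact/measurable_EFinP/measurable_funTS.
Qed.

Lemma cL1_flip (f : circle R -> C) : cL1 f -> cL1 (fun z => f (circle_conj z)).
Proof.
move=> [mf fi]; split; first exact: cmeas_flip.
pose phi := (fun t : measurableTypeR R => - t : measurableTypeR R).
have mphi : measurable_fun setT phi by exact: oppr_measurable.
have eI : phi @^-1` II = II.
  by apply/seteqP; split => x /=; rewrite !in_itv /phi /= => /andP[? ?]; apply/andP; split; lra.
have em (g : measurableTypeR R -> \bar R) : (\int[pushforward mu phi]_(y in II) g y =
    \int[mu]_(y in II) g y)%E.
  apply: eq_measure_integral => /= A mA _; rewrite /pushforward.
  exact: mu_flip.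
move: fi; rewrite -em ge0_integral_pushforward ?eI//.
- by under [X in (_ -> X < _)%E]eq_integral do rewrite circle_conj_expi.
- by apply: EFin_mfun; exact: cmeas_abs.
- by move=> t _; rewrite lee_fin cabs_ge0.
Qed.

Lemma cint_flip (f : circle R -> C) : cL1 f ->
  circle_int (fun z => f (circle_conj z)) = circle_int f.
Proof.
move=> fi; rewrite /circle_int /=.
under [X in _ * X +i* _]eq_Rintegral do rewrite circle_conj_expi.
under [X in _ +i* (_ * X)]eq_Rintegral do rewrite circle_conj_expi.
have [[m1 m2] _] := fi.
by rewrite (Rint_flip m1 (cL1_ReI fi)) (Rint_flip m2 (cL1_ImI fi)).
Qed.

Lemma cint_eq0 (f : circle R -> C) : cL1 f -> circle_ae (fun z => 0 <= f z) ->
  circle_int f = 0 -> circle_ae (fun z => f z = 0).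
Proof.
move=> fi f0 /eqP; rewrite eq_complex /= => /andP[/eqP h _].
have /eqP : Rintegral mu II (fun t => complex.Re (f (expi t))) = 0.
  by apply: (mulfI (lt0r_neq0 (pi_inv_gt0 R))); rewrite mulr0.
(* As [f] is nonnegative a.e., its real part agrees a.e. with its modulus. *)
rewrite (_ : Rintegral _ _ _ = Rintegral mu II (fun t => cabs (f (expi t)))); last first.
  apply: Rint_ae.
  - by apply: measurable_funTS; case: fi => -[].
  - by apply: measurable_funTS; apply: cmeas_abs; case: fi.
  - by move: f0; rewrite /circle_ae; apply: filterS => t /= ft; rewrite cabs_pos.
move=> /eqP i0.
have [mf lf] := fi.
(* [fine] also sends infinity to 0, so the finiteness contained in [cL1] is used here. *)
have : (\int[mu]_(t in II) (cabs (f (expi t)))%:E = 0)%E.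
  move: i0 lf; rewrite /Rintegral.
  have : (0 <= \int[mu]_(t in II) (cabs (f (expi t)))%:E)%E.
    by apply: integral_ge0 => t _; rewrite lee_fin cabs_ge0.
  by case: (integral _ _ _) => [r| |] //= _ ->.
move=> i00; apply: circle_ae_II.
have := (@ae_eq_integral_abs _ _ _ mu II mII (fun t => (cabs (f (expi t)))%:E) _).1.
have mm : measurable_fun II (fun t => (cabs (f (expi t)))%:E).
  by apply: EFin_mfun; exact: cmeas_abs.
move=> /(_ mm) h'; move: h' => [|].
  rewrite -[RHS]i00; apply: eq_integral => t _.
  by rewrite gee0_abs // lee_fin cabs_ge0.
move=> N [mN N0 sN]; exists N; split => // t /= nt; apply: sN => /= ht; apply: nt => It.
have /(_ It) [/eqP] := ht.
by rewrite -[_ == 0]/(cabs _ == 0) => /eqP c0; apply/eqP; rewrite -normr_eq0 cabsE c0.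
Qed.

End CircleInvariance.

(** * Uniqueness of Fourier coefficients of integrable functions *)

Section FourierUniqueness.
Variable R : realType.
Local Notation C := R[i].
Local Notation mu := (@lebesgue_measure R).
Local Notation II := (`[- pi, pi]%classic : set (measurableTypeR R)).
Local Notation mII := (@mII R).

Inductive trig_poly : (circle R -> C) -> Prop :=
| trig_cst c : trig_poly (fun=> c)
| trig_val : trig_poly (fun z => val z)
| trig_conj : trig_poly (fun z => Num.conj (val z))
| trig_add f g : trig_poly f -> trig_poly g -> trig_poly (fun z => f z + g z)
| trig_mul f g : trig_poly f -> trig_poly g -> trig_poly (fun z => f z * g z).

Lemma trig_exp f n : trig_poly f -> trig_poly (fun z => f z ^+ n).
Proof.
move=> tf; elim: n => [|n IH]; first exact: trig_cst.
rewrite (_ : (fun z => _) = (fun z => f z * f z ^+ n)); first exact: trig_mul.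
by apply/funext => z; rewrite exprS.
Qed.

Definition all_fourier0 (f : circle R -> C) := cL1 f /\ forall k, fourier f k = 0.

Lemma fourier_shift (f : circle R -> C) (j k : int) :
  fourier (fun z => val z ^ j * f z) k = fourier f (k - j).
Proof.
rewrite /fourier; congr circle_int; apply/funext => z.
rewrite mulrAC mulrC -expfzDr ?circle_neq0//; congr (_ * _ ^ _).
by rewrite opprB.
Qed.

Lemma cL1_expr (k : int) (f : circle R -> C) : cL1 f -> cL1 (fun z => f z * val z ^ k).
Proof. by move=> fi; under eq_fun do rewrite mulrC; exact: cL1_exp. Qed.

(** Multiplication by [z] or its conjugate only shifts the coefficients. The zeroth coefficient of
    the product then says that [f] is orthogonal to every trigonometric polynomial. *)
Lemma all_fourier0_trig p f : trig_poly p -> all_fourier0 f ->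
  all_fourier0 (fun z => p z * f z).
Proof.
move=> tp; elim: tp f => [c|||g h _ IHg _ IHh|g h _ IHg _ IHh] f f0.
- have [fi fk] := f0; split; first exact: cL1_scale.
  move=> k; rewrite /fourier; under eq_fun do rewrite -mulrA.
  by rewrite cint_scale; [rewrite -/(fourier f k) fk mulr0|exact: cL1_expr].
- have [fi fk] := f0; have e : (fun z : circle R => val z * f z) = (fun z => val z ^ 1 * f z).
    by apply/funext => z; rewrite expr1z.
  by rewrite e; split; [exact: cL1_exp|move=> k; rewrite fourier_shift].
- have [fi fk] := f0; have e : (fun z : circle R => Num.conj (val z) * f z) = (fun z => val z ^ (-1) * f z).
    by apply/funext => z; rewrite -circle_inv exprN1.
  by rewrite e; split; [exact: cL1_exp|move=> k; rewrite fourier_shift].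
- have [gi gk] := IHg _ f0; have [hi hk] := IHh _ f0; split.
    by under eq_fun do rewrite mulrDl; exact: cL1_add.
  move=> k; rewrite /fourier.
  under eq_fun do rewrite mulrDl mulrDl.
  rewrite cint_add; [|exact: cL1_expr..].
  by rewrite -[circle_int _]/(fourier _ _) gk -[circle_int _]/(fourier _ _) hk addr0.
- have := IHg _ (IHh _ f0).
  by under [X in all_fourier0 X -> _]eq_fun do rewrite mulrA.
Qed.

Lemma bernoulli_le (u : R) n : -1 <= u -> 1 + n%:R * u <= (1 + u) ^+ n.
Proof.
move=> u1; elim: n => [|n IH]; first by rewrite mul0r addr0 expr0.
rewrite exprS; apply: (@le_trans _ _ ((1 + u) * (1 + n%:R * u))).
  have : 0 <= n%:R * u ^+ 2 by rewrite mulr_ge0 ?sqr_ge0.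
  by rewrite -natr1; nra.
by rewrite ler_wpM2l//; lra.
Qed.

(* The peaking functions of the elementary proof of the Stone-Weierstrass theorem. *)
Definition bump (n : nat) (x : R) : R := (1 - x ^+ n) ^+ (2 ^ n).

Lemma bump_itv n x : 0 <= x <= 1 -> 0 <= bump n x <= 1.
Proof.
move=> /andP[x0 x1]; have xn1 : x ^+ n <= 1 by rewrite exprn_ile1.
have xn0 : 0 <= x ^+ n by rewrite exprn_ge0.
by rewrite /bump exprn_ge0 ?exprn_ile1//; lra.
Qed.

(** Bernoulli's inequality gives the lower bound 1 - (2x)^n. *)
Lemma bump_cvg1 x : 0 <= x -> 2 * x < 1 -> bump n x @[n --> \oo] --> (1 : R).
Proof.
move=> x0 x1.
have h : (fun n => 1 - (2 * x) ^+ n) @ \oo --> (1 : R).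
  rewrite -[X in _ --> X]subr0; apply: cvgB; first exact: cvg_cst.
  by apply: cvg_expr; rewrite ger0_norm//; lra.
apply: (squeeze_cvgr _ h (cvg_cst (1 : R))).
apply: nearW => n; have x01 : 0 <= x <= 1 by lra.
have /andP[_ -> /=] := bump_itv n x01; rewrite andbT.
have := @bernoulli_le (- x ^+ n) (2 ^ n) _.
rewrite natrX mulrN -exprMn; apply.
by rewrite lerN2 exprn_ile1//; lra.
Qed.

(** The product of [bump n x] with (1 + x^n)^(2^n) is at most 1, and by Bernoulli's inequality the
    second factor is at least (2x)^n. *)
Lemma bump_cvg0 x : x <= 1 -> 1 < 2 * x -> bump n x @[n --> \oo] --> (0 : R).
Proof.
move=> x1 x0.
have h : (fun n => (2 * x)^-1 ^+ n) @ \oo --> (0 : R).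
  apply: cvg_expr; rewrite ger0_norm ?invr_ge0//; last by lra.
  by rewrite invf_lt1//; lra.
apply: (squeeze_cvgr _ (cvg_cst (0 : R)) h).
apply: nearW => n; have x01 : 0 <= x <= 1 by lra.
have /andP[-> _ /=] := bump_itv n x01.
have xn0 : 0 <= x ^+ n by rewrite exprn_ge0//; lra.
have xn1 : x ^+ n <= 1 by rewrite exprn_ile1//; lra.
have px : 0 < (2 * x) ^+ n by rewrite exprn_gt0//; lra.
rewrite exprVn -[leRHS]mul1r ler_pdivlMr//.
apply: (@le_trans _ _ (bump n x * (1 + x ^+ n) ^+ (2 ^ n))).
  apply: ler_wpM2l; first by have /andP[] := bump_itv n x01.
  have := @bernoulli_le (x ^+ n) (2 ^ n) _; rewrite natrX -exprMn => h1.
  by apply: le_trans (h1 _); lra.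
rewrite /bump -exprMn exprn_ile1//; nra.
Qed.

(* Crosses the threshold 1/2 of [bump] exactly where |t - t0| = d. *)
Definition arc_fun (t0 d : R) (t : R) : R := (1 + cos (t - t0)) / (2 * (1 + cos d)).

Lemma arc_trig (t0 d : R) : exists2 p, trig_poly p &
  forall t, p (expi t) = (arc_fun t0 d t)%:C.
Proof.
pose k : C := ((2 * (1 + cos d))^-1)%:C; pose w : C := val (expi t0).
(* With w = e^(i t0), cos (t - t0) is the half sum of conj(w) z and its conjugate. *)
exists (fun z => k * (1 + ((2^-1)%:C * (Num.conj w * val z) + (2^-1)%:C * (w * Num.conj (val z))))).
  do ?[apply: trig_mul|apply: trig_add|apply: trig_cst|apply: trig_val|apply: trig_conj].
move=> t; rewrite /arc_fun /k /w /= cosB; move: (2 * (1 + cos d))^-1 => kk; apply/eqP; rewrite eq_complex /=; apply/andP.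
split; apply/eqP.
  by field.
by field.
Qed.

(** Cosine decreases on [0, pi]. A distance s > pi is replaced by 2 pi - s, which still exceeds d
    because |t0| + d < pi prevents the arc from wrapping around. *)
Lemma cos_lt_arc (t0 d t : R) : 0 < d -> `|t0| + d < pi -> - pi <= t <= pi ->
  (cos d < cos (t - t0)) = (`|t - t0| < d) /\ (cos (t - t0) < cos d) = (d < `|t - t0|).
Proof.
move=> d0 dt tpi; have p0 := pi_gt0 R; rewrite -(cos_norm (t - t0)).
have n0 := normr_ge0 t0.
have s0 : 0 <= `|t - t0| by [].
have s1 : `|t - t0| < pi *+ 2 - d.
  have := ler_normB t t0; have : `|t| <= pi by rewrite ler_norml.
  by lra.
have dI : d \in `[0, pi] by rewrite in_itv /=; lra.
move: (`|t - t0|) s0 s1 => s s0 s1.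
have [sp|sp] := lerP s pi.
  have sI : s \in `[0, pi] by rewrite in_itv /= s0 sp.
  by rewrite (ltr_cos sI dI) (ltr_cos dI sI).
have -> : cos s = cos (pi *+ 2 - s) by rewrite addrC cosD2pi cosN.
have sI : (pi *+ 2 - s) \in `[0, pi] by rewrite in_itv /=; lra.
rewrite (ltr_cos sI dI) (ltr_cos dI sI).
by split; apply/idP/idP; lra.
Qed.

End FourierUniqueness.

Section FourierUniqueness2.
Variable R : realType.
Local Notation C := R[i].
Local Notation mu := (@lebesgue_measure R).
Local Notation II := (`[- pi, pi]%classic : set (measurableTypeR R)).
Local Notation mII := (@mII R).

Lemma cos_d_gt (d : R) : 0 < d -> d < pi -> 0 < 1 + cos d.
Proof.
move=> d0 dpi.
have dI : d \in `[0, pi] by rewrite in_itv /=; lra.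
have pI : (pi : R) \in `[0, pi] by rewrite in_itv /= lexx (ltW (pi_gt0 R)).
have := ltr_cos dI pI; rewrite cospi dpi => h.
by have : -1 < cos d by []; lra.
Qed.

(** For d < pi / 2 one has cos d > 0, so the denominator exceeds 2, the largest possible
    numerator. *)
Lemma arc_fun_itv (t0 d t : R) : 0 < d -> d < pi / 2 -> 0 <= arc_fun t0 d t <= 1.
Proof.
move=> d0 dpi; have p0 := pi_gt0 R.
have c0 : 0 < cos d by apply: cos_gt0_pihalf; lra.
have := cos_geN1 (t - t0); have := cos_le1 (t - t0) => h1 h2.
rewrite /arc_fun.
have e0 : 0 < 2 * (1 + cos d) by lra.
apply/andP; split; first by apply: divr_ge0; lra.
by rewrite ler_pdivrMr// mul1r; lra.
Qed.

Lemma Re_bump_int (f : circle R -> C) (t0 d : R) n :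
  all_fourier0 f ->
  Rintegral mu II (fun t => bump n (arc_fun t0 d t) * complex.Re (f (expi t))) = 0.
Proof.
move=> f0; have [p tp pE] := arc_trig t0 d.
have tq : trig_poly (fun z => (1 + (-1) * p z ^+ n) ^+ (2 ^ n)).
  apply: (@trig_exp _ (fun z => 1 + (-1) * p z ^+ n)); apply: trig_add; first exact: trig_cst.
  by apply: trig_mul; [exact: trig_cst|exact: trig_exp].
have [_ /(_ 0)] := all_fourier0_trig tq f0.
rewrite /fourier oppr0 => /eqP; rewrite eq_complex /= => /andP[/eqP h _].
apply: (mulfI (lt0r_neq0 (pi_inv_gt0 R))); rewrite mulr0 -[RHS]h.
congr (_ * _); apply: eq_Rintegral => t _.
rewrite expr0z mulr1 cReM pE.
rewrite (_ : (1 + -1 * _ ^+ n) ^+ _ = (bump n (arc_fun t0 d t))%:C) /=; first by rewrite mul0r subr0.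
by rewrite /bump mulN1r rmorphXn rmorphB rmorphXn.
Qed.

Lemma measurable_bump n (t0 d : R) :
  measurable_fun setT (fun t : measurableTypeR R => bump n (arc_fun t0 d t)).
Proof.
apply: measurable_funX; apply: measurable_funB; first exact: measurable_cst.
apply: measurable_funX; apply: measurable_funM; last exact: measurable_cst.
apply: measurable_funD; first exact: measurable_cst.
have [mc ms] := @cmeas_val R.
under eq_fun do rewrite cosB.
by apply: measurable_funD; apply: measurable_funM => //; exact: measurable_cst.
Qed.

Lemma ae_neq2 (a b : R) : {ae mu, forall t : measurableTypeR R, t != a /\ t != b}.
Proof.
have n1 (c : R) : mu.-negligible [set c].
  by apply/negligibleP; [exact: measurable_set1|exact: lebesgue_measure_set1].
apply: (negligibleS _ (negligibleU (n1 a) (n1 b))) => t /=.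
by move=> /not_andP[] /negP; rewrite negbK => /eqP; [left|right].
Qed.

(** The trigonometric polynomials [bump n (arc_fun t0 d t)] tend boundedly to 0 inside the arc and
    to 1 outside. By dominated convergence the integral over the outside is 0, and so is the total
    integral, being the real part of a multiple of the zeroth coefficient. *)
Lemma Re_arc_int (f : circle R -> C) (t0 d : R) :
  all_fourier0 f -> 0 < d -> d < pi / 2 -> `|t0| + d < pi ->
  (\int[mu]_(t in ball t0 d) (complex.Re (f (expi t)))%:E = 0)%E.
Proof.
move=> f0 d0 d2 dt; have [fi _] := f0.
pose g t := (complex.Re (f (expi t)))%:E.
have mg : measurable_fun setT g by apply/measurable_EFinP; case: fi => -[].
have gi : mu.-integrable II g by exact: cL1_ReI.
have p0 := pi_gt0 R.
have dpi : d < pi by lra.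
have c0 := cos_d_gt d0 dpi.
pose B : set (measurableTypeR R) := ball t0 d.
have mB : measurable B by exact: measurable_ball.
have sB : B `<=` II.
  move=> t; rewrite /B /= /ball /= in_itv /= => h.
  have := ler_norm t0; have := ler_norm (- t0); rewrite normrN => h1 h2.
  by move: h; rewrite ltr_distlC => /andP[h3 h4]; apply/andP; split; lra.
pose F n t := ((bump n (arc_fun t0 d t))%:E * g t)%E.
pose G t := ((1 - \1_B t)%:E * g t)%E.
have mF n : measurable_fun II (F n).
  apply: measurable_funTS; apply: emeasurable_funM => //.
  by apply/measurable_EFinP; exact: measurable_bump.
have mG : measurable_fun II G.
  apply: measurable_funTS; apply: emeasurable_funM => //.
  apply/measurable_EFinP; apply: measurable_funB; first exact: measurable_cst.
  exact: measurable_indic.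
(* At the two ends of the arc [arc_fun] equals 1/2, where [bump] tends neither to 0 nor to 1. *)
have nI := ae_neq2 (t0 + d) (t0 - d).
have cvg : {ae mu, forall t : measurableTypeR R, II t -> F ^~ t @ \oo --> G t}.
  move: nI; apply: filterS => t [n1 n2] It.
  have tpi : - pi <= t <= pi by move: It; rewrite /= in_itv.
  have [e1 e2] := cos_lt_arc d0 dt tpi.
  have /andP[a0 a1] := arc_fun_itv t0 t d0 d2.
  have ae : 2 * arc_fun t0 d t * (1 + cos d) = 1 + cos (t - t0).
    by rewrite /arc_fun; field; rewrite gt_eqF.
  have gt : exists r, g t = r%:E by exists (complex.Re (f (expi t))).
  have [r gr] := gt.
  rewrite /F /G gr.
  have Bt : B t = (`|t - t0| < d) :> Prop by rewrite /B /ball /= distrC.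
  have [lt|gt'|eq] := ltgtP (`|t - t0|) d.
  - rewrite indicE mem_set ?Bt// subrr mul0e -[X in _ --> X](mul0e r%:E).
    under eq_fun do rewrite -EFinM.
    rewrite -EFinM; apply: cvg_EFin; first exact: nearW.
    apply: cvgM; last exact: cvg_cst.
    apply: bump_cvg0 => //.
    have h : cos d < cos (t - t0) by rewrite e1.
    by rewrite -(ltr_pM2r c0) mul1r ae; lra.
  - rewrite indicE memNset ?Bt; last by apply/negP; rewrite -leNgt ltW.
    rewrite subr0 -EFinM; under eq_fun do rewrite -EFinM.
    apply: cvg_EFin; first exact: nearW.
    apply: cvgM; last exact: cvg_cst.
    apply: bump_cvg1 => //.
    have h : cos (t - t0) < cos d by rewrite e2.
    by rewrite -(ltr_pM2r c0) mul1r ae; lra.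
  - exfalso; move: eq => /eqP; rewrite eqr_norml => /andP[/orP[/eqP h|/eqP h] _].
      by move: n1; rewrite -h addrC subrK eqxx.
    by move: n2; rewrite -h addrC subrK eqxx.
have dom : {ae mu, forall (t : measurableTypeR R) n, II t -> (`|F n t| <= `|g t|)%E}.
  apply: aeW => t n _; rewrite /F abseM -[leRHS]mul1e.
  apply: lee_wpmul2r => //; rewrite lee_fin.
  have /andP[? ?] := bump_itv n (arc_fun_itv t0 t d0 d2).
  by rewrite ger0_norm.
have [iG _ lim] := dominated_convergence mII mF mG cvg (integrable_abse gi) dom.
have : (\int[mu]_(t in II) G t = 0)%E.
  have e n : (\int[mu]_(t in II) F n t = 0)%E.
    have Fi : mu.-integrable II (F n).
      apply: (le_integrable mII (mF n) _ (integrable_abse gi)) => t It.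
      rewrite [leRHS]gee0_abs; last exact: abse_ge0.
      rewrite /F abseM -[leRHS]mul1e.
      apply: lee_wpmul2r => //; rewrite lee_fin.
      have /andP[? ?] := bump_itv n (arc_fun_itv t0 t d0 d2).
      by rewrite ger0_norm.
    have Ff := integrable_fin_num mII Fi; have := Re_bump_int t0 d n f0.
    rewrite /Rintegral -[X in X = _ -> _]/(fine (\int[mu]_(t in II) F n t)).
    by move=> h; rewrite -(fineK Ff) h.
  apply: (cvg_unique _ lim) => //.
  rewrite (_ : [sequence _]_n = fun=> 0%E); first exact: cvg_cst.
  by apply/funext => n; exact: e.
have : (\int[mu]_(t in II) g t = 0)%E.
  have [_ /(_ 0)] := f0; rewrite /fourier oppr0.
  under eq_fun do rewrite expr0z mulr1.
  move=> /eqP; rewrite eq_complex /= => /andP[/eqP h _].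
  have : Rintegral mu II (fun t => complex.Re (f (expi t))) = 0.
    by apply: (mulfI (lt0r_neq0 (pi_inv_gt0 R))); rewrite mulr0.
  by rewrite /Rintegral => h'; rewrite -(fineK (integrable_fin_num mII gi)) h'.
move=> g00 G00.
have : (\int[mu]_(t in II) (g t - G t) = 0)%E by rewrite integralB// g00 G00 sube0.
move=> <-; rewrite -[RHS](_ : \int[mu]_(t in II) ((g \_ B) t) = _)%E.
  rewrite -integral_mkcondr setIC; congr integral.
  by apply/seteqP; split => [t Bt|t []//]; split => //; exact: sB.
apply: eq_integral => t _; rewrite /G patchE indicE.
have [_|_] := boolP (t \in B); first by rewrite subrr mul0e sube0.
by rewrite subr0 mul1e subee.
Qed.

(** At a Lebesgue point x the averages of |g - g(x)| over shrinking balls tend to 0, yet each is at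
    least |g(x)| because g has integral 0 over the ball. *)
Lemma Re_all_fourier0 (f : circle R -> C) : all_fourier0 f ->
  circle_ae (fun z => complex.Re (f z) = 0).
Proof.
move=> f0; have [fi _] := f0; apply: circle_ae_II.
pose g t := complex.Re (f (expi t)).
have loc := integrable_locally_restrict mII (cL1_ReI fi).
have leb : {ae mu, forall t : measurableTypeR R, lebesgue_pt (g \_ II) t} := lebesgue_differentiation loc.
(* Away from the end points, small balls stay inside the period. *)
have nI := ae_neq2 pi (- pi).
move: leb nI; rewrite /almost_everywhere /= => leb nI.
apply: (negligibleS _ (negligibleU leb nI)) => x /= nx.
rewrite -not_andP => -[lx [n1 n2]]; apply: nx => Ix.
have Ix' : - pi <= x <= pi by move: Ix; rewrite /= in_itv.
have xpi : `|x| < pi by rewrite ltr_norml !lt_neqAle; case/andP: Ix' => -> ->; rewrite eq_sym n2 n1.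
apply/eqP; rewrite -normr_eq0 eq_le normr_ge0 andbT -lee_fin.
move: lx; rewrite /lebesgue_pt => lx.
apply: (cvge_ge _ lx).
have p0 := pi_gt0 R.
near=> r.
have r0 : 0 < r by near: r; exact: nbhs_right_gt.
have r1 : r < pi / 2 by near: r; apply: nbhs_right_lt; lra.
have r2 : r < pi - `|x| by near: r; apply: nbhs_right_lt; lra.
pose B : set (measurableTypeR R) := ball x r.
have mB : measurable B by exact: measurable_ball.
have sB : B `<=` II.
  move=> t; rewrite /B /= /ball /= in_itv /= => h.
  have := ler_norm x; have := ler_norm (- x); rewrite normrN => h1 h2.
  by move: h; rewrite ltr_distlC => /andP[h3 h4]; apply/andP; split; lra.
have i0 : (\int[mu]_(t in B) (g t)%:E = 0)%E by apply: Re_arc_int => //; lra.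
have gB : mu.-integrable B (EFin \o g) by apply: integrableS (cL1_ReI fi).
have muB : mu B = (r *+ 2)%:E by exact: (lebesgue_measure_ball _ (ltW r0)).
have cB : mu.-integrable B (cst (g x)%:E).
  exact: (integrableS mII mB sB (cL1_ReI (cL1_cst ((g x)%:C)))).
rewrite /davg /iavg -/B muB.
have -> : (`|g x|%:E = ((r *+ 2)%:E)^-1 * `| \int[mu]_(t in B) ((g t)%:E - (g x)%:E) |)%E.
  rewrite integralB// i0 sub0e abseN integral_cst//.
  rewrite [X in `|_ * X|%E](_ : _ = (r *+ 2)%:E); last exact: muB.
  rewrite -EFinM /= normrM.
  rewrite inver mulrn_eq0 /= gt_eqF// -EFinM (ger0_norm (mulrn_wge0 _ (ltW r0))).
  by rewrite mulrCA mulVf ?mulr1// mulrn_eq0 /= gt_eqF.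
rewrite lee_pmul2l ?inver ?mulrn_eq0 ?gt_eqF//= ?lte_fin ?invr_gt0 ?pmulrn_lgt0//.
have e : {in B, forall t, ((g t)%:E - (g x)%:E = ((center ((g \_ II) x) \o (g \_ II)) t)%:E)%E}.
  move=> t /set_mem /sB It; rewrite /= !patchE.
  have xI : x \in II by apply/mem_set.
  have tI : t \in II by apply/mem_set.
  by rewrite xI tI.
rewrite (eq_integral _ _ e); apply: le_abse_integral => //.
apply: eq_measurable_fun; first by move=> t tB; exact: (e t tB).
by apply: emeasurable_funB; [case/integrableP: gB|exact: measurable_cst].
Unshelve. all: by end_near. Qed.

Theorem fourier_uniqueness (f : circle R -> C) : cL1 f ->
  (forall k, fourier f k = 0) -> circle_ae (fun z => f z = 0).
Proof.
move=> fi fk; have f0 : all_fourier0 f by [].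
(* The real part of - i f is the imaginary part of f. *)
have := circle_ae_and (Re_all_fourier0 f0)
  (Re_all_fourier0 (all_fourier0_trig (trig_cst (- 'i)) f0)).
apply: circle_ae_imp => z [h1]; case: (f z) h1 => a b /= ->.
by rewrite oppr0 mul0r mulN1r opprK add0r => ->.
Qed.

End FourierUniqueness2.

(** * Orthonormal families in finite dimension *)

Section FiniteDimensional.
Variables (R : realType) (X : vectType R[i]) (dX : {dot X for conjC}).
Local Notation C := R[i].

Lemma dDl x y z : dX (x + y) z = dX x z + dX y z. Proof. exact: linearDl. Qed.
Lemma dDr x y z : dX x (y + z) = dX x y + dX x z. Proof. exact: linearDr. Qed.
Lemma dZl (a : C) x y : dX (a *: x) y = a * dX x y. Proof. exact: linearZl_LR. Qed.
Lemma dZr (a : C) x y : dX x (a *: y) = Num.conj a * dX x y.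
Proof. exact: linearZr_LR. Qed.
Lemma d0l x : dX 0 x = 0. Proof. exact: linear0l. Qed.
Lemma d0r x : dX x 0 = 0. Proof. exact: linear0r. Qed.
Lemma dBl x y z : dX (x - y) z = dX x z - dX y z. Proof. exact: linearBl. Qed.
Lemma dBr x y z : dX x (y - z) = dX x y - dX x z. Proof. exact: linearBr. Qed.
Lemma dC x y : Num.conj (dX x y) = dX y x.
Proof. by rewrite [RHS]hermC /= expr0 mul1r. Qed.
Lemma d_suml I (r : seq I) (P : pred I) (F : I -> X) y :
  dX (\sum_(i <- r | P i) F i) y = \sum_(i <- r | P i) dX (F i) y.
Proof. exact: linear_sumlz. Qed.
Lemma d_sumr I (r : seq I) (P : pred I) (F : I -> X) y :
  dX y (\sum_(i <- r | P i) F i) = \sum_(i <- r | P i) dX y (F i).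
Proof. exact: linear_sumr. Qed.
Lemma d_ge0 x : 0 <= dX x x. Proof. exact: dnorm_ge0. Qed.
Lemma d_eq0 x : dX x x = 0 -> x = 0.
Proof. by move=> /eqP; rewrite dnorm_eq0 => /eqP. Qed.

Lemma vnorm_sq x : dX x x = (vnorm dX x ^+ 2)%:C.
Proof.
have := d_ge0 x; rewrite lecE /= => /andP[/eqP h0 h1].
rewrite /vnorm sqr_sqrtr//; case: (dX x x) h0 h1 => a b /= -> _; by [].
Qed.

Lemma d_cauchy x y : cabs (dX x y) ^+ 2 <= vnorm dX x ^+ 2 * vnorm dX y ^+ 2.
Proof.
have [h _] := CauchySchwarz dX x y; move: h.
by rewrite cabsE !vnorm_sq -rmorphXn -rmorphM lecR.
Qed.

(** A crude form of the Cauchy-Schwarz inequality whose right side is integrable for two L^2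
    functions. *)
Lemma d_le_sum x y : cabs (dX x y) <= vnorm dX x ^+ 2 + vnorm dX y ^+ 2.
Proof.
have := d_cauchy x y; have := cabs_ge0 (dX x y).
have := sqr_ge0 (vnorm dX x); have := sqr_ge0 (vnorm dX y).
move: (vnorm dX x ^+ 2) (vnorm dX y ^+ 2) (cabs _) => p q a p0 q0 a0 h.
rewrite -(@ler_pXn2r _ 2) ?nnegrE ?addr_ge0//.
apply: le_trans h _; nra.
Qed.

Definition onfamily m (e : 'I_m -> X) := forall i j, dX (e i) (e j) = (i == j)%:R.

Lemma onfamily_free m (e : 'I_m -> X) : onfamily e -> free [tuple e i | i < m].
Proof.
move=> oe; apply/freeP => k k0 i.
have : dX (\sum_(j < m) k j *: [tuple e i | i < m]`_j) (e i) = 0 by rewrite k0 d0l.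
have ne (j : 'I_m) : [tuple e i | i < m]`_j = e j by rewrite -tnth_nth tnth_mktuple.
under eq_bigr do rewrite ne.
rewrite d_suml (bigD1 i) //= big1 => [|j ji].
  by rewrite dZl oe eqxx mulr1 addr0.
by rewrite dZl oe (negbTE ji) mulr0.
Qed.

Lemma onfamily_dim m (e : 'I_m -> X) : onfamily e -> (m <= \dim (fullv : {vspace X}))%N.
Proof.
move=> /onfamily_free; rewrite /free => /eqP; rewrite size_tuple => <-.
by apply: dimvS; exact: subvf.
Qed.

Lemma onfamily_extend m (e : 'I_m -> X) : onfamily e ->
  (forall x, (forall i, dX x (e i) = 0) -> x = 0) \/
  exists e' : 'I_m.+1 -> X, onfamily e'.
Proof.
move=> oe; have [h|/existsNP[x /not_implyP[x0 /eqP xn]]] :=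
    pselect (forall x, (forall i, dX x (e i) = 0) -> x = 0); first by left.
right; pose u := (vnorm dX x)^-1%:C *: x.
have nx : vnorm dX x != 0.
  by apply: contra xn => /eqP n0; apply/eqP/d_eq0; rewrite vnorm_sq n0 expr0n.
have ue i : dX u (e i) = 0 by rewrite dZl x0 mulr0.
have eu i : dX (e i) u = 0 by rewrite -dC ue conjC0.
have uu : dX u u = 1.
  rewrite dZl dZr vnorm_sq -conjcE conjc_real -!rmorphM /=.
  rewrite mulrA expr2 mulrACA mulVf// mulr1 //.
exists (fun j => if unlift ord_max j is Some i then e i else u) => i j.
case: unliftP => [i' ->|->]; case: unliftP => [j' ->|->].
- by rewrite oe (inj_eq lift_inj).
- by rewrite eu eq_sym (negbTE (neq_lift _ _)).
- by rewrite ue (negbTE (neq_lift _ _)).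
- by rewrite uu eqxx.
Qed.

(** Orthonormal families are free, so extending one vector by vector stops at a complete family.
    Completeness makes it span, which forces its length to be the dimension. *)
Lemma onbasis_exists : exists e : 'I_(\dim (fullv : {vspace X})) -> X,
  onfamily e /\ forall x, (forall i, dX x (e i) = 0) -> x = 0.
Proof.
have H k : (exists e : 'I_k -> X, onfamily e) \/ exists m, exists e : 'I_m -> X,
    onfamily e /\ forall x, (forall i, dX x (e i) = 0) -> x = 0.
  elim: k => [|k [[e oe]|h]]; [|by case: (onfamily_extend oe) => h; [right; exists k, e|left]|by right].
  by left; exists (fun=> 0) => -[].
have [[e oe]|[m [e [oe ce]]]] := H (\dim (fullv : {vspace X})).+1.
  by have := onfamily_dim oe; rewrite ltnn.
suff md : m = \dim (fullv : {vspace X}) by rewrite -md; exists e.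
apply/eqP; rewrite eqn_leq (onfamily_dim oe) /=.
suff : (fullv <= <<[tuple e i | i < m]>>)%VS.
  by move=> /dimvS /leq_trans; apply; rewrite (leq_trans (dim_span _))// size_tuple.
apply/subvP => x _; have -> : x = \sum_(i < m) dX x (e i) *: e i.
  apply/eqP; rewrite -subr_eq0; apply/eqP/ce => i.
  rewrite dBl d_suml (bigD1 i) //= big1 => [|j ji].
    by rewrite dZl oe eqxx mulr1 addr0 subrr.
  by rewrite dZl oe (negbTE ji) mulr0.
apply: memv_suml => i _; apply: memvZ; apply: memv_span.
by apply/mapP; exists i; rewrite ?mem_enum.
Qed.

Definition onb := projT1 (cid onbasis_exists).
Lemma onbP : onfamily onb. Proof. by case: (projT2 (cid onbasis_exists)). Qed.
Lemma onb_expand x : x = \sum_i dX x (onb i) *: onb i.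
Proof.
have [oe ce] := projT2 (cid onbasis_exists).
apply/eqP; rewrite -subr_eq0; apply/eqP/ce => i; rewrite -/onb.
rewrite dBl d_suml (bigD1 i) //= big1 => [|j ji].
  by rewrite dZl onbP eqxx mulr1 addr0 subrr.
by rewrite dZl onbP (negbTE ji) mulr0.
Qed.
Lemma onb_parseval x y : dX x y = \sum_i dX x (onb i) * Num.conj (dX y (onb i)).
Proof.
rewrite {1}[x]onb_expand d_suml; apply: eq_bigr => i _.
by rewrite dZl -[dX (onb i) y]dC.
Qed.

End FiniteDimensional.

(** * The space L^2 of vector-valued functions and its inner product *)

Section L2Basics.
Variables (R : realType) (X : vectType R[i]) (dX : {dot X for conjC}).
Local Notation C := R[i].
Local Notation mu := (@lebesgue_measure R).
Local Notation II := (`[- pi, pi]%classic : set (measurableTypeR R)).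
Implicit Types f g h : circle R -> X.

Definition vmeas f := forall e, circle_measurable (fun z => dX (f z) e).

Lemma vmeas_dot f g : vmeas f -> vmeas g -> circle_measurable (fun z => dX (f z) (g z)).
Proof.
move=> mf mg; under eq_fun do rewrite onb_parseval.
by apply: cmeas_sum => i; apply: cmeas_mul; [exact: mf|apply: cmeas_conj; exact: mg].
Qed.

Lemma L2E f : L2 dX f <-> vmeas f /\ cL1 (fun z => dX (f z) (f z)).
Proof.
have e : (\int[mu]_(t in II) (vnorm dX (f (expi t)) ^+ 2)%:E =
    \int[mu]_(t in II) (cabs (dX (f (expi t)) (f (expi t))))%:E)%E.
  apply: eq_integral => t _; rewrite cabs_pos ?d_ge0//.
  by rewrite vnorm_sq.
split => [[mf fi]|[mf [_ fi]]]; split => //.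
  by split; [exact: vmeas_dot|rewrite -e].
by rewrite [ltLHS]e.
Qed.

Lemma L2_vmeas f : L2 dX f -> vmeas f. Proof. by case. Qed.

Lemma L2_cL1 f g : L2 dX f -> L2 dX g -> cL1 (fun z => dX (f z) (g z)).
Proof.
move=> /L2E[mf fi] /L2E[mg gi].
apply: cL1_dom (cL1_add fi gi) _; first exact: vmeas_dot.
apply: circle_ae_all => z; rewrite [leRHS]cabs_pos ?addr_ge0 ?d_ge0// !vnorm_sq.
exact: d_le_sum.
Qed.

Lemma vmeas_add f g : vmeas f -> vmeas g -> vmeas (f + g).
Proof.
move=> mf mg e; rewrite /= (_ : (fun z => _) = fun z => dX (f z) e + dX (g z) e).
  exact: cmeas_add.
by apply/funext => z; rewrite -dDl.
Qed.

Lemma vmeas_mul (k : circle R -> C) f : circle_measurable k -> vmeas f ->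
  vmeas (fun z => k z *: f z).
Proof.
move=> mk mf e; under eq_fun do rewrite dZl.
by apply: cmeas_mul.
Qed.

Lemma vmeas_cst x : vmeas (fun=> x).
Proof. by move=> e; exact: cmeas_cst. Qed.

Lemma L2_add f g : L2 dX f -> L2 dX g -> L2 dX (f + g).
Proof.
move=> fi gi; apply/L2E; split; first by apply: vmeas_add; exact: L2_vmeas.
rewrite (_ : (fun z => _) = fun z => (dX (f z) (f z) + dX (f z) (g z)) +
                                     (dX (g z) (f z) + dX (g z) (g z))).
  by apply: cL1_add; apply: cL1_add; exact: L2_cL1.
by apply/funext => z; rewrite -!dDr -dDl.
Qed.

Lemma L2_mul (k : circle R -> C) f (M : R) : circle_measurable k ->
  circle_ae (fun z => cabs (k z) <= M) -> L2 dX f -> L2 dX (fun z => k z *: f z).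
Proof.
move=> mk kM fi; apply/L2E; split; first by apply: vmeas_mul => //; exact: L2_vmeas.
under eq_fun do rewrite dZl dZr mulrA.
apply: (@cL1_bounded _ _ _ (`|M| ^+ 2)); [|exact: L2_cL1|].
  by apply: cmeas_mul => //; exact: cmeas_conj.
apply: circle_ae_imp kM => z kz; rewrite cabs_mul cabs_conj -expr2.
rewrite ler_pXn2r ?nnegrE ?cabs_ge0//.
by apply: le_trans kz (ler_norm _).
Qed.

Lemma L2_scale (a : C) f : L2 dX f -> L2 dX (a *: f).
Proof.
apply: (@L2_mul (fun=> a) _ (cabs a)); first exact: cmeas_cst.
exact: circle_ae_all.
Qed.

Lemma L2_opp f : L2 dX f -> L2 dX (- f).
Proof. by rewrite -scaleN1r; exact: L2_scale. Qed.

Lemma L2_sub f g : L2 dX f -> L2 dX g -> L2 dX (f - g).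
Proof. by move=> fi gi; apply: L2_add => //; exact: L2_opp. Qed.

Lemma L2_cst x : L2 dX (fun=> x).
Proof. by apply/L2E; split; [exact: vmeas_cst|exact: cL1_cst]. Qed.

Lemma L2_0 : L2 dX 0. Proof. exact: (L2_cst 0). Qed.

Definition zmul (k : int) f : circle R -> X := fun z => val z ^ k *: f z.

Lemma L2_zmul k f : L2 dX f -> L2 dX (zmul k f).
Proof.
apply: (@L2_mul _ _ 1); first exact: cmeas_exp.
by apply: circle_ae_all => z; rewrite cabs_exp.
Qed.

Lemma zmulD j k f : zmul j (zmul k f) = zmul (j + k) f.
Proof. by apply/funext => z; rewrite /zmul scalerA -expfzDr ?circle_neq0. Qed.

Lemma zmul0 f : zmul 0 f = f.
Proof. by apply/funext => z; rewrite /zmul expr0z scale1r. Qed.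

Lemma zmul_add k f g : zmul k (f + g) = zmul k f + zmul k g.
Proof. by apply/funext => z; exact: scalerDr. Qed.

Lemma zmul_scale k (a : C) f : zmul k (a *: f) = a *: zmul k f.
Proof. apply/funext => z; rewrite /zmul -[RHS]/(a *: (val z ^ k *: f z)).
by rewrite -[LHS]/(val z ^ k *: (a *: f z)) !scalerA mulrC. Qed.

Lemma zmul_sub k f g : zmul k (f - g) = zmul k f - zmul k g.
Proof. by rewrite zmul_add -scaleN1r zmul_scale scaleN1r. Qed.

Lemma circle_expJ (z : circle R) (k : int) : Num.conj (val z ^ k) = val z ^ (- k).
Proof.
rewrite -exprz_inv circle_inv; case: k => n; rewrite ?NegzE -?exprnN ?rmorphXn//.
by rewrite fmorphV rmorphXn.
Qed.

Lemma L2_flip f : L2 dX f -> L2 dX (fun z => f (circle_conj z)).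
Proof.
move=> /L2E[mf fi]; apply/L2E; split; last exact: (cL1_flip fi).
by move=> e; exact: (cmeas_flip (mf e)).
Qed.

Lemma opJE f : opJ f = zmul (-1) (fun z => f (circle_conj z)).
Proof. by apply/funext => z; rewrite /opJ /zmul exprN1 circle_inv. Qed.

Lemma L2_opJ f : L2 dX f -> L2 dX (opJ f).
Proof. by move=> fi; rewrite opJE; apply: L2_zmul; exact: L2_flip. Qed.

Lemma circle_conjK : involutive (@circle_conj R).
Proof. by move=> z; apply: val_inj; rewrite /= conjcK. Qed.

Lemma opJK f : opJ (opJ f) = f.
Proof.
apply/funext => z; rewrite /opJ circle_conjK scalerA [X in X *: _](_ : _ = 1) ?scale1r//.
by rewrite -[LHS]/(Num.conj (val z) * Num.conj (Num.conj (val z))) conjCK mulrC circle_unit.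
Qed.

Lemma opJ_zmul k f : opJ (zmul k f) = zmul (- k) (opJ f).
Proof.
apply/funext => z; rewrite /opJ /zmul /= !scalerA mulrC; congr (_ * _ *: _).
by rewrite -exprz_inv; congr (_ ^ _); exact/esym/circle_inv.
Qed.

Lemma opJ_add f g : opJ (f + g) = opJ f + opJ g.
Proof. by apply/funext => z; exact: scalerDr. Qed.

Lemma opJ_scale (a : C) f : opJ (a *: f) = a *: opJ f.
Proof. apply/funext => z; rewrite -[RHS]/(a *: ((val z)^* *: f (circle_conj z))).
by rewrite -[LHS]/((val z)^* *: (a *: f (circle_conj z))) !scalerA mulrC. Qed.

Lemma opJ_sub f g : opJ (f - g) = opJ f - opJ g.
Proof. by rewrite opJ_add -scaleN1r opJ_scale scaleN1r. Qed.

Lemma L2_ae f g : L2 dX f -> vmeas g -> ae_equal f g -> L2 dX g.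
Proof.
move=> /L2E[mf fi] mg fg; apply/L2E; split => //.
apply: cL1_ae fi _ _; first exact: vmeas_dot.
by apply: (@circle_ae_imp _ (fun z => f z = g z)) fg => z /= ->.
Qed.

End L2Basics.

Lemma ae_use (R : realType) (X : Type) (f g : circle R -> X) :
  ae_equal f g -> circle_ae (fun z => f z = g z).
Proof. by []. Qed.

Lemma cge0_Re (R : realType) (x : R[i]) : 0 <= x -> x = (complex.Re x)%:C.
Proof. by rewrite lecE; case: x => a b /= /andP[/eqP -> _]. Qed.

Section L2Dot.
Variables (R : realType) (X : vectType R[i]) (dX : {dot X for conjC}).
Local Notation C := R[i].
Local Notation mu := (@lebesgue_measure R).
Local Notation II := (`[- pi, pi]%classic : set (measurableTypeR R)).
Local Notation mII := (@mII R).
Local Notation L2 := (L2 dX).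
Local Notation dot := (L2_dot dX).
Implicit Types f g h : circle R -> X.

Definition nrm2 f : R := complex.Re (dot f f).

Lemma dotDl f g h : L2 f -> L2 g -> L2 h -> dot (f + g) h = dot f h + dot g h.
Proof.
move=> fi gi hi; rewrite /L2_dot -cint_add; try exact: (@L2_cL1 _ _ dX).
by congr circle_int; apply/funext => z; rewrite -dDl.
Qed.

Lemma dotZl (a : C) f g : L2 f -> L2 g -> dot (a *: f) g = a * dot f g.
Proof.
move=> fi gi; rewrite /L2_dot -cint_scale; try exact: (@L2_cL1 _ _ dX).
by congr circle_int; apply/funext => z; rewrite -dZl.
Qed.

Lemma dotC f g : L2 f -> L2 g -> Num.conj (dot f g) = dot g f.
Proof.
move=> fi gi; rewrite /L2_dot -cint_conj; try exact: (@L2_cL1 _ _ dX).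
by congr circle_int; apply/funext => z; rewrite dC.
Qed.

Lemma dotDr f g h : L2 f -> L2 g -> L2 h -> dot f (g + h) = dot f g + dot f h.
Proof.
move=> fi gi hi; rewrite -dotC ?dotDl ?rmorphD/= ?(dotC gi fi) ?(dotC hi fi)//; exact: L2_add.
Qed.

Lemma dotZr (a : C) f g : L2 f -> L2 g -> dot f (a *: g) = Num.conj a * dot f g.
Proof.
move=> fi gi; rewrite -dotC ?dotZl ?rmorphM/= ?(dotC gi fi)//; exact: L2_scale.
Qed.

Lemma dot0l g : dot 0 g = 0.
Proof.
rewrite /L2_dot (_ : (fun z => _) = fun=> 0) ?cint_cst//.
by apply/funext => z; rewrite d0l.
Qed.

Lemma dot0r g : dot g 0 = 0.
Proof.
rewrite /L2_dot (_ : (fun z => _) = fun=> 0) ?cint_cst//.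
by apply/funext => z; rewrite d0r.
Qed.

Lemma dotBl f g h : L2 f -> L2 g -> L2 h -> dot (f - g) h = dot f h - dot g h.
Proof.
move=> fi gi hi; rewrite -[- g]scaleN1r dotDl ?dotZl ?mulN1r//; exact: L2_scale.
Qed.

Lemma dotBr f g h : L2 f -> L2 g -> L2 h -> dot f (g - h) = dot f g - dot f h.
Proof.
move=> fi gi hi; rewrite -[- h]scaleN1r dotDr ?dotZr ?rmorphN1 ?mulN1r//; exact: L2_scale.
Qed.

Lemma dot_zmul k f g : dot (zmul k f) g = dot f (zmul (- k) g).
Proof.
congr circle_int; apply/funext => z.
by rewrite /zmul dZl dZr circle_expJ opprK.
Qed.

Lemma dot_zmul2 k f g : dot (zmul k f) (zmul k g) = dot f g.
Proof. by rewrite dot_zmul zmulD addNr zmul0. Qed.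

Lemma dot_opJ f g : L2 f -> L2 g -> dot (opJ f) g = dot f (opJ g).
Proof.
move=> fi gi; rewrite !opJE dot_zmul opprK /L2_dot.
rewrite -[LHS]cint_flip; last by apply: L2_cL1; [exact: L2_flip|exact: L2_zmul].
congr circle_int; apply/funext => z; rewrite circle_conjK; congr (dX _ _).
by rewrite /zmul expr1z exprN1 circle_inv.
Qed.

Lemma dot_fourier f e k : dot f (zmul k (fun=> e)) = fourier (fun z => dX (f z) e) k.
Proof.
by congr circle_int; apply/funext => z; rewrite /zmul dZr circle_expJ mulrC.
Qed.

Lemma dot_ae f f' g g' : L2 f -> L2 f' -> L2 g -> L2 g' ->
  ae_equal f f' -> ae_equal g g' -> dot f g = dot f' g'.
Proof.
move=> fi fi' gi gi' ff gg; apply: cint_ae; try (by apply: vmeas_dot; exact: L2_vmeas).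
have := circle_ae_and (ae_use ff) (ae_use gg); apply: circle_ae_imp => z [-> ->] //.
Qed.

Lemma dot_ge0 f : L2 f -> 0 <= dot f f.
Proof. by move=> fi; apply: cint_ge0; [exact: L2_cL1|move=> z; exact: d_ge0]. Qed.

Lemma nrm2E f : L2 f -> dot f f = (nrm2 f)%:C.
Proof.
by move=> /dot_ge0 /cge0_Re. Qed.

Lemma nrm2_ge0 f : L2 f -> 0 <= nrm2 f.
Proof. by move=> fi; have := dot_ge0 fi; rewrite nrm2E// ler0c. Qed.

Lemma dot_eq0 f : L2 f -> dot f f = 0 -> ae_equal f 0.
Proof.
move=> fi f0; have := @cint_eq0 _ _ (L2_cL1 fi fi) _ f0.
move=> /(_ (circle_ae_all (fun z => d_ge0 dX (f z)))).
by apply: circle_ae_imp => z /d_eq0 ->.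
Qed.

Lemma ae_sub0 f g : ae_equal (f - g) 0 -> ae_equal f g.
Proof. by move=> /ae_use; apply: circle_ae_imp => z h; apply/eqP; rewrite -subr_eq0; exact/eqP. Qed.

Lemma L2_uniqueness f : L2 f -> (forall k e, dot f (zmul k (fun=> e)) = 0) -> ae_equal f 0.
Proof.
move=> fi f0; pose n := \dim (fullv : {vspace X}).
have H (i : 'I_n) : circle_ae (fun z => dX (f z) (onb dX i) = 0).
  apply: fourier_uniqueness; first exact: (L2_cL1 fi (L2_cst dX (onb dX i))).
  by move=> k; rewrite -dot_fourier.
have Hall (s : seq 'I_n) : circle_ae (fun z => forall i, i \in s -> dX (f z) (onb dX i) = 0).
  elim: s => [|i s IH]; first by apply: circle_ae_all.
  have := circle_ae_and (H i) IH; apply: circle_ae_imp => z [h1 h2] j.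
  by rewrite inE => /orP[/eqP ->|/h2].
have := Hall (enum 'I_n); apply: circle_ae_imp => z h.
by rewrite [LHS](onb_expand dX) big1// => i _; rewrite h ?mem_enum// scale0r.
Qed.

Lemma dot_cauchy f g : L2 f -> L2 g -> cabs (dot f g) ^+ 2 <= nrm2 f * nrm2 g.
Proof.
move=> fi gi; have [g0|g0] := eqVneq (nrm2 g) 0.
  have -> : dot f g = 0.
    rewrite -(dot0r f); apply: (dot_ae fi fi gi (L2_0 dX) (circle_ae_all (fun=> erefl))).
    by apply: (dot_eq0 gi); rewrite nrm2E// g0.
  by rewrite g0 mulr0 /cabs normr0 expr0n.
have gp : 0 < nrm2 g by rewrite lt_neqAle eq_sym g0 nrm2_ge0.
(* [l *: g] is the projection of [f] on the line of [g]; the inequality is the positivity of the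
   squared norm of the remainder. *)
pose l := dot f g / (nrm2 g)%:C.
have lg := L2_scale l gi.
have := dot_ge0 (L2_sub fi lg).
rewrite (dotBl fi lg (L2_sub fi lg)) (dotBr fi fi lg) (dotBr lg fi lg) !(dotZl _ gi)//.
rewrite !(dotZr _ _ gi)// -(dotC fi gi).
have cl : Num.conj l = Num.conj (dot f g) / (nrm2 g)%:C.
  by rewrite /l rmorphM fmorphV; congr (_ / _); exact: conjc_real.
rewrite !nrm2E// cl /l.
have gc : (nrm2 g)%:C != 0 :> C by rewrite (_ : 0 = 0%:C)// (inj_eq (@complexI _)).
rewrite [X in _ - (_ - X)](_ : _ = Num.conj (dot f g) / (nrm2 g)%:C * dot f g); last by field.
rewrite [X in X - (_ - _)](_ : _ = (nrm2 f)%:C - `|dot f g| ^+ 2 / (nrm2 g)%:C); last first.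
  by rewrite normCK; field.
rewrite [X in _ - X](_ : _ = 0); last by field.
rewrite subr0 subr_ge0 cabsE -rmorphXn -fmorphV -rmorphM lecR.
by rewrite ler_pdivrMr.
Qed.

Lemma nrm2Z (a : C) f : L2 f -> nrm2 (a *: f) = cabs a ^+ 2 * nrm2 f.
Proof.
move=> fi; apply: complexI; rewrite -nrm2E; last exact: L2_scale.
rewrite dotZl ?dotZr ?nrm2E//; last exact: L2_scale.
by rewrite mulrA -normCK cabsE -rmorphXn -rmorphM.
Qed.

Lemma nrm2_subC f g : L2 f -> L2 g -> nrm2 (f - g) = nrm2 (g - f).
Proof.
move=> fi gi; rewrite -[f - g]opprB -scaleN1r nrm2Z; last exact: L2_sub.
by rewrite /cabs normrN1 expr1n mul1r.
Qed.

Lemma parallelogram f g : L2 f -> L2 g ->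
  nrm2 (f + g) + nrm2 (f - g) = 2 * nrm2 f + 2 * nrm2 g.
Proof.
move=> fi gi; rewrite /nrm2; have fg := L2_add fi gi; have fg' := L2_sub fi gi.
rewrite (dotDl fi gi fg) (dotDr fi fi gi) (dotDr gi fi gi).
rewrite (dotBl fi gi fg') (dotBr fi fi gi) (dotBr gi fi gi).
case: (dot f f) => a b; case: (dot g g) => c d; case: (dot f g) => e e'.
by case: (dot g f) => k k' /=; lra.
Qed.

Lemma int_vnorm f : L2 f ->
  (\int[mu]_(t in II) (vnorm dX (f (expi t)) ^+ 2)%:E = (pi *+ 2 * nrm2 f)%:E)%E.
Proof.
move=> fi; have [_ ff] := fi.
have p0 : (pi *+ 2 : R) != 0 by rewrite gt_eqF // pmulrn_lgt0 ?pi_gt0.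
rewrite /nrm2 /L2_dot /circle_int /= mulVKf// /Rintegral.
have -> : (\int[mu]_(t in II) (complex.Re (dX (f (expi t)) (f (expi t))))%:E =
   \int[mu]_(t in II) (vnorm dX (f (expi t)) ^+ 2)%:E)%E.
  by apply: eq_integral => t _; rewrite vnorm_sq.
rewrite fineK// ge0_fin_numE//.
by apply: integral_ge0 => t _; rewrite lee_fin sqr_ge0.
Qed.

End L2Dot.

(** * Completeness of L^2 *)

Section Completeness.
Variables (R : realType) (X : vectType R[i]) (dX : {dot X for conjC}).
Local Notation C := R[i].
Local Notation mu := (@lebesgue_measure R).
Local Notation II := (`[- pi, pi]%classic : set (measurableTypeR R)).
Local Notation mII := (@mII R).
Local Notation L2 := (L2 dX).
Local Notation dot := (L2_dot dX).
Local Notation nrm2 := (nrm2 dX).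
Local Notation n := (\dim (fullv : {vspace X})).
Local Notation e := (onb dX).

Lemma geometric_cvg (u : nat -> R) (K : R) :
  (forall k, `|u k.+1 - u k| <= K * 2^-1 ^+ k) -> cvgn u.
Proof.
move=> h; rewrite (_ : u = fun k => u 0%N + series (telescope u) k); last first.
  by apply/funext => k; exact: eq_sum_telescope.
apply: is_cvgD; first exact: is_cvg_cst.
apply: normed_cvg; apply: (series_le_cvg (v_ := geometric K 2^-1)).
- by move=> k; exact: normr_ge0.
- by move=> k; apply: le_trans (h k); exact: normr_ge0.
- by move=> k; exact: h.
- by apply: is_cvg_geometric_series; rewrite ger0_norm//; lra.
Qed.

Lemma cvg_sum_ord m (F : 'I_m -> nat -> R) (l : 'I_m -> R) :
  (forall i, F i k @[k --> \oo] --> l i) ->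
  (\sum_(i < m) F i k) @[k --> \oo] --> \sum_(i < m) l i.
Proof.
elim: m F l => [|m IH] F l h.
  by rewrite big_ord0; under eq_fun do rewrite big_ord0; exact: cvg_cst.
rewrite big_ord_recl; under eq_fun do rewrite big_ord_recl.
by apply: cvgD; [exact: h|apply: IH => i; exact: h].
Qed.

Lemma vnorm_sum x : vnorm dX x ^+ 2 =
  \sum_(i < n) (complex.Re (dX x (e i)) ^+ 2 + complex.Im (dX x (e i)) ^+ 2).
Proof.
apply: complexI; rewrite -vnorm_sq (onb_parseval dX x x) rmorph_sum; apply: eq_bigr => i _.
by rewrite -normCK cabsE -rmorphXn cabs_sqrt sqr_sqrtr// addr_ge0 ?sqr_ge0.
Qed.

Lemma coord_le_vnorm x i : cabs (dX x (e i)) <= vnorm dX x.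
Proof.
have v0 : 0 <= vnorm dX x by exact: sqrtr_ge0.
rewrite -(@ler_pXn2r _ 2) ?nnegrE ?cabs_ge0//.
have := d_cauchy dX x (e i).
have -> : vnorm dX (e i) ^+ 2 = 1.
  by apply: complexI; rewrite -vnorm_sq onbP eqxx.
by rewrite mulr1.
Qed.

(** Upper limits of the real and imaginary coordinates are measurable without any convergence
    assumption, and they are limits wherever the sequence converges. *)
Definition vlim (m : nat -> circle R -> X) : circle R -> X := fun z =>
  \sum_(i < n) (fine (limn_esup (fun k => (complex.Re (dX (m k z) (e i)))%:E)) +i*
                fine (limn_esup (fun k => (complex.Im (dX (m k z) (e i)))%:E))) *: e i.

Lemma vlim_coord m z i : dX (vlim m z) (e i) =
  fine (limn_esup (fun k => (complex.Re (dX (m k z) (e i)))%:E)) +i*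
  fine (limn_esup (fun k => (complex.Im (dX (m k z) (e i)))%:E)).
Proof.
rewrite /vlim d_suml (bigD1 i) //= big1 ?addr0 => [|j ji].
  by rewrite dZl onbP eqxx mulr1.
by rewrite dZl onbP (negbTE ji) mulr0.
Qed.

Lemma vlim_meas m : (forall k, vmeas dX (m k)) -> vmeas dX (vlim m).
Proof.
move=> mm x.
have H (F : nat -> measurableTypeR R -> R) : (forall k, measurable_fun setT (F k)) ->
    measurable_fun setT (fun t => fine (limn_esup (fun k => (F k t)%:E))).
  move=> mF; apply: (measurableT_comp (fine_measurable measurableT)).
  by apply: measurable_fun_limn_esup => k; exact/measurable_EFinP.
under eq_fun do rewrite /vlim d_suml.
apply: cmeas_sum => i; under eq_fun do rewrite dZl.
apply: cmeas_mul; last exact: cmeas_cst.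
by split; apply: H => k; have [] := mm k (e i).
Qed.

Lemma vlim_cvg m z (K : R) :
  (forall k, vnorm dX (m k.+1 z - m k z) <= K * 2^-1 ^+ k) ->
  forall i, (complex.Re (dX (m k z) (e i)) @[k --> \oo] --> complex.Re (dX (vlim m z) (e i))) /\
   (complex.Im (dX (m k z) (e i)) @[k --> \oo] --> complex.Im (dX (vlim m z) (e i))).
Proof.
move=> h i; rewrite vlim_coord /=.
have H (u : nat -> R) : (forall k, `|u k.+1 - u k| <= K * 2^-1 ^+ k) ->
    u k @[k --> \oo] --> fine (limn_esup (fun k => (u k)%:E)).
  move=> /geometric_cvg cu; have /cvg_limn_einf_sup[_ ->] : (u k)%:E @[k --> \oo] --> (limn u)%:E.
    by apply: cvg_EFin => //; exact: nearW.
  exact: cu.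
split; apply: H => k; apply: le_trans (h k); apply: le_trans (coord_le_vnorm _ i);
  rewrite dBl.
  apply: le_trans (Re_le_cabs _); rewrite le_eqVlt; apply/orP; left; apply/eqP.
  by case: (dX _ _); case: (dX _ _).
apply: le_trans (Im_le_cabs _); rewrite le_eqVlt; apply/orP; left; apply/eqP.
by case: (dX _ _); case: (dX _ _).
Qed.

Lemma vlim_cvg_vnorm m z (K : R) (x : X) :
  (forall k, vnorm dX (m k.+1 z - m k z) <= K * 2^-1 ^+ k) ->
  vnorm dX (x - m k z) ^+ 2 @[k --> \oo] --> vnorm dX (x - vlim m z) ^+ 2.
Proof.
move=> /vlim_cvg h; rewrite vnorm_sum; under eq_fun do rewrite vnorm_sum.
apply: cvg_sum_ord => i; have [h1 h2] := h i.
have eR (a b : C) : complex.Re (a - b) = complex.Re a - complex.Re b by case: a; case: b.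
have eI (a b : C) : complex.Im (a - b) = complex.Im a - complex.Im b by case: a; case: b.
rewrite dBl eR eI; under eq_fun do rewrite dBl eR eI.
apply: cvgD; rewrite expr2; under eq_fun do rewrite expr2.
  by apply: cvgM; apply: cvgB => //; exact: cvg_cst.
by apply: cvgM; apply: cvgB => //; exact: cvg_cst.
Qed.

Lemma measurable_vnorm_sq (f : circle R -> X) : vmeas dX f ->
  measurable_fun setT (fun t : measurableTypeR R => vnorm dX (f (expi t)) ^+ 2).
Proof.
move=> mf; have [h _] := vmeas_dot mf mf.
by move: h; apply: eq_measurable_fun => t _; rewrite vnorm_sq.
Qed.

(** The rate 8^-k of the squared norms is split: after weighting by 4^k a summable 2^-k remains, so
    the weighted series of squares is integrable and thus finite a.e. Each of its terms is bounded
    by the sum, which bounds the increments themselves by a multiple of 2^-k. *)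
Lemma ae_geometric (m : nat -> circle R -> X) (c : R) : (forall k, L2 (m k)) ->
  (forall k, nrm2 (m k.+1 - m k) <= c * 8^-1 ^+ k) ->
  {ae mu, forall t : measurableTypeR R, II t -> exists K, forall k,
    vnorm dX (m k.+1 (expi t) - m k (expi t)) <= K * 2^-1 ^+ k}.
Proof.
move=> mL hm.
have p0 : 0 < (pi *+ 2 : R) by rewrite pmulrn_lgt0 ?pi_gt0.
have c0 : 0 <= c.
  have := hm 0%N; rewrite expr0 mulr1; apply: le_trans; apply: nrm2_ge0.
  exact: L2_sub.
pose F k (t : measurableTypeR R) : \bar R := ((4 ^+ k) * vnorm dX (m k.+1 (expi t) - m k (expi t)) ^+ 2)%:E.
have F0 k t : (0 <= F k t)%E by rewrite lee_fin mulr_ge0 ?sqr_ge0 ?exprn_ge0.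
have mF k : measurable_fun II (F k).
  apply: EFin_mfun; apply: measurable_funM; first exact: measurable_cst.
  by apply: (measurable_vnorm_sq (f := m k.+1 - m k)); apply: L2_vmeas; exact: L2_sub.
have iF k : (\int[mu]_(t in II) F k t <= (pi *+ 2 * c * 2^-1 ^+ k)%:E)%E.
  rewrite /F; under eq_integral do rewrite EFinM.
  rewrite ge0_integralZl_EFin //; last 2 first.
  - by move=> t _; rewrite lee_fin sqr_ge0.
  - by apply: EFin_mfun; apply: (measurable_vnorm_sq (f := m k.+1 - m k)); apply: L2_vmeas; exact: L2_sub.
  rewrite (int_vnorm (L2_sub (mL k.+1) (mL k))) -EFinM lee_fin.
  rewrite mulrCA -mulrA ler_pM2l//.
  have e4 : (0 : R) <= 4 ^+ k by rewrite exprn_ge0.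
  apply: le_trans (ler_wpM2l e4 (hm k)) _.
  rewrite mulrCA ler_wpM2l// -exprMn.
  by rewrite (_ : 4 * 8^-1 = 2^-1 :> R)//; field.
have iS : (\int[mu]_(t in II) (\sum_(k <oo) F k t) < +oo)%E.
  rewrite integral_nneseries//.
  apply: (@le_lt_trans _ _ (pi *+ 2 * c * 2)%:E); last exact: ltry.
  apply: lime_le.
    by apply: is_cvg_nneseries => k _ _; exact: integral_ge0.
  apply: nearW => N.
  have H : (\sum_(0 <= k < N) \int[mu]_(t in II) F k t <=
      (pi *+ 2 * c * (2 - 2 * 2^-1 ^+ N))%:E)%E.
    elim: N => [|N IH].
      by rewrite big_nil expr0 mulr1 subrr mulr0.
    rewrite big_nat_recr//=; apply: le_trans (leeD IH (iF N)) _.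
    rewrite -EFinD lee_fin exprS -mulrDr.
    apply: ler_wpM2l; last by lra.
    by rewrite mulr_ge0// ltW.
  apply: le_trans H _; rewrite lee_fin ler_wpM2l//; first by rewrite mulr_ge0// ltW.
  by rewrite lerBlDr lerDl mulr_ge0// exprn_ge0.
have mS : measurable_fun II (fun t => \sum_(k <oo) F k t)%E.
  exact: ge0_emeasurable_sum.
have Si : mu.-integrable II (fun t => \sum_(k <oo) F k t)%E.
  apply/integrableP; split => //.
  rewrite (eq_integral (fun t => \sum_(k <oo) F k t)%E) // => t _.
  by rewrite gee0_abs// nneseries_ge0.
have := integrable_ae mII Si; apply: filterS => t /= h It.
pose S : R := fine (\sum_(k <oo) F k t)%E.
have hS : (\sum_(k <oo) F k t = S%:E)%E by rewrite /S fineK//; exact: h.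
exists (Num.sqrt S) => k.
have FS : 4 ^+ k * vnorm dX (m k.+1 (expi t) - m k (expi t)) ^+ 2 <= S.
  rewrite -lee_fin -hS -/(F k t).
  apply: (@le_trans _ _ (\sum_(0 <= j < k.+1) F j t)%E).
    rewrite big_nat_recr//= leeDr// sume_ge0//.
  by apply: nneseries_lim_ge.
have v0 x : 0 <= vnorm dX x by exact: sqrtr_ge0.
have S0 : 0 <= S by apply: le_trans FS; rewrite mulr_ge0 ?sqr_ge0 ?exprn_ge0.
rewrite exprVn ler_pdivlMr ?exprn_gt0//.
rewrite -(@ler_pXn2r _ 2) ?nnegrE ?mulr_ge0 ?exprn_ge0 ?sqrtr_ge0//.
rewrite sqr_sqrtr// exprMn mulrC -exprM mulnC exprM.
by rewrite (_ : 2 ^+ 2 = 4)//; rewrite expr2 -natrM.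
Qed.

(** The sequence converges a.e. by [ae_geometric]. Fatou's lemma, applied to the squared distances
    from [m k] to the later terms, carries the Cauchy bound over to the limit; the same bound shows
    that the limit is in L^2. *)
Lemma L2_complete (m : nat -> circle R -> X) (c : R) : (forall k, L2 (m k)) ->
  (forall k j, (k <= j)%N -> nrm2 (m k - m j) <= c * 8^-1 ^+ k) ->
  exists p, L2 p /\ forall k, nrm2 (m k - p) <= c * 8^-1 ^+ k.
Proof.
move=> mL hm.
have hm1 k : nrm2 (m k.+1 - m k) <= c * 8^-1 ^+ k by rewrite nrm2_subC//; exact: hm.
have ae := ae_geometric mL hm1.
have mp : vmeas dX (vlim m) by apply: vlim_meas => k; exact: L2_vmeas.
have p0 : 0 < (pi *+ 2 : R) by rewrite pmulrn_lgt0 ?pi_gt0.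
have mm k : vmeas dX (m k - vlim m).
  by apply: vmeas_add; [exact: L2_vmeas|rewrite -scaleN1r; apply: (vmeas_mul (cmeas_cst (-1)))].
have bound k : (\int[mu]_(t in II) (vnorm dX ((m k - vlim m) (expi t)) ^+ 2)%:E <=
    (pi *+ 2 * (c * 8^-1 ^+ k))%:E)%E.
  pose f j (t : measurableTypeR R) := (vnorm dX ((m k - m (j + k)%N) (expi t)) ^+ 2)%:E.
  have mf j : measurable_fun II (f j).
    by apply: EFin_mfun; apply: measurable_vnorm_sq; apply: L2_vmeas; exact: L2_sub.
  have f0 j t : II t -> (0 <= f j t)%E by move=> _; rewrite lee_fin sqr_ge0.
  have := fatou mu mII mf f0.
  have -> : (\int[mu]_(t in II) limn_einf (f^~ t) =
     \int[mu]_(t in II) (vnorm dX ((m k - vlim m) (expi t)) ^+ 2)%:E)%E.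
    apply: ae_eq_integral => //.
    - apply: (measurableT_comp (@oppe_measurable R setT)); apply: measurable_fun_limn_esup => j.
      by apply: (measurableT_comp (@oppe_measurable R setT)) => //; exact: mf.
    - by apply: EFin_mfun; exact: measurable_vnorm_sq.
    - move: ae; apply: filterS => t /= h It; have [K hK] := h It.
      suff : f j t @[j --> \oo] --> (vnorm dX ((m k - vlim m) (expi t)) ^+ 2)%:E.
        by move=> /cvg_limn_einf_sup[].
      apply: cvg_EFin; first exact: nearW.
      have := @vlim_cvg_vnorm m (expi t) K (m k (expi t)) hK.
      by move=> hc; rewrite (cvg_shiftn k (fun j => vnorm dX (m k (expi t) - m j (expi t)) ^+ 2)).
  move=> /le_trans; apply; rewrite limn_einf_lim.
  apply: lime_le; first exact: is_cvg_einfs.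
  apply: nearW => j; apply: (@le_trans _ _ (\int[mu]_(t in II) f j t)%E).
    by apply: ereal_inf_lbound; exists j => /=.
  rewrite (int_vnorm (L2_sub (mL k) (mL (j + k)%N))) lee_fin ler_pM2l//.
  by apply: hm; rewrite leq_addl.
have mpL k : L2 (m k - vlim m).
  split; first exact: mm.
  exact: (le_lt_trans (bound k) (ltry _)).
have pL : L2 (vlim m).
  by rewrite -[vlim m](subKr (m 0%N)); apply: L2_sub.
exists (vlim m); split => // k; have := bound k.
by rewrite int_vnorm// lee_fin ler_pM2l.
Qed.

End Completeness.

(** * Integrals of exponentials *)

Section Exponentials.
Variable R : realType.
Local Notation C := R[i].
Local Notation mu := (@lebesgue_measure R).
Local Notation II := (`[- pi, pi]%classic : set (measurableTypeR R)).

Lemma Rint_FTC (f F : R -> R) : continuous f -> (forall t : R, is_derive t (1 : R) F (f t)) ->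
  F pi = F (- pi) -> Rintegral mu II f = 0.
Proof.
move=> cf dF FF; rewrite /Rintegral.
have cF : continuous F.
  move=> t; apply: differentiable_continuous; apply/derivable1_diffP.
  by apply: ex_derive; exact: dF.
rewrite (@continuous_FTC2 _ f F); first by rewrite FF subee.
- by rewrite gtrN// pi_gt0.
- exact: continuous_subspaceT.
- split; first by move=> t _; apply: ex_derive; exact: dF.
    by apply: cvg_at_right_filter; exact: cF.
  by apply: cvg_at_left_filter; exact: cF.
- by move=> t _; rewrite derive1E; apply: derive_val; exact: dF.
Qed.

Lemma expi_pow (t : R) (m : nat) :
  val (expi t) ^+ m = cos (m%:R * t) +i* sin (m%:R * t) :> C.
Proof.
elim: m => [|m IH]; first by rewrite expr0 mul0r cos0 sin0.
rewrite exprS IH -natr1 mulrDl mul1r cosD sinD /=.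
by rewrite -[LHS]/(_ +i* _); congr (_ +i* _); ring.
Qed.

(** For k < 0 the exponent - k is a positive natural number, so de Moivre's formula gives
    antiderivatives with equal values at both end points. The other sign follows by conjugation in
    [fourier_cst]. *)
Lemma fourier_cst0 (c : C) (k : int) : k < 0 ->
  circle_int (fun z : circle R => c * val z ^ (- k)) = 0.
Proof.
case: k => // m _.
have i1 : cL1 (fun z : circle R => val z ^ (- Negz m)).
  have := @cL1_expr R (- Negz m) (fun=> 1) (@cL1_cst R 1).
  by under eq_fun do rewrite mul1r.
rewrite cint_scale// (_ : circle_int _ = 0) ?mulr0//.
rewrite NegzE opprK /circle_int.
have a0 : m.+1%:R != 0 :> R by rewrite pnatr_eq0.
set a : R := m.+1%:R in a0.
have cla : continuous (fun t : R => a * t).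
  by move=> t; apply: cvgM; [exact: cvg_cst|exact: cvg_id].
have spi : sin (a * pi) = 0.
  rewrite /a; elim: m.+1 => [|j IH]; first by rewrite mul0r sin0.
  by rewrite -natr1 mulrDl mul1r sinDpi IH oppr0.
have hc : Rintegral mu II (fun t => cos (a * t)) = 0.
  apply: (@Rint_FTC _ (fun t => a^-1 * sin (a * t))).
  - by move=> t; apply: continuous_comp; [exact: cla|exact: continuous_cos].
  - move=> t; apply: is_derive_eq.
    by rewrite /GRing.scale /= mulr1 ?mulr0 ?addr0 mulrA mulrAC mulVf ?mul1r.
  - by rewrite mulrN sinN spi oppr0.
have hs : Rintegral mu II (fun t => sin (a * t)) = 0.
  apply: (@Rint_FTC _ (fun t => a^-1 * - cos (a * t))).
  - by move=> t; apply: continuous_comp; [exact: cla|exact: continuous_sin].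
  - move=> t; apply: is_derive_eq.
    by rewrite /GRing.scale /= ?mulr0 ?addr0 mulr1 -mulNr opprK mulrA mulrAC mulVf ?mul1r.
  - by rewrite [a * - pi]mulrN cosN.
have eR : Rintegral mu II (fun t => complex.Re (val (expi t) ^+ m.+1)) = 0.
  by rewrite -[RHS]hc; apply: eq_Rintegral => t _; rewrite expi_pow.
have eI : Rintegral mu II (fun t => complex.Im (val (expi t) ^+ m.+1)) = 0.
  by rewrite -[RHS]hs; apply: eq_Rintegral => t _; rewrite expi_pow.
transitivity ((pi *+ 2 : R)^-1 * 0 +i* ((pi *+ 2)^-1 * 0)); last by rewrite mulr0.
by congr (_ * _ +i* (_ * _)); [exact: eR|exact: eI].
Qed.

End Exponentials.

(** * Orthogonal projections, annihilators and the Hardy space *)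

Section Projection.
Variables (R : realType) (X : vectType R[i]) (dX : {dot X for conjC}).
Local Notation C := R[i].
Local Notation L2 := (L2 dX).
Local Notation dot := (L2_dot dX).
Local Notation nrm2 := (nrm2 dX).
Implicit Types f g h : circle R -> X.

Definition closed_sub (M : set (circle R -> X)) :=
  [/\ M `<=` L2, M 0, (forall (a : C) f g, M f -> M g -> M (a *: f + g)) &
      forall (s : nat -> circle R -> X) f, (forall n, M (s n)) -> L2 f ->
        (fun n => nrm2 (s n - f)) @ \oo --> (0 : R) -> M f].

(** Removing from x its component along m lowers the squared norm by |<x, m>|^2 / |m|^2, which can
    be at most eps. The slack eps lets this apply to the terms of a minimizing sequence. *)
Lemma min_orth (x m : circle R -> X) (d eps : R) : L2 x -> L2 m ->
  (forall a : C, d <= nrm2 (x - a *: m)) -> nrm2 x <= d + eps ->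
  cabs (dot x m) ^+ 2 <= eps * nrm2 m.
Proof.
move=> xi mi hd hx; have [m0|m0] := eqVneq (nrm2 m) 0.
  by apply: le_trans (dot_cauchy xi mi) _; rewrite m0 !mulr0.
have mp : 0 < nrm2 m by rewrite lt_neqAle eq_sym m0 nrm2_ge0.
pose l := dot x m / (nrm2 m)%:C.
have lm := L2_scale l mi; have xl := L2_sub xi lm.
have := hd l; rewrite -lecR -nrm2E//.
rewrite (dotBl xi lm xl) (dotBr xi xi lm) (dotBr lm xi lm) !(dotZl _ mi)// !dotZr//.
rewrite -[dot m x]dotC//.
have cl : Num.conj l = Num.conj (dot x m) / (nrm2 m)%:C.
  by rewrite /l rmorphM fmorphV; congr (_ / _); exact: conjc_real.
rewrite !nrm2E// cl /l.
have mc : (nrm2 m)%:C != 0 :> C by rewrite (_ : 0 = 0%:C)// (inj_eq (@complexI _)).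
rewrite [X in _ <= X](_ : _ = (nrm2 x)%:C - `|dot x m| ^+ 2 / (nrm2 m)%:C); last first.
  by rewrite normCK; field.
rewrite cabsE -rmorphXn -fmorphV -rmorphM -rmorphB lecR => h.
rewrite -ler_pdivrMr//; lra.
Qed.

Lemma proj_exists M f : closed_sub M -> L2 f ->
  exists p, M p /\ forall m, M m -> dot (f - p) m = 0.
Proof.
move=> [ML M0 Mlin Mcl] fi.
pose D := [set nrm2 (f - m) | m in M].
have D0 : D !=set0 by exists (nrm2 (f - 0)); exists 0.
have lD : has_lbound D.
  by exists 0 => _ [m Mm <-]; apply: nrm2_ge0; apply: L2_sub => //; exact: ML.
pose d := inf D.
have hd m : M m -> d <= nrm2 (f - m) by move=> Mm; apply: ge_inf => //; exists m.
have ex k : exists m, M m /\ nrm2 (f - m) <= d + 8^-1 ^+ k.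
  have e0 : 0 < (8^-1 : R) ^+ k by rewrite exprn_gt0.
  have [_ [m Mm <-] h] := inf_adherent e0 (conj D0 lD).
  by exists m; split => //; exact: ltW.
pose m k := projT1 (cid (ex k)).
have Mm k : M (m k) by case: (projT2 (cid (ex k))).
have hm k : nrm2 (f - m k) <= d + 8^-1 ^+ k by case: (projT2 (cid (ex k))).
have mL k : L2 (m k) by exact: ML.
(* By the parallelogram law the squared distance is at most 2 (d + 8^-j) + 2 (d + 8^-k) - 4 d, since
   the midpoint lies in M. The rate 8^-k is the one that [L2_complete] asks for. *)
have cau k j : (k <= j)%N -> nrm2 (m k - m j) <= 4 * 8^-1 ^+ k.
  move=> kj; have := parallelogram (L2_sub fi (mL j)) (L2_sub fi (mL k)).
  have -> : (f - m j) - (f - m k) = m k - m j by rewrite opprB addrC addrA subrK.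
  have -> : (f - m j) + (f - m k) = 2%:C *: (f - 2^-1%:C *: (m j + m k)).
    rewrite scalerBr scalerA -rmorphM /= divff// scale1r addrACA -opprD; congr (_ - _).
    by rewrite (rmorph_nat (real_complex R) 2) scaler_nat mulr2n.
  have Mjk : M (2^-1%:C *: (m j + m k)).
    rewrite -[_ *: _]addr0; apply: (Mlin) => //.
    by rewrite -[m j]scale1r; apply: Mlin.
  rewrite nrm2Z; last by apply: L2_sub => //; exact: ML.
  have -> : cabs (2%:C : C) = 2.
    by rewrite cabs_pos// ler0c.
  have := hd _ Mjk; have := hm j; have := hm k.
  have : (8^-1 : R) ^+ j <= 8^-1 ^+ k.
    by apply: ler_wiXn2l => //; lra.
  lra.
have [p [pL hp]] := L2_complete mL cau.
have cvg4 (c : R) : (fun k => c * 8^-1 ^+ k) @ \oo --> (0 : R).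
  rewrite -[X in _ --> X](mulr0 c); apply: cvgM; first exact: cvg_cst.
  by apply: cvg_expr; rewrite ger0_norm ?invr_ge0// invf_lt1//; lra.
have Mp : M p.
  apply: (Mcl m) => //.
  apply: (squeeze_cvgr _ (cvg_cst (0 : R)) (cvg4 4)).
  by apply: nearW => k; rewrite hp nrm2_ge0//; exact: L2_sub.
exists p; split => // q Mq; have qL := ML _ Mq.
(* 10 = 2 * 1 + 2 * 4 by (a + b)^2 <= 2 a^2 + 2 b^2: the defect 8^-k of minimality and the squared
   distance 4 * 8^-k from [m k] to [p]. *)
have key k : cabs (dot (f - p) q) ^+ 2 <= 10 * nrm2 q * 8^-1 ^+ k.
  have mkL := L2_sub fi (mL k); have mpL := L2_sub (mL k) pL.
  have h1 : cabs (dot (f - m k) q) ^+ 2 <= 8^-1 ^+ k * nrm2 q.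
    apply: (@min_orth _ _ d) => // a.
    rewrite -addrA -opprD [m k + _]addrC; apply: hd; exact: Mlin.
  have h2 := dot_cauchy mpL qL.
  have := ler_wpM2r (nrm2_ge0 qL) (hp k) => h3.
  have -> : f - p = (f - m k) + (m k - p) by rewrite addrA subrK.
  rewrite dotDl//; have := cabs_add (dot (f - m k) q) (dot (m k - p) q).
  have := cabs_ge0 (dot (f - m k) q + dot (m k - p) q).
  have := cabs_ge0 (dot (f - m k) q); have := cabs_ge0 (dot (m k - p) q).
  move: (cabs (dot (f - m k) q)) (cabs (dot (m k - p) q)) h1 h2 => a b h1 h2 b0 a0.
  move: (cabs _) => c c0 cab.
  have : c ^+ 2 <= (a + b) ^+ 2 by rewrite ler_pXn2r ?nnegrE ?addr_ge0.
  have : (a + b) ^+ 2 <= 2 * a ^+ 2 + 2 * b ^+ 2 by have := sqr_ge0 (a - b); lra.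
  lra.
have le0 : cabs (dot (f - p) q) ^+ 2 <= 0.
  have cc := cvg4 (10 * nrm2 q).
  apply: (ler_cvg_to (cvg_cst _) cc); exact: nearW.
have /eqP : cabs (dot (f - p) q) ^+ 2 = 0 by apply/eqP; rewrite eq_le le0 sqr_ge0.
by rewrite sqrf_eq0 => /eqP c0; apply/eqP; rewrite -normr_eq0 cabsE c0.
Qed.

Definition annih (S : set (circle R -> X)) :=
  [set f | L2 f /\ forall s, S s -> dot f s = 0].

Lemma annih_closed S : S `<=` L2 -> closed_sub (annih S).
Proof.
move=> SL; split.
- by move=> f [].
- by split; [exact: L2_0|move=> s _; exact: dot0l].
- move=> a f g [fi f0] [gi g0]; split; first by apply: L2_add => //; exact: L2_scale.
  move=> s Ss; have sL := SL _ Ss.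
  by rewrite dotDl ?dotZl ?f0 ?g0 ?mulr0 ?addr0//; exact: L2_scale.
- move=> s f sA fi cv; split => // t St; have tL := SL _ St.
  have sL k : L2 (s k) by case: (sA k).
  have key k : cabs (dot f t) ^+ 2 <= nrm2 t * nrm2 (s k - f).
    have -> : dot f t = - dot (s k - f) t.
      by rewrite dotBl//; case: (sA k) => _ ->//; rewrite sub0r opprK.
    rewrite mulrC /cabs normrN; apply: dot_cauchy => //; exact: L2_sub.
  have cc : (fun k => nrm2 t * nrm2 (s k - f)) @ \oo --> (0 : R).
    by rewrite -[X in _ --> X](mulr0 (nrm2 t)); apply: cvgM => //; exact: cvg_cst.
  have le0 : cabs (dot f t) ^+ 2 <= 0.
    by apply: (ler_cvg_to (cvg_cst _) cc); exact: nearW.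
  have /eqP : cabs (dot f t) ^+ 2 = 0 by apply/eqP; rewrite eq_le le0 sqr_ge0.
  by rewrite sqrf_eq0 => /eqP c0; apply/eqP; rewrite -normr_eq0 cabsE c0.
Qed.

Lemma annih_proj S f : S `<=` L2 -> L2 f ->
  exists p, annih S p /\ forall m, annih S m -> dot (f - p) m = 0.
Proof. by move=> SL; apply: proj_exists; exact: annih_closed. Qed.

Lemma annih_ae S f g : S `<=` L2 -> annih S f -> vmeas dX g -> ae_equal f g -> annih S g.
Proof.
move=> SL [fi f0] mg fg; have gi := L2_ae fi mg fg; split => // s Ss.
have sL := SL _ Ss.
rewrite -(f0 _ Ss); apply: dot_ae => //; last exact: circle_ae_all.
by move/ae_use: fg; apply: circle_ae_imp => z ->.
Qed.

Lemma annih_sub S f g : S `<=` L2 -> annih S f -> annih S g -> annih S (f - g).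
Proof.
move=> SL Sf Sg; have [_ _ lin _] := annih_closed SL.
by rewrite addrC -scaleN1r; exact: lin.
Qed.

Lemma zcst_L2 k x : L2 (zmul k (fun=> x)).
Proof. by apply: L2_zmul; exact: L2_cst. Qed.

Definition neg_exp : set (circle R -> X) :=
  [set s | exists k x, k < 0 /\ s = zmul k (fun=> x)].

Lemma neg_exp_L2 : neg_exp `<=` L2.
Proof. by move=> s [k [x [_ ->]]]; exact: zcst_L2. Qed.

Lemma H2E : H2 dX = annih neg_exp.
Proof.
apply/seteqP; split => f [fi fk]; split => //.
  by move=> _ [k [x [k0 ->]]]; rewrite dot_fourier; exact: fk.
by move=> k x k0; rewrite -dot_fourier; apply: fk; exists k, x.
Qed.

Lemma H2_L2 f : H2 dX f -> L2 f. Proof. by case. Qed.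

Lemma H2_lin (a : C) f g : H2 dX f -> H2 dX g -> H2 dX (a *: f + g).
Proof. by rewrite H2E; have [_ _ + _] := annih_closed neg_exp_L2; apply. Qed.

Lemma H2_0 : H2 dX 0.
Proof. by rewrite H2E; have [_ + _ _] := annih_closed neg_exp_L2. Qed.

Lemma H2_add f g : H2 dX f -> H2 dX g -> H2 dX (f + g).
Proof. by move=> fi gi; rewrite -[f]scale1r; exact: H2_lin. Qed.

Lemma H2_sub f g : H2 dX f -> H2 dX g -> H2 dX (f - g).
Proof. by rewrite H2E; exact: annih_sub neg_exp_L2. Qed.

Lemma H2_zmul k f : 0 <= k -> H2 dX f -> H2 dX (zmul k f).
Proof.
rewrite H2E => k0 [fi f0]; split; first exact: L2_zmul.
move=> _ [j [x [j0 ->]]]; rewrite dot_zmul zmulD; apply: f0; exists (- k + j), x; split => //.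
lia.
Qed.

Lemma H2_monomial k x : 0 <= k -> H2 dX (zmul k (fun=> x)).
Proof.
move=> k0; apply: H2_zmul => //; split; first exact: L2_cst.
move=> j y j0; rewrite -dot_fourier -[fun=> x]zmul0.
rewrite /L2_dot /zmul (_ : (fun z => _) = fun z => dX x y * val z ^ (- j)); last first.
  by apply/funext => z; rewrite expr0z scale1r dZr circle_expJ mulrC.
have := @fourier_cst0 R (dX x y) j j0.
by rewrite /fourier.
Qed.

(* H^2 lies in the double annihilator of the analytic monomials. *)
Lemma H2_dense h s : H2 dX h -> L2 s ->
  (forall k x, 0 <= k -> dot (zmul k (fun=> x)) s = 0) -> dot h s = 0.
Proof.
move=> hH sL s0.
pose S := [set t | L2 t /\ forall k x, 0 <= k -> dot (zmul k (fun=> x)) t = 0].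
have SL : S `<=` L2 by move=> t [].
have [p [[pL p0] ph]] := annih_proj SL (H2_L2 hH).
have hp := L2_sub (H2_L2 hH) pL.
have e : ae_equal (h - p) 0.
  (* Negative exponentials lie in [S], so [p] has no negative frequencies, like [h]. Analytic
     monomials annihilate [S], so [h - p] is orthogonal to them. *)
  apply: L2_uniqueness hp _ => k x; have [k0|k0] := ltP k 0.
    rewrite (dotBl (H2_L2 hH) pL (zcst_L2 k x)).
    rewrite dot_fourier (hH.2 _ _ k0) p0 ?subrr//; split; first exact: zcst_L2.
    move=> j y j0; rewrite -dotC; [|exact: zcst_L2..].
    have [_ h1] : H2 dX (zmul j (fun=> y)) by exact: H2_monomial.
    by rewrite -[dot (zmul k _) _]dotC ?dot_fourier ?h1 ?conjC0//; exact: zcst_L2.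
  apply: ph; split; first exact: zcst_L2.
  by move=> t [_ ht]; exact: ht.
have := ae_sub0 e => {}e.
rewrite (dot_ae (H2_L2 hH) pL sL sL e (circle_ae_all (fun=> erefl))).
by apply: p0.
Qed.

(** [proj_H2] and [shift_adj] are choices with default value 0; their specifications are thereby
    reduced to existence. *)
Lemma xget_mem (P : set (circle R -> X)) : P !=set0 -> P (xget (fun=> 0) P).
Proof. by move=> [g Pg]; exact: (xgetI _ Pg). Qed.

Lemma proj_H2P f : L2 f -> H2 dX (proj_H2 dX f) /\
  forall h, H2 dX h -> dot (f - proj_H2 dX f) h = 0.
Proof.
move=> fi; apply: (@xget_mem [set g | H2 dX g /\ forall h, H2 dX h -> dot (f - g) h = 0]).
by have [p] := annih_proj neg_exp_L2 fi; rewrite -H2E; exists p.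
Qed.

Lemma proj_H2_dot f h : L2 f -> H2 dX h -> dot (proj_H2 dX f) h = dot f h.
Proof.
move=> fi hH; have [pH p0] := proj_H2P fi; apply/eqP; rewrite eq_sym -subr_eq0.
rewrite -dotBl ?p0//; exact: H2_L2.
Qed.

Lemma H2_eq_ae f g : H2 dX f -> H2 dX g -> (forall h, H2 dX h -> dot f h = dot g h) ->
  ae_equal f g.
Proof.
move=> fH gH fg; have fgH := H2_sub fH gH; apply: ae_sub0; apply: dot_eq0; first exact: H2_L2.
by rewrite dotBl ?fg ?subrr//; exact: H2_L2.
Qed.

Lemma proj_H2_id f : H2 dX f -> ae_equal (proj_H2 dX f) f.
Proof.
move=> fH; have [pH _] := proj_H2P (H2_L2 fH); apply: H2_eq_ae => // h hH.
exact: proj_H2_dot (H2_L2 fH) hH.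
Qed.

Lemma proj_H2_eq f g : L2 f -> H2 dX g -> (forall h, H2 dX h -> dot f h = dot g h) ->
  ae_equal (proj_H2 dX f) g.
Proof.
move=> fi gH fg; have [pH _] := proj_H2P fi; apply: H2_eq_ae => // h hH.
by rewrite proj_H2_dot// fg.
Qed.

Lemma shiftE f : shift f = zmul 1 f.
Proof. by []. Qed.

Lemma shift_adjP f : H2 dX f -> H2 dX (shift_adj dX f) /\
  forall h, H2 dX h -> dot (shift h) f = dot h (shift_adj dX f).
Proof.
move=> fH; apply: (@xget_mem [set g | H2 dX g /\ forall h, H2 dX h -> dot (shift h) f = dot h g]).
have zf : L2 (zmul (-1) f) by apply: L2_zmul; exact: H2_L2.
have [pH _] := proj_H2P zf.
(* The backward shift is the compression to H^2 of multiplication by z^-1. *)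
exists (proj_H2 dX (zmul (-1) f)); split => // h hH.
rewrite shiftE dot_zmul -(dotC zf (H2_L2 hH)).
by rewrite -(proj_H2_dot zf hH) (dotC (H2_L2 pH) (H2_L2 hH)).
Qed.

(** [opJ] carries the frequency k to - k - 1 and thus exchanges the nonnegative and the negative
    frequencies. *)
Lemma opJ_H2_orth f h : H2 dX f -> H2 dX h -> dot (opJ f) h = 0.
Proof.
move=> fH hH; have fL := H2_L2 fH; have jL := L2_opJ fL.
rewrite -dotC//; last exact: H2_L2.
rewrite (H2_dense hH jL) ?conjC0// => k x k0.
rewrite -dotC//; last exact: zcst_L2.
rewrite dot_opJ//; last exact: zcst_L2.
rewrite opJ_zmul opJE zmulD dot_fourier.
by case: fH => _ ->; rewrite ?conjC0//; lia.
Qed.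

End Projection.

(** * Wandering vectors and the Beurling-Lax-Halmos representation *)

Section Wold.
Variables (R : realType) (X : vectType R[i]) (dX : {dot X for conjC}).
Local Notation C := R[i].
Local Notation L2 := (L2 dX).
Local Notation dot := (L2_dot dX).
Local Notation nrm2 := (nrm2 dX).
Local Notation annih := (annih dX).
Local Notation mu := (@lebesgue_measure R).
Local Notation II := (`[- pi, pi]%classic : set (measurableTypeR R)).
Implicit Types f g h y : circle R -> X.

(** Used to read a dimension bound off at a single point where a wandering family is orthonormal. *)
Lemma circle_ae_ex (P : circle R -> Prop) : circle_ae P -> exists z, P z.
Proof.
move=> [A [mA A0 sA]]; apply: contrapT => nP.
have AT : A = setT by apply/seteqP; split => // t _; apply: sA => /= pt; apply: nP; exists (expi t).
have : (mu II <= mu A)%E by apply: le_measure; rewrite ?inE ?AT//; exact: measurable_itv.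
rewrite A0 lebesgue_measure_itv /= lte_fin gtrN ?pi_gt0// -EFinD lee_fin opprK.
by rewrite leNgt addr_gt0// pi_gt0.
Qed.

Lemma circle_ae_ord m (P : 'I_m -> circle R -> Prop) :
  (forall i, circle_ae (P i)) -> circle_ae (fun z => forall i, P i z).
Proof.
move=> h; have H (s : seq 'I_m) : circle_ae (fun z => forall i, i \in s -> P i z).
  elim: s => [|i s IH]; first by apply: circle_ae_all.
  have := circle_ae_and (h i) IH; apply: circle_ae_imp => z [h1 h2] j.
  by rewrite inE => /orP[/eqP ->|/h2].
by have := H (enum 'I_m); apply: circle_ae_imp => z hz i; apply: hz; rewrite mem_enum.
Qed.

Lemma fourier_cst (c : C) (k : int) : k != 0 -> fourier (fun=> c : C) k = 0 :> C.
Proof.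
move=> k0; rewrite /fourier; have [kn|kp] := ltP k 0; first exact: fourier_cst0.
have i1 : cL1 (fun z : circle R => Num.conj c * val z ^ (- (- k))).
  by apply: (@cL1_expr R _ (fun=> Num.conj c)); exact: cL1_cst.
have := @fourier_cst0 R (Num.conj c) (- k) _.
rewrite oppr_lt0 lt_neqAle eq_sym k0 kp => /(_ isT) h.
apply: (can_inj (@conjCK C)); rewrite conjC0 -h -cint_conj.
  congr circle_int; apply/funext => z.
  by rewrite rmorphM /= circle_expJ.
by apply: (@cL1_expr R _ (fun=> c)); exact: cL1_cst.
Qed.

Lemma constant_ae (s : circle R -> C) : cL1 s -> (forall k, k != 0 -> fourier s k = 0) ->
  circle_ae (fun z => s z = circle_int s).
Proof.
move=> s1 sk; have c1 := @cL1_cst R (circle_int s).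
have : circle_ae (fun z => s z + (-1) * circle_int s = 0).
  apply: fourier_uniqueness; first by apply: cL1_add => //; exact: cL1_scale.
  move=> k; have cl := cL1_scale (-1) c1.
  rewrite /fourier; under eq_fun do rewrite mulrDl.
  rewrite (cint_add (cL1_expr _ s1) (cL1_expr _ cl)).
  have [->|k0] := eqVneq k 0.
    under eq_fun do rewrite oppr0 expr0z mulr1.
    under [X in _ + circle_int X]eq_fun do rewrite oppr0 expr0z mulr1.
    by rewrite cint_cst mulN1r subrr.
  by rewrite -/(fourier s k) sk// -/(fourier (fun=> -1 * circle_int s) k) fourier_cst ?addr0.
by apply: circle_ae_imp => z /eqP; rewrite mulN1r subr_eq0 => /eqP.
Qed.

Definition ae_unit f := vmeas dX f /\ circle_ae (fun z => dX (f z) (f z) = 1).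

Lemma coef_cL1 f p : L2 f -> ae_unit p ->
  cL1 (fun z => dX (f z) (p z) * Num.conj (dX (f z) (p z))).
Proof.
move=> fi [mp up]; have mc := vmeas_dot (L2_vmeas fi) mp.
apply: cL1_dom (L2_cL1 fi fi) _; first by apply: cmeas_mul => //; exact: cmeas_conj.
apply: circle_ae_imp up => z uz; rewrite cabs_mul cabs_conj -expr2.
apply: le_trans (d_cauchy _ _ _) _.
have -> : vnorm dX (p z) ^+ 2 = 1 by apply: complexI; rewrite -vnorm_sq.
by rewrite mulr1 cabs_pos ?d_ge0// vnorm_sq.
Qed.

(** Exchanging [p] and [q] gives the pointwise adjoint. With constant [p] and wandering [q] this is
    the action of the symbol Phi (synthesis); the exchanged operator is its adjoint (analysis). *)
Definition rank_op m (p q : 'I_m -> circle R -> X) y : circle R -> X :=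
  fun z => \sum_i dX (y z) (p i z) *: q i z.

Lemma L2_sum m (F : 'I_m -> circle R -> X) : (forall i, L2 (F i)) ->
  L2 (fun z => \sum_i F i z).
Proof.
elim: m F => [|m IH] F h.
  by under eq_fun do rewrite big_ord0; exact: L2_cst.
under eq_fun do rewrite big_ord_recl.
exact: (L2_add (h ord0) (IH _ (fun i => h (lift ord0 i)))).
Qed.

Lemma L2_rank_op m p q y : L2 y -> (forall i : 'I_m, ae_unit (p i)) ->
  (forall i, ae_unit (q i)) -> L2 (rank_op p q y).
Proof.
move=> yi up uq; apply: L2_sum => i.
have [mq uq1] := uq i; have [mp _] := up i.
have mc := vmeas_dot (L2_vmeas yi) mp.
have ms : vmeas dX (fun z => dX (y z) (p i z) *: q i z) by exact: vmeas_mul.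
apply/L2E; split => //.
apply: cL1_ae (coef_cL1 yi (up i)) _ _; first exact: vmeas_dot.
by apply: circle_ae_imp uq1 => z uz; rewrite dZl dZr uz mulr1.
Qed.

Lemma rank_op_adj m (p q : 'I_m -> circle R -> X) x y z :
  dX (rank_op p q y z) (x z) = dX (y z) (rank_op q p x z).
Proof.
rewrite /rank_op d_suml d_sumr; apply: eq_bigr => i _.
by rewrite dZl dZr dC mulrC.
Qed.

Lemma rank_op_coef m (p q : 'I_m -> circle R -> X) y z i :
  onfamily dX (fun j => q j z) -> dX (rank_op p q y z) (q i z) = dX (y z) (p i z).
Proof.
move=> oq; rewrite /rank_op d_suml (bigD1 i) //= big1 ?addr0 => [|j ji].
  by rewrite dZl oq eqxx mulr1.
by rewrite dZl oq (negbTE ji) mulr0.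
Qed.

Lemma ae_unit_cst x : dX x x = 1 -> ae_unit (fun=> x).
Proof. by move=> x1; split; [exact: vmeas_cst|exact: circle_ae_all]. Qed.

Section Invariant.
Variable S : set (circle R -> X).
Hypothesis SL : S `<=` L2.
Local Notation M := (annih S).
Hypothesis Minv : forall y, M y -> M (zmul 1 y).

Lemma annih_L2 y : M y -> L2 y. Proof. by case. Qed.

Lemma M_zmul (k : int) y : 0 <= k -> M y -> M (zmul k y).
Proof.
case: k => // k _ My; elim: k => [|k IH]; first by rewrite zmul0.
by rewrite intS -zmulD; exact: Minv.
Qed.

Definition wandering : set (circle R -> X) :=
  [set w | M w /\ forall y, M y -> dot (zmul 1 y) w = 0].

Lemma wandering_orth w y (k : int) : wandering w -> M y -> 0 < k -> dot (zmul k y) w = 0.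
Proof.
move=> [_ hw] My k0; have -> : zmul k y = zmul 1 (zmul (k - 1) y).
  by rewrite zmulD addrC subrK.
by apply: hw; apply: M_zmul => //; lia.
Qed.

Lemma wandering_const w w' : wandering w -> wandering w' ->
  circle_ae (fun z => dX (w z) (w' z) = dot w w').
Proof.
move=> Lw Lw'; have wL := annih_L2 Lw.1; have wL' := annih_L2 Lw'.1.
apply: constant_ae; first exact: L2_cL1.
move=> k k0; rewrite /fourier.
rewrite -[circle_int _](_ : dot (zmul (- k) w) w' = _); last first.
  by congr circle_int; apply/funext => z; rewrite /zmul dZl mulrC.
have [kn|kp] := ltP k 0; first by apply: wandering_orth => //; [exact: Lw.1|lia].
rewrite dot_zmul opprK -dotC//; last exact: L2_zmul.
rewrite wandering_orth ?conjC0//; first exact: Lw'.1.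
by rewrite lt_neqAle eq_sym k0 kp.
Qed.

Definition wandering_family m (w : 'I_m -> circle R -> X) :=
  (forall i, wandering (w i)) /\ forall i j, dot (w i) (w j) = (i == j)%:R.

Lemma wandering_family_ae m (w : 'I_m -> circle R -> X) : wandering_family w ->
  circle_ae (fun z => onfamily dX (fun i => w i z)).
Proof.
move=> [Lw ow]; apply: circle_ae_ord => i; apply: circle_ae_ord => j.
have := wandering_const (Lw i) (Lw j); apply: circle_ae_imp => z ->.
exact: ow.
Qed.

Lemma wandering_family_unit m (w : 'I_m -> circle R -> X) i : wandering_family w ->
  ae_unit (w i).
Proof.
move=> fw; split; first by apply: L2_vmeas; apply: annih_L2; exact: (fw.1 i).1.
have := wandering_family_ae fw; apply: circle_ae_imp => z /(_ i i).
by rewrite eqxx.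
Qed.

Lemma wandering_family_dim m (w : 'I_m -> circle R -> X) : wandering_family w ->
  (m <= \dim (fullv : {vspace X}))%N.
Proof. by move=> /wandering_family_ae /circle_ae_ex[z /onfamily_dim]. Qed.

Lemma wandering_extend m (w : 'I_m -> circle R -> X) : wandering_family w ->
  (forall v, wandering v -> (forall i, dot v (w i) = 0) -> ae_equal v 0) \/
  exists w' : 'I_m.+1 -> circle R -> X, wandering_family w'.
Proof.
move=> [Lw ow]; have [h|] := pselect (forall v, wandering v ->
  (forall i, dot v (w i) = 0) -> ae_equal v 0); first by left.
move=> /existsNP[v /not_implyP[Lv /not_implyP[vo v0]]]; right.
have vL := annih_L2 Lv.1; have wL i := annih_L2 (Lw i).1.
have nv : Num.sqrt (nrm2 v) != 0.
  apply/eqP => n0; apply: v0; apply: (dot_eq0 vL).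
  by rewrite nrm2E// -(sqr_sqrtr (nrm2_ge0 vL)) n0 expr0n.
pose a : C := (Num.sqrt (nrm2 v))^-1%:C; pose u := a *: v.
have uL : L2 u by exact: L2_scale.
have Lu : wandering u.
  have [_ _ lin _] := annih_closed SL; split.
    rewrite -[u]addr0; apply: lin; first exact: Lv.1.
    by have [_ + _ _] := annih_closed SL.
  move=> y My; rewrite dotZr//; last by apply: L2_zmul; exact: annih_L2.
  by rewrite Lv.2 ?mulr0.
have ue i : dot u (w i) = 0 by rewrite dotZl// vo mulr0.
have eu i : dot (w i) u = 0 by rewrite -dotC// ue conjC0.
have uu : dot u u = 1.
  rewrite nrm2E// nrm2Z// /a cabs_pos ?ler0c ?invr_ge0 ?sqrtr_ge0//=.
  rewrite -{2}(sqr_sqrtr (nrm2_ge0 vL)) -exprMn mulVf// expr1n //.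
exists (fun j => if unlift ord_max j is Some i then w i else u); split => [i|i j].
  by case: unliftP.
case: unliftP => [i' ->|->]; case: unliftP => [j' ->|->].
- by rewrite ow (inj_eq lift_inj).
- by rewrite eu eq_sym (negbTE (neq_lift _ _)).
- by rewrite ue (negbTE (neq_lift _ _)).
- by rewrite uu eqxx.
Qed.

Lemma wandering_maximal : exists m, exists w : 'I_m -> circle R -> X,
  wandering_family w /\
  forall v, wandering v -> (forall i, dot v (w i) = 0) -> ae_equal v 0.
Proof.
have H k : (exists w : 'I_k -> circle R -> X, wandering_family w) \/
   exists m, exists w : 'I_m -> circle R -> X, wandering_family w /\
  forall v, wandering v -> (forall i, dot v (w i) = 0) -> ae_equal v 0.
  elim: k => [|k [[w fw]|h]]; [|by case: (wandering_extend fw) => h; [right; exists k, w|left]|by right].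
  by left; exists (fun=> 0); split => -[].
have [[w fw]|//] := H (\dim (fullv : {vspace X})).+1.
by have := wandering_family_dim fw; rewrite ltnn.
Qed.

Section Family.
Variables (m : nat) (w : 'I_m -> circle R -> X) (b : 'I_m -> X).
Hypothesis fw : wandering_family w.
Hypothesis wmax : forall v, wandering v -> (forall i, dot v (w i) = 0) -> ae_equal v 0.
Hypothesis ob : onfamily dX b.
Hypothesis Minf : forall y, (forall k : nat, M (zmul (- k%:Z) y)) -> ae_equal y 0.

Let bc i : circle R -> X := fun=> b i.
Let wunit i : ae_unit (w i) := wandering_family_unit i fw.
Let bunit i : ae_unit (bc i). Proof. by apply: ae_unit_cst; rewrite ob eqxx. Qed.
Let wL i : L2 (w i). Proof. by apply: annih_L2; exact: (fw.1 i).1. Qed.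

(** Analytic monomials are sent to combinations of the z^k w_i, which lie in M. For general [h], let
    [r] be the part of the image orthogonal to M: its pairing with the image of [h] equals that of
    [h] with the adjoint image of [r], which vanishes on monomials and hence on H^2, so [r] = 0. *)
Lemma synthesis_mem h : H2 dX h -> M (rank_op bc w h).
Proof.
move=> hH; have hL := H2_L2 hH; set f := rank_op bc w h.
have fL : L2 f by exact: L2_rank_op.
have [p [Mp po]] := annih_proj SL fL; have pL := annih_L2 Mp.
set r := f - p in po; have rL : L2 r by exact: L2_sub.
have sL : L2 (rank_op w bc r) by exact: L2_rank_op.
have fr : dot f r = 0.
  rewrite (_ : dot f r = dot h (rank_op w bc r)); last first.
    by congr circle_int; apply/funext => z; rewrite rank_op_adj.
  apply: (H2_dense hH sL) => k x k0.
  rewrite (_ : dot _ _ = dot (rank_op bc w (zmul k (fun=> x))) r); last first.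
    by congr circle_int; apply/funext => z; rewrite rank_op_adj.
  have Mw : M (rank_op bc w (zmul k (fun=> x))).
    have [_ M0 lin _] := annih_closed SL.
    rewrite (_ : rank_op _ _ _ = \sum_i dX x (b i) *: zmul k (w i)); last first.
      apply/funext => z; rewrite /rank_op /zmul fct_sumE; apply: eq_bigr => i _.
      rewrite dZl mulrC -scalerA //.
    elim/big_ind: _ => [//|f1 f2 h1 h2|i _]; first by rewrite -[f1]scale1r; exact: lin.
    rewrite -[_ *: _]addr0; apply: (lin _ _ _ _ M0); exact: (M_zmul k0 (fw.1 i).1).
  by rewrite -(dotC rL (annih_L2 Mw)) (po _ Mw) conjC0.
have : ae_equal r 0.
  apply: (dot_eq0 rL); rewrite {1}/r dotBl// fr -dotC// po// conjC0 subr0 //.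
move=> /ae_sub0 fp; apply: annih_ae SL Mp (L2_vmeas fL) _.
by move/ae_use: fp; apply: circle_ae_imp => z ->.
Qed.

(** A coefficient of index k < 0 is a combination of pairings of z^(-k) y, an element of zM, with
    the wandering vectors w_i. *)
Lemma analysis_H2 y : M y -> H2 dX (rank_op w bc y).
Proof.
move=> My; have yL := annih_L2 My; split; first exact: L2_rank_op.
move=> k x k0; rewrite -dot_fourier.
rewrite (_ : dot _ _ = dot y (rank_op bc w (zmul k (fun=> x)))); last first.
  by congr circle_int; apply/funext => z; rewrite rank_op_adj.
rewrite (_ : dot _ _ = dot (zmul (- k) y) (rank_op bc w (fun=> x))); last first.
  rewrite dot_zmul opprK; congr circle_int; apply/funext => z; congr (dX _ _).
  rewrite /rank_op /zmul scaler_sumr; apply: eq_bigr => i _.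
  by rewrite dZl scalerA.
have zL : L2 (zmul (- k) y) by exact: L2_zmul.
rewrite (_ : rank_op _ _ _ = \sum_i dX x (b i) *: w i); last first.
  by apply/funext => z; rewrite /rank_op fct_sumE.
suff : L2 (\sum_i dX x (b i) *: w i) /\ dot (zmul (- k) y) (\sum_i dX x (b i) *: w i) = 0 by case.
elim/big_ind: _ => [|f1 f2 [h1 e1] [h2 e2]|i _].
- by split; [exact: L2_0|exact: dot0r].
- by split; [exact: L2_add|rewrite dotDr// e1 e2 addr0].
- split; first exact: L2_scale.
  rewrite dotZr// wandering_orth ?mulr0//; first exact: fw.1.
  lia.
Qed.

Lemma M_ae f g : M f -> vmeas dX g -> ae_equal f g -> M g.
Proof. exact: annih_ae. Qed.

(* The projection of r to zM differs from r by a wandering vector. *)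
Lemma wandering_descend r : M r -> circle_ae (fun z => forall i, dX (r z) (w i z) = 0) ->
  M (zmul (-1) r).
Proof.
move=> Mr rw; have rL := annih_L2 Mr.
(* Multiplication by z is unitary, so zM is the annihilator of zS and has its own projection. *)
pose zS := [set zmul 1 s | s in S].
have zSL : zS `<=` L2 by move=> _ [s Ss <-]; apply: L2_zmul; exact: SL.
have zSM f : annih zS f -> M (zmul (-1) f).
  move=> [fi f0]; split; first exact: L2_zmul.
  by move=> s Ss; rewrite dot_zmul; apply: f0; exists s.
have MzS f : M f -> annih zS (zmul 1 f).
  move=> Mf; split; first by apply: L2_zmul; exact: annih_L2.
  by move=> _ [s Ss <-]; rewrite dot_zmul2; exact: Mf.2.
have [p [pz po]] := annih_proj zSL rL.
have Mp' := zSM _ pz; have pE : p = zmul 1 (zmul (-1) p) by rewrite zmulD subrr zmul0.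
have Mp : M p by rewrite pE; exact: Minv.
have pL := annih_L2 Mp; have vL := L2_sub rL pL.
have Lv : wandering (r - p).
  split; first exact: annih_sub.
  move=> y My; rewrite -(dotC vL (L2_zmul 1 (annih_L2 My))).
  by rewrite (po _ (MzS _ My)) conjC0.
have vw i : dot (r - p) (w i) = 0.
  rewrite dotBl// pE (fw.1 i).2// subr0.
  rewrite -[RHS](cint_cst 0); apply: cint_ae; [|exact: cmeas_cst|].
    by apply: vmeas_dot; exact: L2_vmeas.
  by apply: circle_ae_imp rw => z /(_ i).
have /ae_sub0 rp := wmax Lv vw.
apply: M_ae Mp' (L2_vmeas (L2_zmul _ rL)) _.
by move/ae_use: rp; apply: circle_ae_imp => z; rewrite /zmul => ->.
Qed.

(** Pointwise orthogonality to the w_i survives division by z, so [wandering_descend] can be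
    repeated without end. *)
Lemma wandering_complete r : M r -> circle_ae (fun z => forall i, dX (r z) (w i z) = 0) ->
  ae_equal r 0.
Proof.
move=> Mr rw; apply: Minf => k.
elim: k => [|k IH]; first by rewrite oppr0 zmul0.
have := wandering_descend IH _; rewrite zmulD (_ : -1 + _ = - k.+1%:Z); last by lia.
apply; apply: circle_ae_imp rw => z h i.
by rewrite /zmul dZl h mulr0.
Qed.

(** The difference of both sides lies in M and is pointwise orthogonal to the w_i, because synthesis
    reproduces the coefficients of [y] on them. *)
Lemma analysis_synthesis y : M y -> ae_equal y (rank_op bc w (rank_op w bc y)).
Proof.
move=> My; have hH := analysis_H2 My; have Mf := synthesis_mem hH.
apply: ae_sub0; apply: wandering_complete; first exact: annih_sub.
have := wandering_family_ae fw; apply: circle_ae_imp => z oz i.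
have oc : onfamily dX (fun j => bc j z) by exact: ob.
by rewrite dBl (rank_op_coef _ _ _ oz) (rank_op_coef _ _ _ oc) subrr.
Qed.


End Family.
End Invariant.
End Wold.

(** * Helson's dichotomy for the reducing part *)

Section Helson.
Variables (R : realType) (X : vectType R[i]) (dX : {dot X for conjC}).
Local Notation C := R[i].
Local Notation L2 := (L2 dX).
Local Notation dot := (L2_dot dX).
Local Notation nrm2 := (nrm2 dX).
Local Notation annih := (annih dX).
Variables (S : set (circle R -> X)) (f0 : X).
Hypothesis SL : S `<=` L2.
Local Notation M := (annih S).
Hypothesis Minv : forall y, M y -> M (zmul 1 y).
Hypothesis f01 : dX f0 f0 = 1.
Let e : circle R -> X := fun=> f0.
Hypothesis Me : M e.

Definition M_infty := [set y | forall k : nat, M (zmul (- k%:Z) y)].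

Hypothesis scalar_M_infty : forall y, M_infty y ->
  circle_ae (fun z => y z = dX (y z) f0 *: f0).

(** Its annihilator is [M_infty], which therefore has an orthogonal projection. *)
Let shifts := [set t | exists (k : nat) s, S s /\ t = zmul k s].

Let shiftsL : shifts `<=` L2.
Proof. by move=> _ [k [s [Ss ->]]]; apply: L2_zmul; exact: SL. Qed.

Let M_inftyE : M_infty = annih shifts.
Proof.
apply/seteqP; split => y.
  move=> hy; split; first by have := annih_L2 (hy 0%N); rewrite oppr0 zmul0.
  move=> _ [k [s [Ss ->]]]; rewrite -(opprK k%:Z) -dot_zmul; exact: (hy k).2.
move=> [yL y0] k; split; first exact: L2_zmul.
by move=> s Ss; rewrite dot_zmul opprK; apply: y0; exists k, s.
Qed.

Let M_infty_zmul y (j : int) : M_infty y -> M_infty (zmul j y).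
Proof.
move=> hy k; rewrite zmulD.
case: (- k%:Z + j) => n; first by apply: (M_zmul Minv) => //; have := hy 0%N; rewrite oppr0 zmul0.
by rewrite NegzE; exact: hy.
Qed.

Let M_infty_M y : M_infty y -> M y.
Proof. by move=> /(_ 0%N); rewrite oppr0 zmul0. Qed.

Lemma M_infty_dichotomy : (forall y, M_infty y -> ae_equal y 0) \/ M_infty e.
Proof.
have eL : L2 e by exact: L2_cst.
have [h [Mh eh]] : exists h, M_infty h /\ forall y, M_infty y -> dot (e - h) y = 0.
  by rewrite M_inftyE; exact: annih_proj.
have hL : L2 h by apply: annih_L2; exact: M_infty_M.
set e' := e - h in eh; have eL' : L2 e' by exact: L2_sub.
pose eta z := dX (h z) f0.
have mh : circle_measurable eta by exact: L2_vmeas.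
have hE : circle_ae (fun z => h z = eta z *: f0) by exact: scalar_M_infty.
have eE : circle_ae (fun z => e' z = (1 - eta z) *: f0).
  apply: circle_ae_imp hE => z hz.
  have -> : e' z = f0 - h z by [].
  by rewrite {1}hz scalerBl scale1r.
(* The Fourier coefficients of <h, e'> are pairings of z^(-k) h, again in [M_infty], with e'. Hence
   h(z) and e'(z) are orthogonal a.e.; on the line of [f0] this reads eta conj(1 - eta) = 0. *)
have eta01 : circle_ae (fun z => eta z = 0 \/ eta z = 1).
  have : circle_ae (fun z => dX (h z) (e' z) = 0).
    apply: fourier_uniqueness; first exact: L2_cL1.
    move=> k; rewrite /fourier -[LHS](_ : dot (zmul (- k) h) e' = _); last first.
      by congr circle_int; apply/funext => z; rewrite /zmul dZl mulrC.
    by rewrite -(dotC eL' (L2_zmul _ hL)) (eh _ (M_infty_zmul _ Mh)) conjC0.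
  move=> h1; have := circle_ae_and h1 (circle_ae_and hE eE).
  apply: circle_ae_imp => z [h2 [hz ez]]; move: h2; rewrite {1}hz ez dZl dZr f01 mulr1 => /eqP.
  rewrite mulf_eq0 => /orP[/eqP ->|]; first by left.
  by rewrite conjC_eq0 subr_eq0 => /eqP <-; right.
have [/eqP n0|n0] := boolP (dot e' e' == 0).
  right; have /ae_sub0 eh0 := dot_eq0 eL' n0.
  rewrite M_inftyE; apply: (annih_ae shiftsL (f := h)); first by rewrite -M_inftyE.
    exact: L2_vmeas.
  by move/ae_use: eh0; apply: circle_ae_imp => z ->.
left.
(* Helson: either e' lies in the closed span C of the z^n e', n >= 1, and then in M_infty,
   or its component w orthogonal to C has constant nonzero modulus, whereas w vanishes
   wherever e' does. *)
pose A0 := [set t | exists k : nat, t = zmul k.+1 e'].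
have A0L : A0 `<=` L2 by move=> _ [k ->]; exact: L2_zmul.
(* The closed span of [A0] is [annih A1], the annihilator of its annihilator. *)
pose A1 := annih A0; have A1L : A1 `<=` L2 by move=> t [].
have [p [Cp po]] := annih_proj A1L eL'.
have pL := annih_L2 Cp; set w := e' - p in po; have wL : L2 w by exact: L2_sub.
have zC k : annih A1 (zmul k.+1 e').
  split; first exact: L2_zmul.
  move=> t [tL t0]; rewrite -(dotC tL (L2_zmul _ eL')) t0 ?conjC0//.
  by exists k.
have Cinv c : annih A1 c -> annih A1 (zmul 1 c).
  move=> [cL c0]; split; first exact: L2_zmul.
  move=> t [tL t0]; rewrite dot_zmul; apply: c0; split; first exact: L2_zmul.
  move=> _ [k ->]; rewrite dot_zmul opprK zmulD.
  by rewrite (_ : 1 + k.+1%:Z = k.+2%:Z)//; apply: t0; exists k.+1.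
have zw (k : nat) : annih A1 (zmul k.+1 w).
  rewrite /w zmul_sub; apply: annih_sub => //.
  by apply: (M_zmul Cinv).
have wc : circle_ae (fun z => dX (w z) (w z) = dot w w).
  apply: constant_ae; first exact: L2_cL1.
  move=> k k0; rewrite /fourier -[LHS](_ : dot (zmul (- k) w) w = _); last first.
    by congr circle_int; apply/funext => z; rewrite /zmul dZl mulrC.
  have [n [kn|kn]] : exists n : nat, - k = n.+1%:Z \/ - k = - n.+1%:Z.
    case: k k0 => [[|n]|n] // _; first by exists n; right.
    by exists n; left; rewrite NegzE opprK.
    by rewrite kn -(dotC wL (L2_zmul _ wL)) (po _ (zw n)) conjC0.
  by rewrite kn dot_zmul opprK po.
have c0 : dot w w != 0.
  apply/negP => /eqP w0; have /ae_sub0 ep := dot_eq0 wL w0.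
  have Ce : annih A1 e'.
    apply: (annih_ae A1L Cp (L2_vmeas eL')).
    by move/ae_use: ep; apply: circle_ae_imp => z ->.
  (* If e' is in the closed span of the z^(k+1) e', then z^(-n-1) e' is in that of the z^(k-n) e', k
     >= 0, which belong to M once z^(-n) e' does. *)
  have : M_infty e'.
    elim => [|n IH]; first by rewrite oppr0 zmul0; apply: annih_sub => //; exact: M_infty_M.
    split; first exact: L2_zmul.
    move=> s Ss; have sL := SL Ss; rewrite dot_zmul opprK; apply: Ce.2.
    split; first exact: L2_zmul.
    move=> _ [k ->]; rewrite -dotC; [|exact: L2_zmul..].
    rewrite -(opprK n.+1%:Z) -dot_zmul zmulD.
    rewrite (_ : - n.+1%:Z + k.+1%:Z = k%:Z + - n%:Z); last by lia.
    rewrite -zmulD; have [_ ->//] := M_zmul Minv (isT : 0 <= k%:Z) IH.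
    exact: conjC0.
  by move=> /eh /eqP; rewrite (negbTE n0).
have eta1 : circle_ae (fun z => cabs (eta z) <= 1).
  apply: circle_ae_imp eta01 => z [] ->; first by rewrite /cabs normr0.
  by rewrite /cabs normr1.
(* Since eta e' = 0 a.e., [s] is orthogonal to all z^k e' with k >= 0 and so to [w]. But its pairing
   with [w] is the constant |w|^2 times the integral of eta, which forces eta = 0. *)
pose s z := eta z *: w z; have sL : L2 s by exact: (L2_mul mh eta1 wL).
have se : circle_ae (fun z => dX (s z) (e' z) = 0).
  have := circle_ae_and eE eta01; apply: circle_ae_imp => z [-> h01].
  rewrite /s dZl dZr; case: h01 => ->; first by rewrite mul0r.
  by rewrite subrr conjC0 mul0r mulr0.
have A1s : A1 s.
  split => // _ [k ->].
  rewrite -[RHS](cint_cst 0); apply: cint_ae; [|exact: cmeas_cst|].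
    exact: (vmeas_dot (L2_vmeas sL) (L2_vmeas (L2_zmul _ eL'))).
  by apply: circle_ae_imp se => z; rewrite /zmul dZr => ->; rewrite mulr0.
have e0 : dot e' s = 0.
  rewrite -dotC// -[RHS]conjC0 -(cint_cst 0); congr (Num.conj _); apply: cint_ae; [|exact: cmeas_cst|].
    by apply: vmeas_dot; apply: L2_vmeas.
  by apply: circle_ae_imp se => z ->.
have ws : dot s w = 0.
  by rewrite -dotC// {1}/w dotBl// e0 (Cp.2 _ A1s) subrr conjC0.
have eta1L : cL1 eta by exact: (L2_cL1 hL (L2_cst dX f0)).
have eta0 : circle_ae (fun z => eta z = 0).
  apply: cint_eq0 => //.
    by apply: circle_ae_imp eta01 => z [] ->.
  apply: (mulfI c0); rewrite mulr0 -[RHS]ws -cint_scale//; apply: cint_ae.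
  - by apply: cmeas_mul => //; exact: cmeas_cst.
  - by apply: vmeas_dot; exact: L2_vmeas.
  - by apply: circle_ae_imp wc => z hz; rewrite /s dZl hz mulrC.
(* Now [e] itself is orthogonal to [M_infty], which is stable under all z^k and has values in the
   line of [f0]; hence its elements vanish a.e. *)
have h0 : ae_equal e' e.
  have := circle_ae_and eE eta0; apply: circle_ae_imp => z [-> ->].
  by rewrite subr0 scale1r.
move=> y My; have yL : L2 y by apply: annih_L2; exact: M_infty_M.
have : circle_ae (fun z => dX (y z) f0 = 0).
  apply: fourier_uniqueness; first exact: (L2_cL1 yL eL).
  move=> k; rewrite /fourier -[LHS](_ : dot (zmul (- k) y) e = _); last first.
    by congr circle_int; apply/funext => z; rewrite /zmul dZl mulrC.
  have zy := L2_zmul (- k) yL.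
  rewrite -(dot_ae zy zy eL' eL (circle_ae_all (fun=> erefl)) h0).
  by rewrite -(dotC eL' zy) (eh _ (M_infty_zmul _ My)) conjC0.
move=> h1; have := circle_ae_and h1 (scalar_M_infty My).
by apply: circle_ae_imp => z [h2 ->]; rewrite h2 scale0r.
Qed.

End Helson.

(** * Functions with values in E (+) F and the lifting of N *)

Section ProductDot.
Variable R : realType.
Variables (E F : vectType R[i]) (dE : {dot E for conjC}) (dF : {dot F for conjC}).

Definition dsum : vectType R[i] := (E * F)%type.

Definition prod_dot (x y : dsum) : R[i] := dE x.1 y.1 + dF x.2 y.2.

Lemma prod_dot_bilinear : bilinear_for ( *%R ) (conjC \; *%R) prod_dot.
Proof.
split=> [y a x x'|x a y y']; rewrite /prod_dot /=.
  by rewrite !dDl !dZl mulrDr addrACA.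
by rewrite !dDr !dZr mulrDr addrACA.
Qed.

HB.instance Definition _ :=
  bilinear_isBilinear.Build _ _ _ _ _ _ prod_dot prod_dot_bilinear.

Lemma prod_dot_hermitian x y :
  prod_dot x y = (-1) ^+ false * conjC (prod_dot y x).
Proof. by rewrite expr0 mul1r rmorphD /= !dC. Qed.

HB.instance Definition _ :=
  isHermitianSesquilinear.Build _ _ false conjC prod_dot prod_dot_hermitian.

Lemma prod_dot_gt0 x : x != 0 -> 0 < prod_dot x x.
Proof.
case: x => x y xy; rewrite lt_neqAle addr_ge0 ?d_ge0// andbT eq_sym.
apply: contra xy; rewrite /prod_dot paddr_eq0 ?d_ge0//= => /andP[/eqP x0 /eqP y0].
by apply/eqP; rewrite (d_eq0 x0) (d_eq0 y0).
Qed.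

HB.instance Definition _ := isDotProduct.Build _ _ prod_dot prod_dot_gt0.

Definition pdot : {dot dsum for conjC} := prod_dot.

End ProductDot.

Section DirectSumFunctions.
Variable R : realType.
Variables (E F : vectType R[i]) (dE : {dot E for conjC}) (dF : {dot F for conjC}).
Local Notation C := R[i].
Local Notation dX := (pdot dE dF).
Local Notation fn := (circle R -> dsum E F).
Local Notation dot := (L2_dot dX).
Implicit Types y u v : fn.

Definition part1 y : circle R -> E := fun z => (y z).1.
Definition part2 y : circle R -> F := fun z => (y z).2.

Lemma vmeas_prod y : vmeas dX y <-> vmeas dE (part1 y) /\ vmeas dF (part2 y).
Proof.
split=> [my|[m1 m2] [a b]]; last by apply: cmeas_add; [exact: m1|exact: m2].
split=> x.
  have := my (x, 0); rewrite (_ : (fun z => dX (y z) (x, 0)) = fun z => dE (part1 y z) x)//.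
  by apply/funext => z; rewrite /= /pdot /= /prod_dot /= d0r addr0.
have := my (0, x); rewrite (_ : (fun z => dX (y z) (0, x)) = fun z => dF (part2 y z) x)//.
by apply/funext => z; rewrite /= /pdot /= /prod_dot /= d0r add0r.
Qed.

Lemma L2_prod y : L2 dX y <-> L2 dE (part1 y) /\ L2 dF (part2 y).
Proof.
split=> [/L2E[/vmeas_prod[m1 m2] yi]|[/L2E[m1 i1] /L2E[m2 i2]]]; last first.
  by apply/L2E; split; [exact/vmeas_prod|exact: cL1_add].
split; apply/L2E; split => //; apply: cL1_dom (yi) _; try exact: vmeas_dot;
  apply: circle_ae_all => z; rewrite !cabs_pos ?d_ge0//.
  have : dE (part1 y z) (part1 y z) <= dX (y z) (y z) by rewrite lerDl d_ge0.
  by rewrite lecE => /andP[].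
have : dF (part2 y z) (part2 y z) <= dX (y z) (y z) by rewrite lerDr d_ge0.
by rewrite lecE => /andP[].
Qed.

Lemma dot_prod u v : L2 dX u -> L2 dX v ->
  dot u v = L2_dot dE (part1 u) (part1 v) + L2_dot dF (part2 u) (part2 v).
Proof.
move=> /L2_prod[u1 u2] /L2_prod[v1 v2]; rewrite /L2_dot -cint_add//.
  exact: (L2_cL1 u1 v1).
exact: (L2_cL1 u2 v2).
Qed.

Lemma H2_prod y : H2 dX y <-> H2 dE (part1 y) /\ H2 dF (part2 y).
Proof.
split=> [[/[dup] yL /L2_prod[y1 y2] yk]|[[y1 k1] [y2 k2]]].
  split; split => // k x k0.
    have := yk k (x, 0) k0; rewrite (_ : (fun z => dX (y z) (x, 0)) = fun z => dE (part1 y z) x)//.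
    by apply/funext => z; rewrite /= /pdot /= /prod_dot /= d0r addr0.
  have := yk k (0, x) k0; rewrite (_ : (fun z => dX (y z) (0, x)) = fun z => dF (part2 y z) x)//.
  by apply/funext => z; rewrite /= /pdot /= /prod_dot /= d0r add0r.
split; first exact/L2_prod.
move=> k [a b] k0; have := k1 k a k0; have := k2 k b k0; rewrite /fourier => h2 h1.
rewrite -[RHS]addr0 -{1}h1 -h2 -cint_add.
- by congr circle_int; apply/funext => z; rewrite -mulrDl.
- by apply: cL1_expr; exact: (L2_cL1 y1 (L2_cst dE a)).
- by apply: cL1_expr; exact: (L2_cL1 y2 (L2_cst dF b)).
Qed.

(** The unitary involution 1 (+) J, which moves H^2_F in the second component onto its complement in
    L^2_F. *)
Definition flip2 y : fn := fun z => (part1 y z, opJ (part2 y) z).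

Lemma flip2K y : flip2 (flip2 y) = y.
Proof.
apply/funext => z; rewrite -[LHS]/((y z).1, opJ (opJ (part2 y)) z) opJK.
by rewrite /part2; case: (y z).
Qed.

Lemma L2_flip2 y : L2 dX y -> L2 dX (flip2 y).
Proof. by move=> /L2_prod[y1 y2]; apply/L2_prod; split => //; exact: L2_opJ. Qed.

Lemma dot_flip2 u v : L2 dX u -> L2 dX v -> dot (flip2 u) v = dot u (flip2 v).
Proof.
move=> uL vL; rewrite (dot_prod (L2_flip2 uL) vL) (dot_prod uL (L2_flip2 vL)).
congr (_ + _); apply: dot_opJ; first by have /L2_prod[] := uL.
by have /L2_prod[] := vL.
Qed.

Section InvariantSubspace.
Variable N : set (sumfun E F).
Hypothesis Ninv : invariant_subspace dE dF N.

Definition Npair : set fn := [set y | N (part1 y, part2 y)].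

Lemma Npair_H2 y : Npair y -> H2 dX y.
Proof. by move=> Ny; apply/H2_prod; have [sN _ _ _] := Ninv; exact: (sN _ Ny). Qed.

Lemma Npair_closed : closed_sub dX Npair.
Proof.
have [sN [N0 Nlin] Ncl _] := Ninv; split.
- by move=> y /Npair_H2 /H2_L2.
- exact: N0.
- by move=> a f g Nf Ng; exact: (Nlin a _ _ Nf Ng).
- move=> s f Ns fL cv; apply: (Ncl (fun n => (part1 (s n), part2 (s n)))) => //.
    have [_ _ _ cl] := annih_closed (@neg_exp_L2 _ _ dX).
    apply/H2_prod; rewrite H2E; apply: (cl s) => // n.
    by rewrite -H2E; exact: Npair_H2.
  rewrite (_ : (fun n => _) = fun n => Num.sqrt (nrm2 dX (s n - f))).
    rewrite -[X in _ --> X]sqrtr0.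
    apply: (cvg_comp _ _ cv); exact: sqrt_continuous.
  apply/funext => n; have sfL := L2_sub (H2_L2 (Npair_H2 (Ns n))) fL.
  by rewrite /sum_norm /nrm2 (dot_prod sfL sfL).
Qed.

Definition Nperp : set fn := [set v | H2 dX v /\ forall u, Npair u -> dot u v = 0].

Lemma Nperp_L2 v : Nperp v -> L2 dX v. Proof. by move=> [/H2_L2]. Qed.

Lemma Npair_ae u v : Npair u -> vmeas dX v -> ae_equal u v -> Npair v.
Proof.
move=> Nu mv uv; have uL := H2_L2 (Npair_H2 Nu); have vL := L2_ae uL mv uv.
have [_ _ _ cl] := Npair_closed; apply: (cl (fun=> u)) => //.
rewrite (_ : (fun n => _) = fun=> 0); first exact: cvg_cst.
apply/funext => _; rewrite /nrm2 (_ : dot _ _ = 0)//.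
rewrite -(dot0l dX 0); have uvL := L2_sub uL vL; have L0 := L2_0 dX.
have ae0 : ae_equal (u - v) 0.
  move/ae_use: uv; apply: circle_ae_imp => z h.
  by rewrite -[LHS]/(u z - v z) h subrr.
exact: dot_ae.
Qed.

(** The double complement theorem inside H^2: closedness of N turns membership into orthogonality
    relations. *)
Lemma Npair_perp u : H2 dX u -> (forall v, Nperp v -> dot u v = 0) -> Npair u.
Proof.
move=> uH u0; have uL := H2_L2 uH.
have [p [Np po]] := proj_exists Npair_closed uL.
have pH := Npair_H2 Np; have pL := H2_L2 pH; have upL := L2_sub uL pL.
have Yup : Nperp (u - p).
  split; first exact: H2_sub.
  by move=> q Nq; rewrite -(dotC upL (H2_L2 (Npair_H2 Nq))) (po _ Nq) conjC0.
have up0 : dot (u - p) (u - p) = 0 by rewrite dotBl// u0// Yup.2// subrr.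
have /ae_sub0 up := dot_eq0 upL up0.
apply: Npair_ae Np (L2_vmeas uL) _.
by move/ae_use: up; apply: circle_ae_imp => z ->.
Qed.

(* Through J, S_E (+) S_F^* is the compression of multiplication by z to the quotient of
   H^2_E (+) L^2_F by 0 (+) H^2_F; the annihilator of [liftset] is the preimage of N under
   this quotient map. *)
Definition liftset : set fn :=
  [set t | (exists2 v, Nperp v & t = flip2 v) \/
           (exists k x, k < 0 /\ t = zmul k (fun=> (x, 0)))].

Lemma liftset_L2 : liftset `<=` L2 dX.
Proof.
move=> t [[v Yv ->]|[k [x [_ ->]]]]; last exact: zcst_L2.
by apply: L2_flip2; exact: Nperp_L2.
Qed.

Local Notation M := (annih dX liftset).

Lemma part1_zmul k y : part1 (zmul k y) = zmul k (part1 y).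
Proof. by []. Qed.

Lemma part2_zmul k y : part2 (zmul k y) = zmul k (part2 y).
Proof. by []. Qed.

Lemma liftE y : M y <-> [/\ L2 dX y, H2 dE (part1 y) & forall v, Nperp v -> dot (flip2 y) v = 0].
Proof.
split=> [[yL y0]|[yL yH y0]].
  have /L2_prod[y1 y2] := yL; split => //.
    split => // k x k0; have := y0 (zmul k (fun=> (x, 0))).
    rewrite (dot_prod yL (zcst_L2 _ k (x, 0))).
    rewrite part2_zmul (_ : L2_dot dF _ _ = 0) ?addr0; last first.
      rewrite (_ : zmul k _ = 0) ?dot0r//.
      by apply/funext => z; rewrite /zmul /part2 /= scaler0.
    by rewrite part1_zmul dot_fourier; apply; right; exists k, x.
  by move=> v Yv; rewrite (dot_flip2 yL (Nperp_L2 Yv)); apply: y0; left; exists v.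
have /L2_prod[y1 y2] := yL; split => // t [[v Yv ->]|[k [x [k0 ->]]]].
  by rewrite -(dot_flip2 yL (Nperp_L2 Yv)); exact: y0.
rewrite (dot_prod yL (zcst_L2 _ k (x, 0))).
rewrite part2_zmul (_ : L2_dot dF _ _ = 0) ?addr0; last first.
  rewrite (_ : zmul k _ = 0) ?dot0r//.
  by apply/funext => z; rewrite /zmul /part2 /= scaler0.
by rewrite part1_zmul dot_fourier; exact: yH.2.
Qed.

(** The adjoint of [shift_sum] on H^2: the backward shift on E, as a compression of z^-1, and the
    forward shift on F. *)
Definition adjoint_shift v : fn :=
  fun z => (proj_H2 dE (zmul (-1) (part1 v)) z, zmul 1 (part2 v) z).

Lemma Nperp_adjoint_shift v : Nperp v -> Nperp (adjoint_shift v).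
Proof.
move=> [vH v0]; have /H2_prod[v1 v2] := vH.
have zL : L2 dE (zmul (-1) (part1 v)) by apply: L2_zmul; exact: H2_L2.
have [pH _] := proj_H2P zL.
have avH : H2 dX (adjoint_shift v) by apply/H2_prod; split; [exact: pH|exact: (H2_zmul (k := 1) isT v2)].
split => // u Nu; have uH := Npair_H2 Nu; have /H2_prod[u1 u2] := uH.
have [_ _ _ Nsh] := Ninv.
have Nsu := Nsh _ Nu.
have [saH sa] := shift_adjP u2.
pose su : fn := fun z => (zmul 1 (part1 u) z, shift_adj dF (part2 u) z).
have Nsu' : Npair su by exact: Nsu.
have := v0 _ Nsu'.
rewrite dot_prod; [|exact: H2_L2 (Npair_H2 Nsu')|exact: H2_L2].
rewrite dot_prod; [|exact: H2_L2|exact: H2_L2].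
move=> h; rewrite -[RHS]h; congr (_ + _).
  rewrite -[LHS](dotC (g := part1 u)); [|exact: H2_L2..].
  rewrite [X in Num.conj X]proj_H2_dot// dotC//; last exact: H2_L2.
  by rewrite -[RHS]/(L2_dot dE (zmul 1 (part1 u)) (part1 v)) dot_zmul.
rewrite -[LHS](dotC (g := part2 u)); [|exact: (H2_L2 (H2_zmul _ v2))|exact: H2_L2].
rewrite -[X in Num.conj X]/(L2_dot dF (shift (part2 v)) (part2 u)) sa//.
by rewrite (dotC (H2_L2 v2) (H2_L2 saH)).
Qed.

(** J turns multiplication by z into multiplication by z^-1. Hence [flip2] of z y pairs with [v] as
    [flip2] of y pairs with [adjoint_shift v], which is again in [Nperp]. *)
Lemma lift_inv y : M y -> M (zmul 1 y).
Proof.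
move=> /liftE[yL y1 y0]; apply/liftE; split; first exact: L2_zmul.
  by rewrite part1_zmul; exact: H2_zmul.
move=> v Yv; have vH := Yv.1; have /H2_prod[v1 v2] := vH.
have := y0 _ (Nperp_adjoint_shift Yv).
have aL := Nperp_L2 (Nperp_adjoint_shift Yv).
have zL : L2 dE (zmul (-1) (part1 v)) by apply: L2_zmul; exact: H2_L2.
rewrite (dot_prod (L2_flip2 yL) aL).
rewrite [in X in _ -> X]dot_prod; [|by apply: L2_flip2; exact: L2_zmul|exact: H2_L2].
move=> h; rewrite -[RHS]h; congr (_ + _).
  rewrite -[RHS](dotC (g := part1 y)) ; [|exact: H2_L2 (proj_H2P zL).1|exact: H2_L2].
  rewrite [X in Num.conj X]proj_H2_dot// dotC//; last exact: H2_L2.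
  by rewrite -[LHS]/(L2_dot dE (zmul 1 (part1 y)) (part1 v)) dot_zmul.
rewrite -[LHS]/(L2_dot dF (opJ (zmul 1 (part2 y))) (part2 v)) opJ_zmul dot_zmul.
by [].
Qed.

Lemma lift_H2 (q : circle R -> F) : H2 dF q -> M (fun z => (0, q z)).
Proof.
move=> qH; apply/liftE; split.
- by apply/L2_prod; split; [exact: L2_0|exact: H2_L2].
- exact: H2_0.
- move=> v Yv; have /H2_prod[v1 v2] := Yv.1.
  rewrite dot_prod; [|apply: L2_flip2; apply/L2_prod; split; [exact: L2_0|exact: H2_L2]|exact: Nperp_L2].
  rewrite -[X in X + _]/(L2_dot dE 0 (part1 v)) dot0l add0r.
  exact: (opJ_H2_orth qH v2).
Qed.

Lemma lift_flip2 u : Npair u -> M (flip2 u).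
Proof.
move=> Nu; have uH := Npair_H2 Nu; have /H2_prod[u1 u2] := uH; apply/liftE; split => //.
  by apply: L2_flip2; exact: H2_L2.
by move=> v Yv; rewrite flip2K; exact: Yv.2.
Qed.

(** The part removed by the projection is orthogonal to H^2_F, so elements of [Nperp] do not see
    it. *)
Lemma lift_proj y : M y -> Npair (fun z => (part1 y z, proj_H2 dF (opJ (part2 y)) z)).
Proof.
move=> /liftE[yL y1 y0]; have /L2_prod[_ y2] := yL; have y2J := L2_opJ y2.
have [pH po] := proj_H2P y2J.
have uH : H2 dX (fun z => (part1 y z, proj_H2 dF (opJ (part2 y)) z)) by apply/H2_prod.
apply: Npair_perp => // v Yv; have /H2_prod[v1 v2] := Yv.1.
rewrite -[RHS](y0 _ Yv) (dot_prod (H2_L2 uH) (Nperp_L2 Yv)).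
rewrite (dot_prod (L2_flip2 yL) (Nperp_L2 Yv)); congr (_ + _); exact: proj_H2_dot y2J v2.
Qed.

(** First components of M are analytic; one that stays analytic after division by every power of z
    has no Fourier coefficient left. *)
Lemma lift_infty1 y : M_infty dX liftset y -> ae_equal (part1 y) 0.
Proof.
move=> hy; have yL : L2 dX y by have := annih_L2 (hy 0%N); rewrite oppr0 zmul0.
have /L2_prod[y1 y2] := yL; apply: L2_uniqueness (y1) _ => k x.
have [n kn] : exists n : nat, k - n%:Z < 0 by exists `|k|%N.+1; lia.
have /liftE[_ [_ h] _] := hy n.
rewrite -(dot_zmul2 dE (- n%:Z)) zmulD dot_fourier; apply: h.
by rewrite addrC.
Qed.

End InvariantSubspace.
End DirectSumFunctions.

(** * Finite-rank operator functions and the blocks of the symbol *)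

Section RankOperators.
Variables (R : realType) (X : vectType R[i]) (dX : {dot X for conjC}).
Local Notation C := R[i].
Local Notation fn := (circle R -> X).
Local Notation dot := (L2_dot dX).

Lemma rank_op_lin m (p q : 'I_m -> fn) (a : C) y y' :
  rank_op dX p q (a *: y + y') = a *: rank_op dX p q y + rank_op dX p q y'.
Proof.
apply/funext => z; rewrite -[RHS]/(a *: rank_op dX p q y z + rank_op dX p q y' z).
rewrite /rank_op scaler_sumr -big_split /=; apply: eq_bigr => i _.
by rewrite -[(a *: y + y') z]/(a *: y z + y' z) dDl dZl scalerDl scalerA.
Qed.

Lemma rank_op_sub m (p q : 'I_m -> fn) y y' :
  rank_op dX p q (y - y') = rank_op dX p q y - rank_op dX p q y'.
Proof. by rewrite addrC -scaleN1r rank_op_lin scaleN1r addrC. Qed.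

Lemma rank_op_comp m (p q r : 'I_m -> fn) y z : onfamily dX (fun j => q j z) ->
  rank_op dX q r (rank_op dX p q y) z = rank_op dX p r y z.
Proof.
by move=> oq; rewrite /rank_op; apply: eq_bigr => i _; rewrite rank_op_coef.
Qed.

Lemma rank_op_isometry m (p q : 'I_m -> fn) y z : onfamily dX (fun j => q j z) ->
  dX (rank_op dX p q y z) (rank_op dX p q y z) = dX (y z) (rank_op dX p p y z).
Proof. by move=> oq; rewrite rank_op_adj rank_op_comp. Qed.

Lemma bessel m (p : 'I_m -> fn) y z : onfamily dX (fun j => p j z) ->
  dX (y z) (rank_op dX p p y z) <= dX (y z) (y z).
Proof.
move=> op; set q := rank_op dX p p y z.
have qq : dX q q = dX (y z) q by exact: rank_op_isometry.
have qy : dX q (y z) = dX (y z) q by exact: rank_op_adj.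
have := d_ge0 dX (y z - q).
by rewrite dBl !dBr qq qy subrr subr0 subr_ge0.
Qed.

Lemma dot_rank_op m (p q : 'I_m -> fn) x y :
  dot (rank_op dX p q y) x = dot y (rank_op dX q p x).
Proof. by congr circle_int; apply/funext => z; exact: rank_op_adj. Qed.

Section ConstantFamily.
Variables (m : nat) (w : 'I_m -> fn) (b : 'I_m -> X).
Hypothesis wunit : forall i, ae_unit dX (w i).
Hypothesis ow : circle_ae (fun z => onfamily dX (fun i => w i z)).
Hypothesis ob : onfamily dX b.
Let bc i : fn := fun=> b i.
Let bunit i : ae_unit dX (bc i). Proof. by apply: ae_unit_cst; rewrite ob eqxx. Qed.

Lemma H2_cst_rank_op h : H2 dX h -> H2 dX (rank_op dX bc bc h).
Proof.
move=> hH; split; first by apply: L2_rank_op => //; exact: H2_L2.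
move=> k x k0; rewrite -dot_fourier dot_rank_op.
(* The operator is constant on the circle; [expi 0] is an arbitrary point of evaluation. *)
rewrite (_ : rank_op _ _ _ _ = zmul k (fun=> rank_op dX bc bc (fun=> x) (expi 0))).
  by rewrite dot_fourier; exact: hH.2.
apply/funext => z; rewrite /rank_op /zmul scaler_sumr; apply: eq_bigr => i _.
by rewrite dZl scalerA.
Qed.

Lemma rank_op_cst_idem h : rank_op dX bc w (rank_op dX bc bc h) = rank_op dX bc w h.
Proof. by apply/funext => z; apply: rank_op_comp; exact: ob. Qed.

(** Where the w_i are orthonormal, Phi^* Phi is the projection on the span of the b_i, which may be
    a proper subspace. *)
Lemma rank_op_cst_norm h : L2 dX h ->
  dot (rank_op dX bc w h) (rank_op dX bc w h) = dot h (rank_op dX bc bc h).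
Proof.
move=> hL; apply: cint_ae.
- by apply: vmeas_dot; apply: L2_vmeas; exact: L2_rank_op.
- by apply: vmeas_dot; apply: L2_vmeas => //; exact: L2_rank_op.
- by apply: circle_ae_imp ow => z oz; exact: rank_op_isometry.
Qed.

Lemma rank_op_cst_le : circle_ae (fun z => forall x,
  dX (rank_op dX bc w (fun=> x) z) (rank_op dX bc w (fun=> x) z) <= dX x x).
Proof.
apply: circle_ae_imp ow => z oz x; rewrite rank_op_isometry//.
exact: (@bessel _ bc (fun=> x) z ob).
Qed.

End ConstantFamily.
End RankOperators.

Section Symbol.
Variable R : realType.
Variables (E F : vectType R[i]) (dE : {dot E for conjC}) (dF : {dot F for conjC}).
Local Notation C := R[i].
Local Notation X := (dsum E F).
Local Notation dX := (pdot dE dF).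
Local Notation fn := (circle R -> dsum E F).

Lemma hom_exists (U V : vectType C) (f : U -> V) :
  (forall a u v, f (a *: u + v) = a *: f u + f v) -> exists g : 'Hom(U, V), g =1 f.
Proof.
move=> lf; pose g := HB.pack_for {linear U -> V} f (GRing.isLinear.Build _ _ _ _ f lf).
by exists (linfun g) => x; rewrite lfunE.
Qed.

Section Blocks.
Variables (m : nat) (w : 'I_m -> fn) (b : 'I_m -> X).
Let bc i : fn := fun=> b i.
Local Notation Phi := (rank_op dX bc w).

Let Phi_at (z : circle R) (x : X) : X := Phi (fun=> x) z.

Let Phi_at_lin z a x x' : Phi_at z (a *: x + x') = a *: Phi_at z x + Phi_at z x'.
Proof. exact: (congr1 (fun f => f z) (rank_op_lin dX bc w a (fun=> x) (fun=> x'))). Qed.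

Lemma blocks_exist : exists S : symbol E F, forall z,
  [/\ forall x, symA S z x = (Phi (fun=> (x, 0)) z).1,
      forall x, symB S z x = (Phi (fun=> (0, x)) z).1,
      forall x, symC S z x = (Phi (fun=> (x, 0)) z).2 &
      forall x, symD S z x = (Phi (fun=> (0, x)) z).2].
Proof.
have lE (a : C) (u v : E) : (a *: u + v, 0) = a *: (u, 0) + (v, 0) :> X.
  by rewrite -[RHS]/(a *: u + v, a *: 0 + 0) scaler0 addr0.
have lF (a : C) (u v : F) : (0, a *: u + v) = a *: (0, u) + (0, v) :> X.
  by rewrite -[RHS]/(a *: 0 + 0, a *: u + v) scaler0 addr0.
have hA z : exists g : 'Hom(E, E), g =1 fun x => (Phi_at z (x, 0)).1.
  by apply: hom_exists => a u v; rewrite lE Phi_at_lin.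
have hB z : exists g : 'Hom(F, E), g =1 fun x => (Phi_at z (0, x)).1.
  by apply: hom_exists => a u v; rewrite lF Phi_at_lin.
have hC z : exists g : 'Hom(E, F), g =1 fun x => (Phi_at z (x, 0)).2.
  by apply: hom_exists => a u v; rewrite lE Phi_at_lin.
have hD z : exists g : 'Hom(F, F), g =1 fun x => (Phi_at z (0, x)).2.
  by apply: hom_exists => a u v; rewrite lF Phi_at_lin.
exists (Symbol (fun z => projT1 (cid (hA z))) (fun z => projT1 (cid (hB z)))
               (fun z => projT1 (cid (hC z))) (fun z => projT1 (cid (hD z)))).
by move=> z; split => x /=; case: cid => g /= ->.
Qed.

End Blocks.
End Symbol.


Section AeEqual.
Variables (R : realType) (T : Type).
Implicit Types f g h : circle R -> T.

Lemma ae_refl f : ae_equal f f. Proof. exact: circle_ae_all. Qed.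

Lemma ae_sym f g : ae_equal f g -> ae_equal g f.
Proof. by move/ae_use; apply: circle_ae_imp => z ->. Qed.

Lemma ae_trans f g h : ae_equal f g -> ae_equal g h -> ae_equal f h.
Proof.
move=> /ae_use fg /ae_use gh; have := circle_ae_and fg gh.
by apply: circle_ae_imp => z [-> ->].
Qed.

Lemma ae_comp (T' : Type) (k : T -> T') f g :
  ae_equal f g -> ae_equal (fun z => k (f z)) (fun z => k (g z)).
Proof. by move/ae_use; apply: circle_ae_imp => z ->. Qed.

Lemma circle_ae_flip (P : circle R -> Prop) : circle_ae P -> circle_ae (fun z => P (circle_conj z)).
Proof.
move=> [A [mA A0 sA]]; exists ((fun t : measurableTypeR R => - t : measurableTypeR R) @^-1` A).
split.
- rewrite -[X in measurable X]setTI.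
  by have := @oppr_measurable R setT; apply.
- by rewrite mu_flip.
- move=> t /= np; apply: sA => /= p; apply: np.
  by rewrite circle_conj_expi.
Qed.

End AeEqual.

Section ProjectionAe.
Variables (R : realType) (X : vectType R[i]) (dX : {dot X for conjC}).
Local Notation dot := (L2_dot dX).
Implicit Types f g h : circle R -> X.

Lemma dot_aer f g g' : L2 dX f -> L2 dX g -> L2 dX g' -> ae_equal g g' -> dot f g = dot f g'.
Proof. by move=> fL gL gL' gg; apply: dot_ae => //; exact: ae_refl. Qed.

Lemma dot_ael f g g' : L2 dX f -> L2 dX g -> L2 dX g' -> ae_equal g g' -> dot g f = dot g' f.
Proof. by move=> fL gL gL' gg; apply: dot_ae => //; exact: ae_refl. Qed.

Lemma opJ_ae f g : ae_equal f g -> ae_equal (opJ f) (opJ g).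
Proof.
move=> /ae_use /circle_ae_flip; apply: circle_ae_imp => z h.
by rewrite /opJ h.
Qed.

Lemma proj_H2_ae f g : L2 dX f -> L2 dX g -> ae_equal f g ->
  ae_equal (proj_H2 dX f) (proj_H2 dX g).
Proof.
move=> fL gL fg; have [gH _] := proj_H2P gL; apply: proj_H2_eq => // h hH.
by rewrite proj_H2_dot//; apply: dot_ael => //; exact: H2_L2.
Qed.

Lemma proj_H2_add f g : L2 dX f -> L2 dX g ->
  ae_equal (proj_H2 dX f + proj_H2 dX g) (proj_H2 dX (f + g)).
Proof.
move=> fL gL; have [fH _] := proj_H2P fL; have [gH _] := proj_H2P gL.
apply: ae_sym; apply: proj_H2_eq; [exact: L2_add|exact: H2_add|move=> h hH].
have hL := H2_L2 hH.
rewrite (dotDl fL gL hL) (dotDl (H2_L2 fH) (H2_L2 gH) hL).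
by rewrite (proj_H2_dot fL hH) (proj_H2_dot gL hH).
Qed.

Lemma ae_add f f' g g' : ae_equal f f' -> ae_equal g g' -> ae_equal (f + g) (f' + g').
Proof.
move=> /ae_use ff /ae_use gg; have := circle_ae_and ff gg; apply: circle_ae_imp => z [h1 h2].
by rewrite -[LHS]/(f z + g z) h1 h2.
Qed.

(** The converse of [opJ_H2_orth]: a frequency k < 0 of [f] is the frequency - k - 1 >= 0 of
    [opJ f]. *)
Lemma opJ_perp_H2 f : L2 dX f -> (forall h, H2 dX h -> dot (opJ f) h = 0) -> H2 dX f.
Proof.
move=> fL f0; split => // k x k0; rewrite -dot_fourier -(opJK f).
have jL := L2_opJ fL; rewrite (dot_opJ jL (zcst_L2 dX k x)) opJ_zmul [opJ (fun=> x)]opJE zmulD.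
by apply: f0; apply: H2_monomial; lia.
Qed.

Lemma nrm2_ae f g : L2 dX f -> L2 dX g -> ae_equal f g -> nrm2 dX f = nrm2 dX g.
Proof. by move=> fL gL fg; rewrite /nrm2; congr complex.Re; exact: dot_ae. Qed.

End ProjectionAe.


(** * Range, kernel and isometry of V_Phi *)

Section PartialIsometry.
Variable R : realType.
Variables (E F : vectType R[i]) (dE : {dot E for conjC}) (dF : {dot F for conjC}).
Local Notation C := R[i].
Local Notation X := (dsum E F).
Local Notation dX := (pdot dE dF).
Local Notation fn := (circle R -> dsum E F).
Local Notation dot := (L2_dot dX).
Variable N : set (sumfun E F).
Hypothesis Ninv : invariant_subspace dE dF N.
Local Notation S := (liftset dE dF N).
Local Notation M := (annih dX S).
Let SL : S `<=` L2 dX := liftset_L2 (N := N).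
Let Minv : forall y, M y -> M (zmul 1 y) := lift_inv Ninv.
Hypothesis Minf : forall y, (forall k : nat, M (zmul (- k%:Z) y)) -> ae_equal y 0.
Variables (m : nat) (w : 'I_m -> fn) (b : 'I_m -> X).
Hypothesis fw : wandering_family dX S w.
Hypothesis wmax : forall v, wandering dX S v -> (forall i, dot v (w i) = 0) ->
  ae_equal v 0.
Hypothesis ob : onfamily dX b.
Let bc i : fn := fun=> b i.
Local Notation Phi := (rank_op dX bc w).
Local Notation Psi := (rank_op dX w bc).
Local Notation Q := (rank_op dX bc bc).
Variable T : symbol E F.
Hypothesis TE : forall z,
  [/\ forall x, symA T z x = (Phi (fun=> (x, 0)) z).1,
      forall x, symB T z x = (Phi (fun=> (0, x)) z).1,
      forall x, symC T z x = (Phi (fun=> (x, 0)) z).2 &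
      forall x, symD T z x = (Phi (fun=> (0, x)) z).2].

Let Phi_M h : H2 dX h -> M (Phi h).
Proof. exact: (synthesis_mem SL Minv fw ob). Qed.
Let Psi_H2 y : M y -> H2 dX (Psi y).
Proof. exact: (analysis_H2 Minv fw ob). Qed.
Let Phi_Psi y : M y -> ae_equal y (Phi (Psi y)).
Proof. exact: (analysis_synthesis SL Minv fw wmax ob Minf). Qed.
Let wunit i : ae_unit dX (w i).
Proof. exact: (wandering_family_unit Minv i fw). Qed.
Let ow : circle_ae (fun z => onfamily dX (fun i => w i z)).
Proof. exact: (wandering_family_ae Minv fw). Qed.
Let annih_L2' y : M y -> L2 dX y. Proof. by case. Qed.

Let cst_H2 (x : X) : H2 dX (fun=> x).
Proof. by have := H2_monomial dX x (lexx 0); rewrite zmul0. Qed.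

(** Treats the four blocks at once: [inj] is isometric, [pr] contractive, and Phi(z) a contraction
    a.e., so 1 is a bound. *)
Let block_Linfty (U V : vectType C) (dU : {dot U for conjC}) (dV : {dot V for conjC})
    (G : circle R -> 'Hom(V, U)) (inj : V -> X) (pr : X -> U) :
  (forall z x, G z x = pr (Phi (fun=> inj x) z)) ->
  (forall x, L2 dU (fun z => pr (Phi (fun=> inj x) z))) ->
  (forall v, dU (pr v) (pr v) <= dX v v) ->
  (forall x, dX (inj x) (inj x) = dV x x) -> Linfty dV dU G.
Proof.
move=> GE GL pr_le inj_eq; split=> [x y|].
  by under eq_fun do rewrite GE; exact: (GL x).1.
exists 1; have := rank_op_cst_le ow ob; apply: circle_ae_imp => z hz x.
rewrite mul1r GE; have h : dU (pr (Phi (fun=> inj x) z)) (pr (Phi (fun=> inj x) z)) <= dV x x.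
  by rewrite -inj_eq; apply: le_trans (pr_le _) (hz _).
by move: h; rewrite !vnorm_sq lecR ler_pXn2r ?nnegrE ?sqrtr_ge0.
Qed.

Lemma symbol_Gamma : Gamma_infty dE dF T.
Proof.
have ML x : M (Phi (fun=> x)) by apply: Phi_M; exact: cst_H2.
have PL x : L2 dE (part1 (Phi (fun=> x))) /\ L2 dF (part2 (Phi (fun=> x))).
  by apply/L2_prod; exact: annih_L2' (ML x).
have PH x : H2 dE (part1 (Phi (fun=> x))) by have /liftE[] := ML x.
have le1 (v : X) : dE v.1 v.1 <= dX v v by rewrite lerDl d_ge0.
have le2 (v : X) : dF v.2 v.2 <= dX v v by rewrite lerDr d_ge0.
have i1 (x : E) : dX (x, 0) (x, 0) = dE x x by rewrite /= /pdot /= /prod_dot /= d0l addr0.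
have i2 (x : F) : dX (0, x) (0, x) = dF x x by rewrite /= /pdot /= /prod_dot /= d0l add0r.
split.
- split.
    apply: (block_Linfty (inj := fun x => (x, 0)) (pr := fst)) => //.
      by move=> z x; have [-> _ _ _] := TE z.
    by move=> x; exact: (PL (x, 0)).1.
  move=> k x y k0; rewrite (_ : (fun z => dE (symA T z x) y) =
    fun z => dE (part1 (Phi (fun=> (x, 0))) z) y); first exact: (PH (x, 0)).2.
  by apply/funext => z; have [-> _ _ _] := TE z.
- split.
    apply: (block_Linfty (inj := fun x => (0, x)) (pr := fst)) => //.
      by move=> z x; have [_ -> _ _] := TE z.
    by move=> x; exact: (PL (0, x)).1.
  move=> k x y k0; rewrite (_ : (fun z => dE (symB T z x) y) =
    fun z => dE (part1 (Phi (fun=> (0, x))) z) y); first exact: (PH (0, x)).2.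
  by apply/funext => z; have [_ -> _ _] := TE z.
- apply: (block_Linfty (inj := fun x => (x, 0)) (pr := snd)) => //.
    by move=> z x; have [_ _ -> _] := TE z.
  by move=> x; exact: (PL (x, 0)).2.
- apply: (block_Linfty (inj := fun x => (0, x)) (pr := snd)) => //.
    by move=> z x; have [_ _ _ ->] := TE z.
  by move=> x; exact: (PL (0, x)).2.
Qed.

Definition pairf (h : sumfun E F) : fn := fun z => (h.1 z, h.2 z).

Lemma pairf_H2 h : H2sum dE dF h -> H2 dX (pairf h).
Proof. by move=> [h1 h2]; apply/H2_prod. Qed.

Local Notation V := (V_op dE dF T).

(** The four block terms recombine by additivity of the projection. The Toeplitz projections change
    nothing a.e., as the first component of an element of M is already analytic. *)
Lemma V_opE h : H2sum dE dF h -> let y := Phi (pairf h) in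
  sum_ae_equal (V h) (part1 y, proj_H2 dF (opJ (part2 y))) /\ H2sum dE dF (V h).
Proof.
move=> [h1 h2] y.
pose ha : fn := fun z => (h.1 z, 0); pose hb : fn := fun z => (0, h.2 z).
have haM : M (Phi ha).
  by apply: Phi_M; apply/H2_prod; split; [exact: h1|exact: (H2_0 dF)].
have hbM : M (Phi hb).
  by apply: Phi_M; apply/H2_prod; split; [exact: (H2_0 dE)|exact: h2].
have yE : y = Phi ha + Phi hb.
  have := rank_op_lin dX bc w 1 ha hb; rewrite !scale1r => <-; congr rank_op.
  by apply/funext => z; rewrite -[RHS]/(h.1 z + 0, 0 + h.2 z) addr0 add0r.
have yE1 : part1 y = part1 (Phi ha) + part1 (Phi hb) by rewrite yE.
have yE2 : opJ (part2 y) = opJ (part2 (Phi ha)) + opJ (part2 (Phi hb)).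
  by rewrite -opJ_add yE.
have AE : (fun z => symA T z (h.1 z)) = part1 (Phi ha).
  by apply/funext => z; have [-> _ _ _] := TE z.
have BE : (fun z => symB T z (h.2 z)) = part1 (Phi hb).
  by apply/funext => z; have [_ -> _ _] := TE z.
have CE : (fun z => symC T z (h.1 z)) = part2 (Phi ha).
  by apply/funext => z; have [_ _ -> _] := TE z.
have DE : (fun z => symD T z (h.2 z)) = part2 (Phi hb).
  by apply/funext => z; have [_ _ _ ->] := TE z.
have /liftE[aL a1 _] := haM; have /liftE[bL b1 _] := hbM.
have /L2_prod[_ a2] := aL; have /L2_prod[_ b2] := bL.
have Ja2 := L2_opJ a2; have Jb2 := L2_opJ b2.
have [pa1 _] := proj_H2P (H2_L2 a1); have [pb1 _] := proj_H2P (H2_L2 b1).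
have [pa2 _] := proj_H2P Ja2; have [pb2 _] := proj_H2P Jb2.
rewrite /V_op /toeplitz /hankel AE BE CE DE yE1 yE2.
split; split.
- exact: (ae_add (proj_H2_id a1) (proj_H2_id b1)).
- exact: (proj_H2_add Ja2 Jb2).
- exact: (H2_add pa1 pb1).
- exact: (H2_add pa2 pb2).
Qed.

Lemma V_of u h : H2sum dE dF u -> H2sum dE dF h ->
  ae_equal (Phi (pairf h)) (flip2 (pairf u)) -> sum_ae_equal u (V h).
Proof.
move=> [u1 u2] hH yu; have [[e1 e2] _] := V_opE hH.
have yM := Phi_M (pairf_H2 hH); have /L2_prod[_ y2] := annih_L2' yM.
split; apply: ae_sym.
  apply: ae_trans e1 _; exact: (ae_comp fst yu).
apply: ae_trans e2 _ => /=.
apply: ae_trans (proj_H2_id u2).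
apply: proj_H2_ae; [exact: L2_opJ|exact: H2_L2|].
by rewrite -[u.2](opJK u.2); apply: opJ_ae; exact: (ae_comp snd yu).
Qed.

(** An element u of N is the image of Psi (flip2 u), because Phi Psi is the identity on M.
    Conversely, V h is the compression of an element of M, which is in N by [lift_proj]. *)
Lemma range_N : N = op_range dE dF V.
Proof.
have [sN _ _ _] := Ninv.
apply/seteqP; split => u.
  move=> Nu; have uH := sN _ Nu; split => //.
  have Np : Npair N (pairf u) by move: Nu; rewrite /Npair /=; case: (u).
  have yM := lift_flip2 Ninv Np; have hH := Psi_H2 yM; have /H2_prod[h1 h2] := hH.
  exists (part1 (Psi (flip2 (pairf u))), part2 (Psi (flip2 (pairf u)))); first by split.
  apply: (@V_of u (_, _) uH (conj h1 h2)); apply: ae_sym.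
  rewrite (_ : pairf (_, _) = Psi (flip2 (pairf u))); first exact: Phi_Psi.
  by apply/funext => z; rewrite /pairf /part1 /part2 /=; case: (Psi _ z).
move=> [uH [h hH [e1 e2]]]; have [[v1 v2] _] := V_opE hH.
have yM := Phi_M (pairf_H2 hH).
have Nv := lift_proj Ninv yM.
have : Npair N (pairf u).
  apply: (Npair_ae Ninv Nv); first exact: L2_vmeas (H2_L2 (pairf_H2 uH)).
  have := circle_ae_and (ae_use (ae_trans e1 v1)) (ae_use (ae_trans e2 v2)).
  by apply: circle_ae_imp => z /= [h1 h2]; rewrite /pairf h1 h2.
by rewrite /Npair /=; case: (u).
Qed.

(** Together with [ker_elim] this describes the kernel as the preimage of 0 (+) H^2_F under Phi,
    H^2_F being exactly what is killed by J followed by the projection. *)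
Lemma ker_of k q : H2sum dE dF k -> H2 dF q ->
  ae_equal (Phi (pairf k)) (fun z => (0, q z)) -> op_ker dE dF V k.
Proof.
move=> kH qH kq; split => //; have [[e1 e2] _] := V_opE kH.
have yM := Phi_M (pairf_H2 kH); have /L2_prod[_ y2] := annih_L2' yM.
split => /=; first by apply: ae_trans e1 (ae_comp fst kq).
apply: ae_trans e2 _ => /=.
apply: proj_H2_eq; [exact: L2_opJ|exact: H2_0|move=> h hH].
have hL := H2_L2 hH; have qL := H2_L2 qH.
rewrite [RHS]dot0l -(opJ_H2_orth qH hH).
apply: (dot_ael hL (L2_opJ y2) (L2_opJ qL)).
by apply: opJ_ae; exact: (ae_comp snd kq).
Qed.

Lemma ker_elim k : op_ker dE dF V k -> exists2 q, H2 dF q &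
  ae_equal (Phi (pairf k)) (fun z => (0, q z)).
Proof.
move=> [kH [k1 k2]]; have [[e1 e2] _] := V_opE kH.
have yM := Phi_M (pairf_H2 kH); have /L2_prod[_ y2] := annih_L2' yM.
exists (part2 (Phi (pairf k))).
  apply: opJ_perp_H2 => // h hH.
  rewrite -proj_H2_dot//; last exact: L2_opJ.
  have [pH _] := proj_H2P (L2_opJ y2).
  rewrite -(dot0l dF h); apply: dot_ael; [exact: H2_L2|exact: H2_L2|exact: L2_0|].
  exact: ae_trans (ae_sym e2) k2.
have := ae_use (ae_trans (ae_sym e1) k1); apply: circle_ae_imp => z /= h.
rewrite [LHS]surjective_pairing; congr (_, _); exact: h.
Qed.

Lemma sum_dot_pairf h k : H2sum dE dF h -> H2sum dE dF k ->
  sum_dot dE dF h k = dot (pairf h) (pairf k).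
Proof. by move=> hH kH; rewrite dot_prod//; apply: H2_L2; exact: pairf_H2. Qed.

(** Two kernel vectors are tested. Orthogonality to Psi (0, q), where (0, q) is the part of Phi h
    removed by V, shows that nothing is removed; orthogonality to h - Q h shows that Phi preserves
    the norm of h. *)
Lemma ker_perp_norm h : op_ker_perp dE dF V h ->
  sum_norm dE dF (V h) = sum_norm dE dF h.
Proof.
move=> [hH hk]; have hH' := pairf_H2 hH; have hL := H2_L2 hH'.
have ker_dot k : H2 dX k -> (exists2 q, H2 dF q & ae_equal (Phi k) (fun z => (0, q z))) ->
    dot (pairf h) k = 0.
  move=> kH [q qH kq]; have kE : pairf (part1 k, part2 k) = k.
    by apply/funext => z; rewrite /pairf /part1 /part2 /=; case: (k z).
  have kS : H2sum dE dF (part1 k, part2 k) by have /H2_prod := kH.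
  rewrite -kE -sum_dot_pairf//; apply: hk; apply: (ker_of kS qH).
  by rewrite kE.
set y := Phi (pairf h); have yM : M y by exact: Phi_M.
have yL := annih_L2' yM; have /L2_prod[y1 y2] := yL; have Jy2 := L2_opJ y2.
have Nu := lift_proj Ninv yM.
set u : fn := (fun z => _) in Nu; have uL := H2_L2 (Npair_H2 Ninv Nu).
have y'M : M (flip2 u) by exact: lift_flip2.
(* y' is the component of y orthogonal to 0 (+) H^2_F, so y - y' has the form (0, q) with q in
   H^2_F. *)
set y' := flip2 u in y'M; have y'L := annih_L2' y'M.
have dM : M (y - y') by apply: annih_sub.
have dL := annih_L2' dM.
pose q := part2 y - opJ (proj_H2 dF (opJ (part2 y))).
have [pH po] := proj_H2P Jy2.
have qL : L2 dF q by exact: (L2_sub y2 (L2_opJ (H2_L2 pH))).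
have Jq : opJ q = opJ (part2 y) - proj_H2 dF (opJ (part2 y)).
  by rewrite /q opJ_sub opJK.
have qH : H2 dF q by apply: opJ_perp_H2 => // g gH; rewrite Jq; exact: po.
have dE' : y - y' = fun z => (0, q z).
  apply/funext => z; rewrite -[LHS]/(y z - y' z) [y z]surjective_pairing.
  by rewrite -[LHS]/((y z).1 - (y z).1, q z) subrr.
have hd : dot (pairf h) (Psi (y - y')) = 0.
  apply: ker_dot; first exact: Psi_H2.
  by exists q => //; rewrite -dE'; apply: ae_sym; exact: Phi_Psi.
have yd : dot y (y - y') = 0 by rewrite dot_rank_op.
have y'd : dot y' (y - y') = 0.
  rewrite /y' (dot_flip2 uL dL) (dot_prod uL (L2_flip2 dL)).
  rewrite dE' -[part1 (flip2 _)]/(0 : circle R -> E) dot0r add0r.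
  rewrite -[part2 (flip2 _)]/(opJ q) -[part2 u]/(proj_H2 dF (opJ (part2 y))).
  rewrite -dotC; [|exact: L2_opJ|exact: H2_L2].
  by rewrite Jq po ?conjC0.
have yy' : ae_equal y y'.
  apply: ae_sub0; apply: (dot_eq0 dL).
  by rewrite (dotBl yL y'L dL) yd y'd subrr.
have nV : sum_norm dE dF (V h) = Num.sqrt (nrm2 dX u).
  have [[e1 e2] VH] := V_opE hH.
  rewrite /sum_norm sum_dot_pairf// -/(nrm2 dX (pairf (V h))); congr Num.sqrt.
  apply: (nrm2_ae (H2_L2 (pairf_H2 VH)) uL).
  have := circle_ae_and (ae_use e1) (ae_use e2).
  by apply: circle_ae_imp => z [h1 h2]; congr (_, _); [exact: h1|exact: h2].
rewrite nV /sum_norm sum_dot_pairf// -/(nrm2 dX (pairf h)); congr Num.sqrt.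
transitivity (nrm2 dX y).
  rewrite (nrm2_ae yL y'L yy') /nrm2 {1}/y' (dot_flip2 uL y'L).
  by rewrite flip2K.
rewrite /nrm2; congr complex.Re.
rewrite (rank_op_cst_norm wunit ow ob hL).
have QH := H2_cst_rank_op ob hH'.
apply/esym/eqP; rewrite -subr_eq0 -(dotBr hL hL (H2_L2 QH)); apply/eqP.
apply: ker_dot; first exact: H2_sub.
exists 0; first exact: H2_0.
rewrite rank_op_sub (rank_op_cst_idem w ob) subrr.
exact: ae_refl.
Qed.

Lemma V_partial_isometry : partial_isometry dE dF V.
Proof.
split; first exact: ker_perp_norm.
move=> u ru; have [uH _] := ru.
have Nu : N u by rewrite range_N.
have Np : Npair N (pairf u) by move: Nu; rewrite /Npair /=; case: (u).
have yM := lift_flip2 Ninv Np; have hH := Psi_H2 yM; have /H2_prod[h1 h2] := hH.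
set y := flip2 (pairf u) in yM hH h1 h2; have yL := annih_L2' yM.
have pE : pairf (part1 (Psi y), part2 (Psi y)) = Psi y.
  by apply/funext => z; rewrite /pairf /part1 /part2 /=; case: (Psi _ z).
have hS : H2sum dE dF (part1 (Psi y), part2 (Psi y)) by split.
exists (part1 (Psi y), part2 (Psi y)); last first.
  by apply: V_of => //; rewrite pE; apply: ae_sym; exact: Phi_Psi.
(* The pairing of Psi y with a kernel vector k is that of y with Phi k = (0, q), that is, of J u_2
   with q in H^2_F. *)
split => // k kk; have kH := kk.1; have [q qH kq] := ker_elim kk.
rewrite sum_dot_pairf// pE dot_rank_op.
have qM : L2 dX (fun z => (0, q z)).
  by apply/L2_prod; split; [exact: (L2_0 dE)|exact: H2_L2].
rewrite (dot_aer yL (annih_L2' (Phi_M (pairf_H2 kH))) qM kq).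
rewrite (dot_prod yL qM) (_ : part1 (fun z => (0, q z)) = 0)// dot0r add0r.
exact: (opJ_H2_orth uH.2 qH).
Qed.

End PartialIsometry.

(** * The case in which N contains 0 (+) H^2_F *)

Definition subdot (R : realType) (U : vectType R[i]) (dU : {dot U for conjC})
  (W : {vspace U}) : {dot (subvs_of W) for conjC} := @sub_dot R U dU W.

Section Subspaces.
Variables (R : realType) (U : vectType R[i]) (dU : {dot U for conjC}).
Local Notation C := R[i].

Lemma subvs0 (x : subvs_of (0%VS : {vspace U})) : vsval x = 0.
Proof. by apply/eqP; rewrite -memv0; exact: subvsP. Qed.

Lemma vsproj_fullK (x : U) : vsval (vsproj fullv x) = x.
Proof. by rewrite vsprojK// memvf. Qed.

Lemma sub_dot_L2 (f : circle R -> subvs_of (fullv : {vspace U})) :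
  L2 (subdot dU fullv) f <-> L2 dU (fun z => vsval (f z)).
Proof.
split=> -[mf fi]; split => // e.
  by have := mf (vsproj fullv e); rewrite /= /sub_dot vsproj_fullK.
exact: (mf (vsval e)).
Qed.

Lemma sub_dot_H2 (f : circle R -> subvs_of (fullv : {vspace U})) :
  H2 (subdot dU fullv) f <-> H2 dU (fun z => vsval (f z)).
Proof.
split=> -[/sub_dot_L2 fL fk]; split => // k e k0.
  by have := fk k (vsproj fullv e) k0; rewrite /= /sub_dot vsproj_fullK.
exact: (fk k (vsval e) k0).
Qed.

(** The two adjoints are independent choices of representatives, so they are compared only a.e.,
    through their pairings with H^2. *)
Lemma sub_shift_adj (f : circle R -> subvs_of (fullv : {vspace U})) :
  H2 (subdot dU fullv) f ->
  ae_equal (shift_adj dU (fun z => vsval (f z)))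
           (fun z => vsval (shift_adj (subdot dU fullv) f z)).
Proof.
move=> fH; have [sH s] := shift_adjP fH.
have fH' : H2 dU (fun z => vsval (f z)) by apply/sub_dot_H2.
have [tH t] := shift_adjP fH'.
have sH' : H2 dU (fun z => vsval (shift_adj (subdot dU fullv) f z)) by apply/sub_dot_H2.
apply: (H2_eq_ae tH sH') => h hH.
have hH' : H2 (subdot dU fullv) (fun z => vsproj fullv (h z)).
  by apply/sub_dot_H2; under eq_fun do rewrite vsproj_fullK.
rewrite -(dotC (H2_L2 hH) (H2_L2 tH)) -(dotC (H2_L2 hH) (H2_L2 sH')).
congr (Num.conj _); rewrite -(t _ hH); have := s _ hH'.
rewrite (_ : L2_dot _ (shift _) f = L2_dot dU (shift h) (fun z => vsval (f z))).
  move=> ->; congr circle_int; apply/funext => z.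
  by rewrite /= /sub_dot vsproj_fullK.
congr circle_int; apply/funext => z; rewrite /= /sub_dot /shift linearZ /=.
by rewrite vsproj_fullK.
Qed.

End Subspaces.

Section FullSpace.
Variable R : realType.
Variables (E F : vectType R[i]) (dE : {dot E for conjC}) (dF : {dot F for conjC}).

Lemma H2sum_invariant : invariant_subspace dE dF (H2sum dE dF).
Proof.
split=> //.
- split; first by split; exact: H2_0.
  by move=> a u v [u1 u2] [v1 v2]; split; exact: H2_lin.
- move=> u [u1 u2]; split; first exact: (H2_zmul (k := 1)).
  by have [] := shift_adjP u2.
Qed.

End FullSpace.

Section SplitCase.
Variable R : realType.
Variables (E F : vectType R[i]) (dE : {dot E for conjC}) (dF : {dot F for conjC}).
Local Notation C := R[i].
Variable N : set (sumfun E F).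
Hypothesis Ninv : invariant_subspace dE dF N.
Hypothesis N_H2 : forall q, H2 dF q -> N (fun=> 0, q).
Local Notation dE1 := (subdot dE fullv).
Local Notation dE2 := (subdot dE 0%VS).
Local Notation dF1 := (subdot dF 0%VS).
Local Notation dF2 := (subdot dF fullv).

(** The slice of N with second component 0; the complementary summand is the whole of H^2_F. *)
Let N1 : set (sumfun (subvs_of (fullv : {vspace E})) (subvs_of (0%VS : {vspace F}))) :=
  [set u | H2sum dE1 dF1 u /\ N (fun z => vsval (u.1 z), fun=> 0)].

Let N_ae u v : N u -> H2sum dE dF v -> ae_equal u.1 v.1 -> ae_equal u.2 v.2 -> N v.
Proof.
move=> Nu vH uv1 uv2.
have Npu : Npair N (fun z => (u.1 z, u.2 z)) by move: Nu; rewrite /Npair /=; case: (u).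
have vH' : H2 (pdot dE dF) (fun z => (v.1 z, v.2 z) : dsum E F).
  by apply/H2_prod; case: vH.
have := Npair_ae Ninv Npu (L2_vmeas (H2_L2 vH')) _.
rewrite /Npair /=; case: (v) uv1 uv2 => v1 v2 /= /ae_use uv1 /ae_use uv2; apply.
by have := circle_ae_and uv1 uv2; apply: circle_ae_imp => z [-> ->].
Qed.

Let N1_invariant : invariant_subspace dE1 dF1 N1.
Proof.
have [sN [N0 Nlin] Ncl Nsh] := Ninv; split.
- by move=> u [].
- split.
    split; first by split; exact: H2_0.
    by under [X in N (X, _)]eq_fun do rewrite linear0.
  move=> a u v [[u1 u2] Nu] [[v1 v2] Nv]; split; first by split; exact: H2_lin.
  have := Nlin a _ _ Nu Nv; congr (N (_, _)); apply/funext => z.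
  by rewrite /= scaler0 addr0.
- move=> s u Ns uH cv; split => //.
  apply: (Ncl (fun n => (fun z => vsval ((s n).1 z), fun=> 0))).
  + by move=> n; have [] := Ns n.
  + by split; [apply/sub_dot_H2; case: uH|exact: (H2_0 dF)].
  + move: cv; rewrite (_ : (fun n => sum_norm dE1 dF1 _) = (fun n => sum_norm dE dF
      ((fun z => vsval ((s n).1 z), (fun=> 0) : circle R -> F).1 - (fun z => vsval (u.1 z), (fun=> 0) : circle R -> F).1,
       (fun z => vsval ((s n).1 z), (fun=> 0) : circle R -> F).2 - (fun z => vsval (u.1 z), (fun=> 0) : circle R -> F).2)))//.
    apply/funext => n; rewrite /sum_norm /sum_dot; congr (Num.sqrt (complex.Re (_ + _))).
    congr circle_int; apply/funext => z; rewrite /= /sub_dot subvs0 d0l.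
    by rewrite -[X in dF X _]/(0 - 0 : F) subrr d0l.
- move=> u [[u1 u2] Nu]; split.
    split; first exact: (H2_zmul (k := 1)).
    by have [] := shift_adjP u2.
  have := Nsh _ Nu => Nsu.
  have u1' : H2 dE (fun z => vsval (u.1 z)) by apply/sub_dot_H2.
  apply: (N_ae Nsu) => /=.
  + split; last exact: (H2_0 dF).
    exact: ((sub_dot_H2 dE (shift u.1)).1 (H2_zmul (k := 1) isT u1)).
  + exact: ae_refl.
  + have [sH s] := shift_adjP (H2_0 dF).
    apply: (H2_eq_ae sH (H2_0 dF)) => h hH.
    by rewrite -(dotC (H2_L2 hH) (H2_L2 sH)) -s// dot0r conjC0 dot0l.
Qed.

(** The unitary is the identity, with E_1 = E, F_2 = F and the other two subspaces zero. Subtracting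
    (0, u_2), which lies in N, from an element u of N leaves an element of the slice. *)
Lemma split_of_H2 (dimE : (0 < \dim (fullv : {vspace E}))%N)
  (dimF : (0 < \dim (fullv : {vspace F}))%N) : splitting dE dF N.
Proof.
have [sN [N0 Nlin] Ncl Nsh] := Ninv.
exists fullv, 0%VS, 0%VS, fullv, \1%VF => /=; split.
- split; split; rewrite ?addv0 ?add0v// => x y.
    by move=> _; rewrite memv0 => /eqP ->; rewrite d0r.
  by rewrite memv0 => /eqP -> _; rewrite d0l.
- by rewrite !dimv0 addn0 add0n.
- by split; [move=> x y; rewrite !lfunE|rewrite lim1g].
- move=> u v [u1 u2] [v1 v2]; split.
    apply: circle_ae_all => z; rewrite /= /shift !lfunE /=.
    by rewrite scalerDr.
  rewrite /shift_sum /const_op /direct_merge /=.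
  under [X in ae_equal (shift_adj dF X)]eq_fun do rewrite lfunE /= subvs0 add0r.
  apply: ae_trans (sub_shift_adj v2) _.
  by apply: circle_ae_all => z; rewrite lfunE /= subvs0 add0r.
- exists N1, (H2sum dE2 dF2); split; [exact: N1_invariant|exact: H2sum_invariant|].
  apply/seteqP; split => u.
    move=> Nu; have uH := sN _ Nu; split => //; have [u1 u2] := uH.
    exists (fun z => vsproj fullv (u.1 z), fun=> 0), (fun=> 0, fun z => vsproj fullv (u.2 z)).
    split.
    + split.
        split; last exact: H2_0.
        by apply/sub_dot_H2; under eq_fun do rewrite vsproj_fullK.
      have := Nlin (-1) _ _ (N_H2 u2) Nu; congr (N (_, _)); apply/funext => z /=.
        by rewrite scaler0 add0r vsproj_fullK.
      by rewrite scaleN1r addNr.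
    + split; first exact: H2_0.
      by apply/sub_dot_H2; under eq_fun do rewrite vsproj_fullK.
    + split; apply: circle_ae_all => z; rewrite /const_op /direct_merge /= lfunE /=.
        by rewrite vsproj_fullK addr0.
      by rewrite add0r vsproj_fullK.
  move=> [uH [v [v' [[[v1 v2] Nv] [v1' v2'] [e1 e2]]]]].
  have Nv' : N (fun=> 0, fun z => vsval (v'.2 z)) by apply: N_H2; apply/sub_dot_H2.
  apply: (N_ae (Nlin 1 _ _ Nv Nv') uH) => /=.
    apply: ae_sym; apply: ae_trans e1 _; apply: circle_ae_all => z.
    by rewrite /const_op /direct_merge /= lfunE /= subvs0 scale1r.
  apply: ae_sym; apply: ae_trans e2 _; apply: circle_ae_all => z.
  by rewrite /const_op /direct_merge /= lfunE /= subvs0 scaler0.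
Qed.

End SplitCase.

(** * The line F and the conclusion *)

Section OneDimensional.
Variables (R : realType) (F : vectType R[i]) (dF : {dot F for conjC}).

Lemma unit_vector_exists : \dim (fullv : {vspace F}) = 1%N ->
  exists f0, dF f0 f0 = 1 /\ forall x, x = dF x f0 *: f0.
Proof.
move=> dimF; have := @onb_expand _ _ dF; have := @onbP _ _ dF.
move: (onb dF); rewrite dimF => e oe ex; exists (e ord0); split.
  by rewrite oe eqxx.
by move=> x; rewrite {1}[x]ex big_ord1.
Qed.

End OneDimensional.

Theorem theorem1p5 (R : realType) (E F : vectType R[i])
    (dE : {dot E for Num.conj}%R) (dF : {dot F for Num.conj}%R)
    (dimE : (0 < \dim (fullv : {vspace E}))%N)
    (dimF : \dim (fullv : {vspace F}) = 1%N)
    (N : set (sumfun E F)) :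
  invariant_subspace dE dF N -> ~ splitting dE dF N ->
  exists Phi : symbol E F,
    Gamma_infty dE dF Phi /\
    partial_isometry dE dF (V_op dE dF Phi) /\
    N = op_range dE dF (V_op dE dF Phi).
Proof.
move=> Ninv nsplit.
have [f0 [f01 f0E]] := unit_vector_exists dF dimF.
pose dX := (pdot dE dF).
pose S := liftset dE dF N.
have SL : S `<=` L2 dX := liftset_L2 (N := N).
have Minv := lift_inv Ninv.
pose f : dsum E F := (0, f0).
have ff : dX f f = 1 by rewrite /dX /= /pdot /= /prod_dot /= d0l add0r f01.
have fH : H2 dF (fun=> f0) by have := H2_monomial dF f0 (lexx 0); rewrite zmul0.
have Me : annih dX S (fun=> f) := lift_H2 dE N fH.
have scal y : M_infty dX S y -> circle_ae (fun z => y z = dX (y z) f *: f).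
  move=> /lift_infty1 /ae_use; apply: circle_ae_imp => z y1.
  rewrite [LHS]surjective_pairing [RHS]surjective_pairing.
  have -> : dX (y z) f = dF (y z).2 f0.
    by rewrite /dX /= /pdot /= /prod_dot /= d0r add0r.
  congr (_, _); first by rewrite -[RHS]/(_ *: 0) scaler0; exact: y1.
  exact: f0E.
have [Minf|Me'] := M_infty_dichotomy SL Minv ff Me scal.
  have [m [w [fw wmax]]] := wandering_maximal SL Minv.
  have mle := wandering_family_dim Minv fw.
  (* As m is at most the dimension of E (+) F, the first m vectors of an orthonormal basis can serve
     as the b_i. *)
  pose b i := onb dX (widen_ord mle i).
  have ob : onfamily dX b by move=> i j; rewrite /b onbP.
  have [T TE] := blocks_exist dE dF w b.
  exists T; split; first exact: (symbol_Gamma Ninv fw ob TE).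
  split; first exact: (V_partial_isometry Ninv Minf fw wmax ob TE).
  exact: (range_N Ninv Minf fw wmax ob TE).
(* Here M contains z^j f for every integer j. Elements of [Nperp] then have second component 0, so N
   contains 0 (+) H^2_F. *)
exfalso; apply: nsplit; apply: split_of_H2 => //; last by rewrite dimF.
have Mz (j : int) : annih dX S (zmul j (fun=> f)).
  by case: j => n; [exact: (M_zmul Minv)|rewrite NegzE; exact: Me'].
move=> q qH; apply: (Npair_perp Ninv (u := fun z => (0, q z) : dsum E F)).
  by apply/H2_prod; split => //; exact: (H2_0 dE).
move=> v Yv; have vH := Yv.1; have /H2_prod[v1 v2] := vH.
have qL : L2 dX (fun z => (0, q z)).
  by apply/L2_prod; split; [exact: (L2_0 dE)|exact: H2_L2].
have v20 : ae_equal (part2 v) 0.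
  apply: (L2_uniqueness (H2_L2 v2)) => k x.
  (* The exponent is chosen so that J sends z^(-k-1) f0 to z^k f0. *)
  have /liftE[zL _ /(_ _ Yv)] := Mz (- k - 1).
  rewrite (dot_prod (L2_flip2 zL) (H2_L2 vH)).
  rewrite (_ : part1 (flip2 _) = 0); last first.
    by apply/funext => z; exact: scaler0.
  rewrite dot0l add0r.
  rewrite (_ : part2 (flip2 _) = zmul k (fun=> f0)); last first.
    rewrite -[LHS]/(opJ (zmul (- k - 1) (fun=> f0))) opJ_zmul opJE zmulD.
    by congr (zmul _ _); lia.
  move=> h; have := dotC (zcst_L2 dF k f0) (H2_L2 v2); rewrite h conjC0 => /esym h'.
  rewrite (_ : zmul k _ = dF x f0 *: zmul k (fun=> f0)); last first.
    by rewrite -zmul_scale; congr zmul; apply/funext => z; exact: f0E.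
  by rewrite (dotZr _ (H2_L2 v2) (zcst_L2 dF k f0)) h' mulr0.
rewrite (dot_prod qL (H2_L2 vH)) (_ : part1 (fun z => (0, q z)) = 0)// dot0l add0r.
rewrite (dot_aer (H2_L2 qH) (H2_L2 v2) (L2_0 dF) v20).
exact: dot0r.
Qed.
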